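(* Let $p=p_n$ satisfy $n\geq p+5$ and $\lim_{n\to\infty}p/n=y\in(0,1]$. Let $\mathbf{X}=(\mathbf{y}_1,\dots,\mathbf{y}_p)$ be an $n\times p$ random matrix whose columns $\mathbf{y}_1,\dots,\mathbf{y}_p$ are independent random vectors, each having an $n$-variate spherical distribution (the distributions may differ) with $P(\mathbf{y}_i=\mathbf{0})=0$ for all $i$. Let $\mathbf{R}_n=(r_{ij})_{p\times p}$ with $r_{ij}$ the Pearson correlation coefficient between $\mathbf{y}_i$ and $\mathbf{y}_j$. Then $(\log|\mathbf{R}_n|-\mu_n)/\sigma_n$ converges in distribution to $N(0,1)$ as $n\to\infty$, where $$\mu_n=\Big(p-n+\frac32\Big)\log\Big(1-\frac p{n-1}\Big)-\frac{n-2}{n-1}p,\qquad \sigma_n^2=-2\Big[\frac p{n-1}+\log\Big(1-\frac p{n-1}\Big)\Big].$$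
   Context: A random vector $\mathbf{x}\in\mathbb{R}^n$ has a spherical distribution if $\mathbf{O}\mathbf{x}$ and $\mathbf{x}$ have the same distribution for every $n\times n$ orthogonal matrix $\mathbf O$. For $\mathbf{x}=(x_1,\dots,x_n)',\mathbf{y}=(y_1,\dots,y_n)'\in\mathbb{R}^n$, the Pearson correlation coefficient is $r_{\mathbf x,\mathbf y}=\frac{\sum_{i=1}^n(x_i-\bar x)(y_i-\bar y)}{\sqrt{\sum_{i=1}^n(x_i-\bar x)^2\sum_{i=1}^n(y_i-\bar y)^2}}$ with $\bar x=\frac1n\sum x_i$, $\bar y=\frac1n\sum y_i$. $|\cdot|$ denotes the determinant. *)

(* Defs.v *)
From HB Require Import structures.
From mathcomp Require Import all_boot all_order all_algebra.
From mathcomp Require Import all_classical all_reals all_analysis.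
Set Implicit Arguments. Unset Strict Implicit. Unset Printing Implicit Defensive.
Import Order.TTheory GRing.Theory Num.Theory.
Import numFieldNormedType.Exports.
Local Open Scope classical_set_scope.
Local Open Scope ring_scope.

(* Vectors of R^n are represented as n.-tuple R, which MathComp-Analysis
   equips with the product (Borel) sigma-algebra generated by the coordinates. *)

Definition tuple_cV (R : realType) (n : nat) (x : n.-tuple R) : 'cV[R]_n :=
  \col_(i < n) tnth x i.
Definition cV_tuple (R : realType) (n : nat) (v : 'cV[R]_n) : n.-tuple R :=
  [tuple v i ord0 | i < n].

Definition mx_act (R : realType) (n : nat) (O : 'M[R]_n) (x : n.-tuple R)
  : n.-tuple R := cV_tuple (O *m tuple_cV x).

Definition orthogonal_mx (R : realType) (n : nat) (O : 'M[R]_n) : Prop :=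
  O *m O^T = 1%:M.

Definition spherical (d : measure_display) (T : measurableType d)
  (R : realType) (P : probability T R) (n : nat) (x : T -> n.-tuple R) : Prop :=
  forall O : 'M[R]_n, orthogonal_mx O ->
  forall A : set (n.-tuple R), measurable A ->
    P ((fun t => mx_act O (x t)) @^-1` A) = P (x @^-1` A).

Definition independent_vectors (d : measure_display) (T : measurableType d)
  (R : realType) (P : probability T R) (n m : nat)
  (x : 'I_m -> T -> n.-tuple R) : Prop :=
  forall (J : {set 'I_m}) (A : 'I_m -> set (n.-tuple R)),
    (forall i, measurable (A i)) ->
    P (\bigcap_(i in [set i | i \in J]) (x i @^-1` A i)) =
    (\prod_(i in J) P (x i @^-1` A i))%E.

Definition mean_tuple (R : realType) (n : nat) (x : n.-tuple R) : R :=
  (\sum_(i < n) tnth x i) / n%:R.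

Definition pearson (R : realType) (n : nat) (x y : n.-tuple R) : R :=
  (\sum_(i < n) (tnth x i - mean_tuple x) * (tnth y i - mean_tuple y)) /
  Num.sqrt ((\sum_(i < n) (tnth x i - mean_tuple x) ^+ 2) *
            (\sum_(i < n) (tnth y i - mean_tuple y) ^+ 2)).

Definition corr_mx (R : realType) (n p : nat) (y : 'I_p -> n.-tuple R)
  : 'M[R]_p := \matrix_(i, j) pearson (y i) (y j).

Definition mu_n (R : realType) (n p : nat) : R :=
  (p%:R - n%:R + 3 / 2) * ln (1 - p%:R / (n%:R - 1))
  - (n%:R - 2) / (n%:R - 1) * p%:R.

Definition sigma_n (R : realType) (n p : nat) : R :=
  Num.sqrt (- 2 * (p%:R / (n%:R - 1) + ln (1 - p%:R / (n%:R - 1)))).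

Definition std_normal_cdf (R : realType) (x : R) : \bar R :=
  normal_prob 0 1 `]-oo, x].

(* convergence in distribution of Z_n (Z_n defined on (T n, P n)) to N(0,1):
   the cdfs converge at every point (all points are continuity points). *)
Definition cvg_dist_std_normal (d : measure_display) (T : nat -> measurableType d)
  (R : realType) (P : forall n, probability (T n) R) (Z : forall n, T n -> R)
  : Prop :=
  forall x : R,
    P n [set t | Z n t <= x] @[n --> \oo] --> std_normal_cdf x.

(* Main.v *)
(** Appending the column [k] (numbered from 0) to the matrix multiplies the
    determinant of the correlation matrix by a ratio [B_k] of sums of squares of
    coordinates of this column in an orthonormal basis that depends on the
    previous columns only. By sphericity and independence, [B_k] is thus
    independent of the previous determinant and has the beta law with parameters
    [(n - 1 - k) / 2] and [k / 2], of which only the moments [E B^j] for [j <= 4]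
    and the bound on [E 1/B] are used; they come from a Stein identity obtained by
    infinitesimal rotations. Writing [q = n - 1 - k], Taylor expansions of the
    logarithm show that the mean and variance of [ln B_k] agree with the
    increments of [mu_n] and [sigma_n ^+ 2] up to [O(q^-2)], with third absolute
    moment [O(q^(-3/2))]. Lindeberg's replacement method, with exact Gaussian
    increments, then bounds the error on a smooth test function by a multiple of
    [(sigma_n * sqrt (n - 1 - p))^-1], which tends to 0 because
    [sigma_n ^+ 2 >= (p / (n - 1)) ^+ 2] and
    [sigma_n ^+ 2 >= 2 * ln ((n - 1) / (n - 1 - p)) - 2]. *)

Require Import Defs.
From HB Require Import structures.
From mathcomp Require Import all_boot all_order all_algebra.
From mathcomp Require Import all_classical all_reals all_analysis.
From mathcomp Require Import measurable_realfun ring lra zify.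
Set Implicit Arguments. Unset Strict Implicit. Unset Printing Implicit Defensive.
Import Order.TTheory GRing.Theory Num.Theory.
Import numFieldNormedType.Exports.
Local Open Scope classical_set_scope.
Local Open Scope ring_scope.

(** * Determinants of correlation matrices *)

(** No density is computed and no law is identified: all that is used of a spherical vector is its
    invariance under rotations. The inverse moment is there because [ln B] is unbounded near 0,
    where polynomial moments say nothing. The delicate case is [y = 1]: [n - p] may then stay
    bounded, and the errors [q^(-3/2)] of the last columns are not small by themselves. All
    estimates are therefore uniform in [q >= 5], which [n >= p + 5] ensures for every [k < p]. The
    errors are summed by telescoping against [2 / sqrt q]. When [n - 1 - p] stays bounded, [sigma_n]
    tends to infinity and the normalization alone makes the sum negligible. The ratios are never
    treated as a joint independent family. The step from [k] to [k.+1] columns freezes the first [k]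
    and integrates over the last one, for a test function already convolved with the Gaussian that
    stands for the remaining columns. This convolution preserves the constants of Taylor expansions,
    so that one constant serves all steps. *)

Lemma mxE11 (R : realType) (M : 'M[R]_1) : M = (M ord0 ord0)%:M.
Proof. exact: mx11_scalar. Qed.

Lemma row_sqr_ge0 (R : realType) n (v : 'rV[R]_n) : 0 <= (v *m v^T) ord0 ord0.
Proof.
by rewrite mxE; apply: sumr_ge0 => i _; rewrite mxE -expr2 sqr_ge0.
Qed.

Lemma row_sqr_eq0 (R : realType) n (v : 'rV[R]_n) :
  (v *m v^T) ord0 ord0 = 0 -> v = 0.
Proof.
rewrite mxE => /eqP; rewrite psumr_eq0; last first.
  by move=> i _; rewrite mxE -expr2 sqr_ge0.
move=> /allP h; apply/rowP => j; rewrite mxE.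
have := h j (mem_index_enum _); rewrite mxE /= mulf_eq0 orbb => /eqP.
by rewrite (_ : 0 = ord0 :> 'I_1).
Qed.

(** The reflection [1 - (2 / |v|^2) v^T v] with [v = a - |a| e_0] sends [a] to [|a| e_0]. If
    [v = 0], then [a] already lies on the first axis and the identity serves. *)
Lemma householder (R : realType) n (a : 'rV[R]_n.+1) :
  exists H : 'M[R]_n.+1, H *m H^T = 1%:M /\
    forall j, j != ord0 -> (a *m H) ord0 j = 0.
Proof.
set nr := Num.sqrt ((a *m a^T) ord0 ord0).
have [v vE] : exists v : 'rV[R]_n.+1, v = a - nr *: delta_mx ord0 ord0.
  by eexists.
have [v0|v0] := eqVneq v 0.
  exists 1%:M; split; first by rewrite trmx1 mulmx1.
  move=> j j0; rewrite mulmx1.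
  move/eqP: v0; rewrite vE subr_eq0 => /eqP ->.
  by rewrite !mxE eqxx (negbTE j0) /= mulr0.
set s := (v *m v^T) ord0 ord0.
have s0 : s != 0 by apply: contra_neq v0 => /row_sqr_eq0.
have vvT : v *m v^T = s%:M by rewrite [LHS]mxE11.
have nr2 : nr ^+ 2 = (a *m a^T) ord0 ord0 by rewrite sqr_sqrtr// row_sqr_ge0.
have aaT : a *m a^T = (nr ^+ 2)%:M by rewrite [LHS]mxE11 nr2.
have ae : a *m (delta_mx ord0 ord0)^T = (a ord0 ord0)%:M.
  rewrite [LHS]mxE11; congr (_%:M); rewrite trmx_delta -colE mxE.
  by [].
have ea : delta_mx ord0 ord0 *m a^T = (a ord0 ord0)%:M :> 'M[R]_1.
  by rewrite -[LHS]trmxK trmx_mul trmxK ae tr_scalar_mx.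
have ee : (delta_mx ord0 ord0 : 'rV[R]_n.+1) *m (delta_mx ord0 ord0)^T
   = 1%:M.
  rewrite trmx_delta mul_delta_mx; apply/matrixP => i j.
  by rewrite !mxE !ord1 /=.
have vT : v^T = a^T - nr *: (delta_mx ord0 ord0)^T.
  by rewrite vE linearB /= linearZ.
have av : a *m v^T = (nr ^+ 2 - nr * a ord0 ord0)%:M.
  rewrite vT mulmxBr aaT -scalemxAr ae.
  by rewrite scale_scalar_mx -raddfB.
(* This says that [|v|^2] is twice the scalar product of [a] and [v]; hence the image of [a] is
   [a - v]. *)
have sE : s = 2 * (nr ^+ 2 - nr * a ord0 ord0).
  have : v *m v^T = (2 * (nr ^+ 2 - nr * a ord0 ord0))%:M.
    rewrite {1}vE mulmxBl av -scalemxAl vT mulmxBr.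
    rewrite ea -scalemxAr ee !scale_scalar_mx -!raddfB /= scale_scalar_mx.
    by rewrite -raddfB /=; congr (_%:M); ring.
  by rewrite vvT => /matrixP/(_ ord0 ord0); rewrite !mxE eqxx !mulr1n.
exists (1%:M - (2 / s) *: (v^T *m v)); split.
  have tr : (1%:M - (2 / s) *: (v^T *m v))^T = 1%:M - (2 / s) *: (v^T *m v).
    by rewrite linearB /= linearZ /= trmx_mul trmxK trmx1.
  rewrite tr mulmxBl mul1mx mulmxBr mulmx1 -scalemxAl -scalemxAr scalerA.
  rewrite mulmxA -(mulmxA _ v) vvT scalar_mxC.
  rewrite mul_scalar_mx -scalemxAl scalerA.
  rewrite (_ : 2 / s * (2 / s) * s = 2 / s + 2 / s); last by field.
  by rewrite scalerDl opprB addrK subrK.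
move=> j j0.
rewrite mulmxBr mulmx1 -scalemxAr mulmxA av mul_scalar_mx scalerA.
rewrite (_ : 2 / s * _ = 1); last by rewrite mulrAC -sE divff.
rewrite scale1r vE opprB addrC subrK !mxE eqxx (negbTE j0) /=.
by rewrite mulr0.
Qed.

(** LQ factorization: a Householder reflection clears the first row, then the induction treats the
    lower right block. Reflections, unlike Gram-Schmidt, do not care whether the rows are linearly
    dependent. *)
Lemma orthogonal_lower (R : realType) n k (A : 'M[R]_(k, n)) :
  exists2 O : 'M[R]_n, orthogonal_mx O &
    forall (i : 'I_k) (j : 'I_n), (i < j)%N -> (A *m O^T) i j = 0.
Proof.
elim: n k A => [|n IH] k A.
  exists 1%:M; first by rewrite /orthogonal_mx trmx1 mulmx1.
  by move=> i [].
case: k A => [|k] A; first by exists 1%:M;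
  [rewrite /orthogonal_mx trmx1 mulmx1|case].
have [H [HH aH]] := @householder R n (row ord0 A).
pose A' : 'M[R]_(1 + k, 1 + n) := A *m H.
have [Q Qo Qz] := IH k (drsubmx A').
pose O1 : 'M[R]_(1 + n) := block_mx 1%:M 0 0 Q.
have O1o : O1 *m O1^T = 1%:M.
  rewrite /O1 tr_block_mx mulmx_block !(trmx0, mulmx0, mul0mx, addr0, add0r).
  by rewrite trmx1 mulmx1 Qo -scalar_mx_block.
exists (O1 *m H^T : 'M[R]_n.+1).
  rewrite /orthogonal_mx trmx_mul trmxK mulmxA.
  by rewrite -(mulmxA _ H^T) (mulmx1C HH) mulmx1.
have -> : A *m (O1 *m H^T)^T = A' *m O1^T by rewrite trmx_mul trmxK mulmxA.
rewrite -[A']submxK /O1 tr_block_mx mulmx_block.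
rewrite !(trmx0, mulmx0, mul0mx, addr0, add0r, trmx1, mulmx1).
have ur0 : ursubmx A' = 0.
  apply/matrixP => i j; rewrite !mxE.
  have := aH (rshift 1 j) isT; rewrite mxE => aH0.
  apply: etrans aH0; apply: eq_bigr => l _.
  by rewrite !mxE; congr (A _ _ * _); apply/val_inj; rewrite /= ord1.
rewrite ur0 mul0mx.
move=> i j.
have [i' ->|i' ->] := @split_ordP 1 k i; have [j' ->|j' ->] := @split_ordP 1 n j.
- by rewrite !ord1.
- by move=> _; rewrite (@block_mxEur R 1 k 1 n) mxE.
- by rewrite /= ord1.
- by rewrite /= !add1n ltnS => ij; rewrite (@block_mxEdr R 1 k 1 n) Qz.
Qed.

(** The factor [1 / n] is left out, as it cancels in correlations. *)
Definition cov (R : realType) n (x y : n.-tuple R) : R :=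
  \sum_(i < n) (tnth x i - mean_tuple x) * (tnth y i - mean_tuple y).

Lemma cov_ge0 (R : realType) n (x : n.-tuple R) : 0 <= cov x x.
Proof. by apply: sumr_ge0 => i _; rewrite -expr2 sqr_ge0. Qed.

Lemma pearsonE (R : realType) n (x y : n.-tuple R) :
  pearson x y = (Num.sqrt (cov x x))^-1 * cov x y * (Num.sqrt (cov y y))^-1.
Proof.
rewrite /pearson -/(cov x y).
have -> (z : n.-tuple R) : \sum_(i < n) (tnth z i - mean_tuple z) ^+ 2 = cov z z.
  by apply: eq_bigr => i _; rewrite expr2.
by rewrite sqrtrM ?cov_ge0// invfM mulrCA mulrA.
Qed.

(** The correlation matrix is the Gram matrix multiplied on both sides by the diagonal matrix of
    inverse norms. Thanks to [0^-1 = 0] this covers constant columns too. *)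
Lemma det_corr_mx (R : realType) n k (w : 'I_k -> n.-tuple R) :
  \det (corr_mx w) =
  (\prod_i (cov (w i) (w i))^-1) * \det (\matrix_(i, j) cov (w i) (w j)).
Proof.
pose s i := (Num.sqrt (cov (w i) (w i)))^-1.
have -> : corr_mx w = diag_mx (\row_i s i) *m
    (\matrix_(i, j) cov (w i) (w j)) *m diag_mx (\row_i s i).
  apply/matrixP => i j; rewrite mul_diag_mx mul_mx_diag !mxE pearsonE.
  by [].
rewrite !det_mulmx det_diag mulrAC -big_split /=; congr (_ * _).
apply: eq_bigr => i _; rewrite !mxE /s -invfM -expr2 sqr_sqrtr ?cov_ge0//.
Qed.

(* Coordinates are numbered from 0, so that [resid k] has [n - 1 - k] terms.
   Coordinate 0 is the direction of the constant vector, hence [resid 0 z] is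
   the sum of squares of the centered vector. *)
Definition resid (R : realType) n k (z : n.-tuple R) : R :=
  \sum_(j < n | (k < j)%N) tnth z j ^+ 2.

Definition resid_ratio (R : realType) n k (z : n.-tuple R) : R :=
  resid k z / resid 0 z.

Lemma tnth_mx_act (R : realType) n (O : 'M[R]_n) (x : n.-tuple R) i :
  tnth (mx_act O x) i = \sum_j O i j * tnth x j.
Proof.
rewrite tnth_mktuple mxE; apply: eq_bigr => j _; congr (_ * _).
by rewrite mxE.
Qed.

Lemma mx_act_dot (R : realType) n (O : 'M[R]_n) (x y : n.-tuple R) :
  orthogonal_mx O ->
  \sum_i tnth (mx_act O x) i * tnth (mx_act O y) i =
  \sum_i tnth x i * tnth y i.
Proof.
move=> Oo.
have E (a b : n.-tuple R) : \sum_i tnth a i * tnth b i =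
    ((tuple_cV a)^T *m tuple_cV b) ord0 ord0.
  by rewrite mxE; apply: eq_bigr => i _; rewrite !mxE.
have K (v : 'cV[R]_n) : tuple_cV (cV_tuple v) = v.
  by apply/colP => i; rewrite mxE tnth_mktuple.
rewrite !E !K trmx_mul mulmxA -(mulmxA _ O^T).
by rewrite (mulmx1C Oo) mulmx1.
Qed.

(** The rows of [O] of positive index are orthogonal to the constant vector [e], so [O e] lies on
    axis 0. Centering thus amounts to dropping coordinate 0. *)
Lemma cov_rotate (R : realType) n (O : 'M[R]_n.+1) (x y : n.+1.-tuple R) :
  orthogonal_mx O ->
  (forall j : 'I_n.+1, (0 < j)%N -> \sum_i O j i = 0) ->
  cov x y = \sum_(j < n.+1 | (0 < j)%N)
    tnth (mx_act O x) j * tnth (mx_act O y) j.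
Proof.
move=> Oo O0.
pose e : n.+1.-tuple R := [tuple 1 | i < n.+1].
have eE i : tnth e i = 1 by rewrite tnth_mktuple.
have Oe (j : 'I_n.+1) : (0 < j)%N -> tnth (mx_act O e) j = 0.
  by move=> /O0 <-; rewrite tnth_mx_act; apply: eq_bigr => i _; rewrite eE mulr1.
have dotD (a b : n.+1.-tuple R) : \sum_i tnth a i * tnth b i =
    tnth (mx_act O a) ord0 * tnth (mx_act O b) ord0 +
    \sum_(j < n.+1 | (0 < j)%N) tnth (mx_act O a) j * tnth (mx_act O b) j.
  rewrite -(mx_act_dot a b Oo) (bigD1 ord0) //=; congr (_ + _).
  by apply: eq_bigl => i; rewrite lt0n.
(* [c] is the norm of [e] up to its sign, which disappears in [c ^+ 2 = n.+1]. *)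
set c := tnth (mx_act O e) ord0.
have de a : \sum_i tnth a i = tnth (mx_act O a) ord0 * c.
  rewrite (_ : \sum_i tnth a i = \sum_i tnth a i * tnth e i); last first.
    by apply: eq_bigr => i _; rewrite eE mulr1.
  rewrite dotD [X in _ + X]big1 ?addr0// => j j0.
  by rewrite Oe ?mulr0.
have cc : c ^+ 2 = n.+1%:R.
  have := de e; rewrite -/c -expr2 => <-.
  by under eq_bigr do rewrite eE; rewrite sumr_const card_ord.
have n0 : n.+1%:R != 0 :> R by rewrite pnatr_eq0.
have covE : cov x y = \sum_i tnth x i * tnth y i -
    (\sum_i tnth x i) * (\sum_i tnth y i) / n.+1%:R.
  rewrite /cov /mean_tuple.
  set sx := \sum_i tnth x i; set sy := \sum_i tnth y i.
  transitivity (\sum_i (tnth x i * tnth y i - tnth x i * (sy / n.+1%:R)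
     - tnth y i * (sx / n.+1%:R) + sx / n.+1%:R * (sy / n.+1%:R))).
    by apply: eq_bigr => i _; ring.
  rewrite big_split /= !sumrB -!mulr_suml -/sx -/sy sumr_const card_ord.
  rewrite -(mulr_natr sx).
  by move: (n.+1%:R : R) n0 => N n0; field.
rewrite covE dotD !de.
rewrite (_ : _ * c * _ / _ = tnth (mx_act O x) ord0 * tnth (mx_act O y) ord0).
  by rewrite addrAC subrr add0r.
have c0 : c != 0 by apply: contra_neq n0 => c0; rewrite -cc c0 expr0n.
by rewrite -cc; field.
Qed.

(** The first [k] vectors only have coordinates 1 to [k] (coordinate 0 does not count). Scalar
    products are unchanged if the coordinates of [w k] beyond [k] are merged into one coordinate [s]
    of the same length. The Gram matrix is then [M *m M^T], where the last column of [M] is zero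
    except for [s] at the bottom. *)
Lemma det_gram_last (R : realType) n k (w : nat -> n.-tuple R) (O : 'M[R]_n) :
  (k < n)%N ->
  (forall i j, cov (w i) (w j) = \sum_(l < n | (0 < l)%N)
    tnth (mx_act O (w i)) l * tnth (mx_act O (w j)) l) ->
  (forall i (j : 'I_n), (i < k)%N -> (i.+1 < j)%N ->
     tnth (mx_act O (w i)) j = 0) ->
  \det (\matrix_(i < k.+1, j < k.+1) cov (w i) (w j)) =
  \det (\matrix_(i < k, j < k) cov (w i) (w j)) * resid k (mx_act O (w k)).
Proof.
case: n w O => // n w O kn covE w0.
pose z i (l : nat) : R := tnth (mx_act O (w i)) (inord l).
have covz i j : cov (w i) (w j) = \sum_(1 <= l < n.+1) z i l * z j l.
  rewrite covE big_geq_mkord; apply: eq_big => l; first by rewrite /= lt0n.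
  by rewrite /z inord_val.
have z0 i l : (i < k)%N -> (i.+1 < l)%N -> (l < n.+1)%N -> z i l = 0.
  by move=> ik il ln; rewrite /z w0// inordK.
pose s := Num.sqrt (resid k (mx_act O (w k))).
have s2 : s * s = resid k (mx_act O (w k)).
  by rewrite -expr2 sqr_sqrtr// sumr_ge0// => i _; rewrite sqr_ge0.
have residE : resid k (mx_act O (w k)) = \sum_(k.+1 <= l < n.+1) z k l * z k l.
  rewrite big_geq_mkord; apply: eq_big => l; first by [].
  by rewrite /z inord_val expr2.
have covsplit i j : cov (w i) (w j) = \sum_(l < k) z i l.+1 * z j l.+1 +
    \sum_(k.+1 <= l < n.+1) z i l * z j l.
  by rewrite covz (@big_cat_nat _ _ _ k.+1)//= big_add1 /= big_mkord.
have tail0 i j : (i < k)%N || (j < k)%N ->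
    \sum_(k.+1 <= l < n.+1) z i l * z j l = 0.
  move=> ijk; rewrite big_nat_cond big1// => l; rewrite andbT => /andP[kl ln].
  case/orP: ijk => ijk; first by rewrite (z0 i) ?mul0r// (leq_trans _ kl).
  by rewrite (z0 j) ?mulr0// (leq_trans _ kl).
pose L : 'M[R]_k := \matrix_(i, j) z i j.+1.
pose M : 'M[R]_k.+1 := \matrix_(i, j)
  (if (j < k)%N then z i j.+1 else if (i < k)%N then 0 else s).
have -> : \matrix_(i < k, j < k) cov (w i) (w j) = L *m L^T.
  apply/matrixP => i j; rewrite !mxE covsplit tail0 ?ltn_ord// addr0.
  by apply: eq_bigr => l _; rewrite !mxE.
have -> : \matrix_(i < k.+1, j < k.+1) cov (w i) (w j) = M *m M^T.
  apply/matrixP => i j; rewrite !mxE covsplit big_ord_recr /=; congr (_ + _).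
    by apply: eq_bigr => l _; rewrite !mxE /= ltn_ord.
  rewrite !mxE /= ltnn.
  have [ik|ik] := ltnP i k; first by rewrite tail0 ?ik// mul0r.
  have [jk|jk] := ltnP j k; first by rewrite tail0 ?jk ?orbT// mulr0.
  have -> : nat_of_ord i = k by apply/eqP; rewrite eqn_leq ik -ltnS ltn_ord.
  have -> : nat_of_ord j = k by apply/eqP; rewrite eqn_leq jk -ltnS ltn_ord.
  by rewrite -residE s2.
rewrite !det_mulmx !det_tr -s2.
suff -> : \det M = \det L * s by ring.
rewrite (expand_det_col M ord_max) (bigD1 ord_max) //= big1 ?addr0; last first.
  move=> i ni; rewrite !mxE /= ltnn ifT ?mul0r//.
  by rewrite ltn_neqAle -ltnS ltn_ord andbT.
rewrite !mxE /= !ltnn /cofactor /= -signr_odd addnn odd_double expr0 mul1r.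
rewrite mulrC; congr (\det _ * _).
apply/matrixP => i j; rewrite !mxE /= /bump.
have ki (l : 'I_k) : (k <= l)%N = false by rewrite leqNgt ltn_ord.
by rewrite !ki /= !add0n ltn_ord.
Qed.

(* Conditionally on the first [k] columns, the determinant of the correlation
   matrix gets multiplied by a ratio of sums of squares of the coordinates of
   the next column in an orthonormal basis depending on these columns only.
   Both sides vanish when a column is constant, as [pearson] is then [0]. *)
Lemma det_corr_recr (R : realType) n k (w : nat -> n.-tuple R) : (k < n)%N ->
  exists2 O : 'M[R]_n, orthogonal_mx O & forall y : n.-tuple R,
  \det (corr_mx (fun i : 'I_k.+1 => if (i < k)%N then w i else y)) =
  \det (corr_mx (fun i : 'I_k => w i)) * resid_ratio k (mx_act O y).
Proof.
case: n w => // n w kn.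
(* The constant row in front makes one LQ factorization yield both properties of [O]: its rows of
   positive index are orthogonal to constants, and column [i] has no coordinate beyond [i.+1]. *)
pose A : 'M[R]_(k.+1, n.+1) := \matrix_(i, j)
  (if i == 0 :> nat then 1 else tnth (w i.-1) j).
have [/= O Oo AO] := orthogonal_lower A.
exists O => // y.
pose w' i := if (i < k)%N then w i else y.
change (\det (corr_mx (fun i : 'I_k.+1 => w' i)) =
  \det (corr_mx (fun i : 'I_k => w i)) * resid_ratio k (mx_act O y)).
have O0 (j : 'I_n.+1) : (0 < j)%N -> \sum_i O j i = 0.
  move=> j0; apply: etrans (AO ord0 j j0); rewrite mxE.
  by apply: eq_bigr => l _; rewrite !mxE /= mul1r.
have w0 i (j : 'I_n.+1) : (i < k)%N -> (i.+1 < j)%N ->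
    tnth (mx_act O (w' i)) j = 0.
  move=> ik ij; have ik' : (i.+1 < k.+1)%N by [].
  apply: etrans (AO (Ordinal ik') j ij); rewrite mxE.
  rewrite tnth_mx_act /w' ik; apply: eq_bigr => l _.
  by rewrite !mxE /= mulrC.
have cr i j := cov_rotate (w' i) (w' j) Oo O0.
have w'E (i : 'I_k) : w' i = w i by rewrite /w' ltn_ord.
have w'k : w' k = y by rewrite /w' ltnn.
rewrite !det_corr_mx (det_gram_last kn cr w0) big_ord_recr /= w'k.
rewrite (eq_bigr (fun i : 'I_k => (cov (w i) (w i))^-1)); last first.
  by move=> i _; rewrite w'E.
have -> : \matrix_(i < k, j < k) cov (w' i) (w' j) =
    \matrix_(i < k, j < k) cov (w i) (w j).
  by apply/matrixP => i j; rewrite !mxE !w'E.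
rewrite /resid_ratio.
have -> : cov y y = resid 0 (mx_act O y).
  by rewrite (cov_rotate y y Oo O0); apply: eq_bigr => i _; rewrite expr2.
ring.
Qed.

(** * Expectations *)

(** The formula [x * expR (- ln (x * x))] avoids a case distinction: at 0 its first factor gives 0,
    which is [0^-1]. *)
Lemma measurable_inv (R : realType) : measurable_fun [set: R] (@GRing.inv R).
Proof.
rewrite (_ : @GRing.inv R = fun x => x * expR (- ln (x * x))).
  apply: measurable_funM => //; apply: measurableT_comp => //.
  apply: measurableT_comp => //; apply: measurableT_comp => //.
  exact: measurable_funM.
apply/funext => x; have [->|x0] := eqVneq x 0; first by rewrite invr0 mul0r.
rewrite expRN lnK; last first.
  by rewrite posrE lt0r mulf_neq0//= -expr2 sqr_ge0.
by field.
Qed.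

Lemma measurable_funV d (T : measurableType d) (R : realType) (f : T -> R) :
  measurable_fun setT f -> measurable_fun setT (fun x => (f x)^-1).
Proof. by move=> mf; exact: (measurableT_comp (@measurable_inv R) mf). Qed.

Lemma measurable_sum_cond d (T : measurableType d) (R : realType) (I : finType)
  (Q : pred I) (h : I -> T -> R) :
  (forall i, measurable_fun setT (h i)) ->
  measurable_fun setT (fun x => \sum_(i | Q i) h i x).
Proof.
move=> mh; under eq_fun do rewrite -big_filter.
by apply: measurable_sum => i; exact: mh.
Qed.

Lemma measurable_prod_fin d (T : measurableType d) (R : realType) (I : finType)
  (h : I -> T -> R) :
  (forall i, measurable_fun setT (h i)) ->
  measurable_fun setT (fun x => \prod_i h i x).
Proof. by move=> mh; apply: measurable_prod => i _; exact: mh. Qed.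

Lemma measurable_tnth_comp d (T : measurableType d) (R : realType) n
  (y : T -> n.-tuple R) i :
  measurable_fun setT y -> measurable_fun setT (fun t => tnth (y t) i).
Proof. by move=> my; exact: (measurableT_comp (measurable_tnth i) my). Qed.

Lemma measurable_det_corr d (T : measurableType d) (R : realType) n k
  (w : 'I_k -> T -> n.-tuple R) :
  (forall i, measurable_fun setT (w i)) ->
  measurable_fun setT (fun t => \det (corr_mx (fun i => w i t))).
Proof.
move=> mw; under eq_fun do rewrite det_corr_mx.
have mcov i j : measurable_fun setT (fun t => cov (w i t) (w j t)).
  have mmean l : measurable_fun setT (fun t => mean_tuple (w l t)).
    apply: measurable_funM => //.
    by apply: measurable_sum_cond => a; exact: measurable_tnth_comp.
  apply: measurable_sum_cond => a.
  by apply: measurable_funM; apply: measurable_funB => //;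
     exact: measurable_tnth_comp.
apply: measurable_funM.
  by apply: measurable_prod_fin => i; exact: measurable_funV.
under eq_fun do rewrite /determinant.
have mprod (f : 'I_k -> 'I_k) : measurable_fun setT (fun x =>
    \prod_i (\matrix_(i, j) cov (w i x) (w j x)) i (f i)).
  apply: measurable_prod_fin => i; apply: eq_measurable_fun (mcov i (f i)).
  by move=> x _; rewrite mxE.
apply: measurable_sum_cond => s.
apply: (measurable_funM (measurable_cst _) (mprod _)).
Qed.

Lemma measurable_mx_act (R : realType) n (O : 'M[R]_n) :
  measurable_fun setT (fun x : n.-tuple R => mx_act O x).
Proof.
apply/measurable_fun_tnthP => i.
rewrite (_ : _ \o _ = fun x => \sum_j O i j * tnth x j).
  apply: measurable_sum_cond => j; apply: measurable_funM => //.
  exact: measurable_tnth.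
by apply/funext => x; rewrite /= tnth_mx_act.
Qed.

Lemma measurable_resid_ratio (R : realType) n k :
  measurable_fun setT (fun x : n.-tuple R => resid_ratio k x).
Proof.
have m l : measurable_fun setT (fun x : n.-tuple R => resid l x).
  apply: measurable_sum_cond => j; apply: measurable_funX.
  exact: measurable_tnth.
by apply: measurable_funM => //; exact: measurable_funV.
Qed.

Lemma eq_law_integral d d' (T : measurableType d) (U : measurableType d')
  (R : realType) (P : probability T R) (f g : T -> U) (h : U -> \bar R) :
  measurable_fun setT f -> measurable_fun setT g -> measurable_fun setT h ->
  (forall A, measurable A -> P (f @^-1` A) = P (g @^-1` A)) ->
  (\int[P]_t h (f t) = \int[P]_t h (g t))%E.
Proof.
move=> mf mg mh fg.
have ge0 (k : U -> \bar R) : measurable_fun setT k -> (forall x, 0 <= k x)%E ->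
    (\int[P]_t k (f t) = \int[P]_t k (g t))%E.
  move=> mk k0.
  rewrite -[LHS](@ge0_integral_pushforward _ _ _ _ _ f mf P setT k)//.
  rewrite -[RHS](@ge0_integral_pushforward _ _ _ _ _ g mg P setT k)//.
  by apply: eq_measure_integral => A mA _; exact: fg.
rewrite integralE [RHS]integralE; congr (_ - _)%E.
  under eq_integral do rewrite funeposE -funeposE.
  under [RHS]eq_integral do rewrite funeposE -funeposE.
  exact: (ge0 (h^\+)%E (measurable_funepos mh) (funepos_ge0 h)).
under eq_integral do rewrite funenegE -funenegE.
under [RHS]eq_integral do rewrite funenegE -funenegE.
exact: (ge0 (h^\-)%E (measurable_funeneg mh) (funeneg_ge0 h)).
Qed.

Section bounded_expectation.
Context d (T : measurableType d) (R : realType) (P : probability T R).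
Implicit Types f g : T -> R.

Lemma bounded_integrable f K : measurable_fun setT f ->
  (forall t, `|f t| <= K) -> P.-integrable setT (EFin \o f).
Proof.
move=> mf fK; apply: measurable_bounded_integrable => //.
  exact: le_lt_trans (probability_le1 P measurableT) (ltry 1).
by exists K; split; [rewrite num_real|move=> M KM t _ /=; exact: le_trans (ltW KM)].
Qed.

Lemma le_norm_Rintegral f g : P.-integrable setT (EFin \o f) ->
  P.-integrable setT (EFin \o g) -> (forall t, `|f t| <= g t) ->
  `|\int[P]_t f t| <= \int[P]_t g t.
Proof.
move=> fi gi fg; apply: le_trans (le_normr_Rintegral _ fi) _ => //.
apply: le_Rintegral => //; exact: integrable_norm.
Qed.

Lemma Rintegral_cst_prob (c : R) : \int[P]_t c = c.
Proof.
rewrite Rintegral_cst// -[RHS]mulr1; congr (_ * _).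
exact: (congr1 fine (probability_setT P)).
Qed.

Lemma norm_Rintegral_le f K : measurable_fun setT f ->
  (forall t, `|f t| <= K) -> `|\int[P]_t f t| <= K.
Proof.
move=> mf fK; rewrite -[leRHS]Rintegral_cst_prob.
apply: le_norm_Rintegral => //; first exact: bounded_integrable fK.
by apply: (@bounded_integrable _ `|K|) => // t.
Qed.

Lemma integrable_cst_prob (c : R) : P.-integrable setT (EFin \o (fun=> c)).
Proof. by apply: (@bounded_integrable _ `|c|). Qed.

Lemma integrableZl_EFin (c : R) f : P.-integrable setT (EFin \o f) ->
  P.-integrable setT (EFin \o (fun t => c * f t)).
Proof. by move=> /(integrableZl measurableT c). Qed.

Lemma integrableD_EFin f g : P.-integrable setT (EFin \o f) ->
  P.-integrable setT (EFin \o g) ->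
  P.-integrable setT (EFin \o (fun t => f t + g t)).
Proof. by move=> fi gi; have := integrableD measurableT fi gi. Qed.

Lemma integrableB_EFin f g : P.-integrable setT (EFin \o f) ->
  P.-integrable setT (EFin \o g) ->
  P.-integrable setT (EFin \o (fun t => f t - g t)).
Proof. by move=> fi gi; have := integrableB measurableT fi gi. Qed.

Lemma integrable_measurable_EFin f : P.-integrable setT (EFin \o f) ->
  measurable_fun setT f.
Proof. by move=> /measurable_int/measurable_EFinP. Qed.

Lemma Rintegral_sum (I : finType) (Q : pred I) (h : I -> T -> R) :
  (forall i, P.-integrable setT (EFin \o h i)) ->
  \int[P]_t (\sum_(i | Q i) h i t) = \sum_(i | Q i) \int[P]_t h i t.
Proof.
move=> hi.
have H (s : seq I) : P.-integrable setT (EFin \o (fun t => \sum_(i <- s) h i t)) /\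
    \int[P]_t (\sum_(i <- s) h i t) = \sum_(i <- s) \int[P]_t h i t.
  elim: s => [|i s [IHi IHe]].
    under [X in EFin \o X]eq_fun do rewrite big_nil.
    under eq_Rintegral do rewrite big_nil.
    by rewrite big_nil Rintegral_cst_prob; split => //; exact: integrable_cst_prob.
  under [X in EFin \o X]eq_fun do rewrite big_cons.
  under eq_Rintegral do rewrite big_cons.
  rewrite big_cons RintegralD// IHe; split => //; exact: integrableD_EFin.
under eq_Rintegral do rewrite -big_filter.
by rewrite -big_filter; have [] := H [seq i <- index_enum I | Q i].
Qed.

Lemma ae_eq_Rintegral f g : measurable_fun setT f -> measurable_fun setT g ->
  {ae P, forall t, f t = g t} -> \int[P]_t f t = \int[P]_t g t.
Proof.
move=> mf mg fg; congr fine; apply: ae_eq_integral => //.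
- exact/measurable_EFinP.
- exact/measurable_EFinP.
- by apply: filterS fg => t -> _.
Qed.

Lemma ae_le_Rintegral f g : P.-integrable setT (EFin \o f) ->
  P.-integrable setT (EFin \o g) ->
  {ae P, forall t, f t <= g t} -> \int[P]_t f t <= \int[P]_t g t.
Proof.
move=> fi gi fg.
have mf := integrable_measurable_EFin fi; have mg := integrable_measurable_EFin gi.
(* The minimum equals [f] almost everywhere and is below [g] everywhere, which reduces the claim to
   a pointwise comparison. *)
rewrite (@ae_eq_Rintegral f (fun t => Num.min (f t) (g t)))//; last first.
- by apply: filterS fg => t; rewrite minEle => ->.
- exact: measurable_minr.
apply: le_Rintegral => //; last by move=> t _; rewrite ge_min lexx orbT.
apply: (@le_integrable _ _ _ P setT measurableT _
  (EFin \o (fun t => `|f t| + `|g t|))).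
- exact/measurable_EFinP/measurable_minr.
- move=> t _ /=; rewrite lee_fin (ger0_norm (addr_ge0 _ _))//.
  by rewrite minEle; case: ifP; rewrite ?lerDl ?lerDr.
- by apply: integrableD_EFin; exact: integrable_norm.
Qed.

Lemma ae_le_norm_Rintegral f g : P.-integrable setT (EFin \o f) ->
  P.-integrable setT (EFin \o g) -> {ae P, forall t, `|f t| <= g t} ->
  `|\int[P]_t f t| <= \int[P]_t g t.
Proof.
move=> fi gi fg; apply: le_trans (le_normr_Rintegral _ fi) _ => //.
apply: ae_le_Rintegral => //; exact: integrable_norm.
Qed.

End bounded_expectation.

Lemma spherical_Rintegral d (T : measurableType d) (R : realType)
  (P : probability T R) n (y : T -> n.-tuple R) (O : 'M[R]_n)
  (h : n.-tuple R -> R) :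
  measurable_fun setT y -> spherical P y -> orthogonal_mx O ->
  measurable_fun setT h ->
  \int[P]_t h (mx_act O (y t)) = \int[P]_t h (y t).
Proof.
move=> my sy Oo mh; congr fine.
apply: (@eq_law_integral _ _ _ _ _ P (fun t => mx_act O (y t)) y (EFin \o h)) => //.
- exact: (measurableT_comp (measurable_mx_act O) my).
- exact/measurable_EFinP.
- exact: sy.
Qed.

(** * Spherical vectors *)

(** Here [t] is the tangent of the angle and [c] its cosine. Quadratic quantities only involve
    [c ^+ 2 = (1 + t ^+ 2)^-1], so they are rational in [t]. *)
Definition plane_rot (R : realType) n (i j : 'I_n) (t : R) : 'M[R]_n :=
  let c := (Num.sqrt (1 + t ^+ 2))^-1 in
  \matrix_(a, b) (if a == i then (if b == i then c else if b == j then - (t * c) else 0)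
                  else if a == j then (if b == i then t * c else if b == j then c else 0)
                  else (a == b)%:R).

Section plane_rotation.
Variables (R : realType) (n : nat) (i j : 'I_n) (t : R).
Hypothesis ij : i != j.
Let c := (Num.sqrt (1 + t ^+ 2))^-1.

Lemma plane_rot_sum (v : 'I_n -> R) a :
  \sum_b plane_rot i j t a b * v b =
  if a == i then c * (v i - t * v j) else
  if a == j then c * (t * v i + v j) else v a.
Proof.
under eq_bigr do rewrite mxE -/c.
have [_|ai] := eqVneq a i.
  rewrite (bigD1 i)//= (bigD1 j) 1?eq_sym//= big1 ?addr0; last first.
    by move=> b /andP[/negbTE -> /negbTE ->]; rewrite mul0r.
  by rewrite !eqxx eq_sym (negbTE ij); ring.
have [_|aj] := eqVneq a j.
  rewrite (bigD1 i)//= (bigD1 j) 1?eq_sym//= big1 ?addr0; last first.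
    by move=> b /andP[/negbTE -> /negbTE ->]; rewrite mul0r.
  by rewrite !eqxx eq_sym (negbTE ij); ring.
rewrite (bigD1 a)//= big1 ?addr0; last first.
  by move=> b /negbTE; rewrite eq_sym => ->; rewrite mul0r.
by rewrite eqxx mul1r.
Qed.

Lemma plane_rot_cos : c ^+ 2 = (1 + t ^+ 2)^-1.
Proof. by rewrite exprVn sqr_sqrtr// addr_ge0// sqr_ge0. Qed.

Lemma plane_rot_orthogonal : orthogonal_mx (plane_rot i j t).
Proof.
have c2 : c * c * (1 + t ^+ 2) = 1.
  by rewrite -expr2 plane_rot_cos mulVf// gt_eqF// ltr_pwDl// sqr_ge0.
rewrite /orthogonal_mx; apply/matrixP => a b; rewrite mxE.
under eq_bigr do rewrite [_^T _ _]mxE.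
rewrite plane_rot_sum !mxE -/c !eqxx (eq_sym j i) (negbTE ij) (eq_sym b a).
have [->|ai] := eqVneq a i.
  have [_|bi] := eqVneq b i; first by apply: etrans c2; ring.
  by have [_|bj] := eqVneq b j; rewrite /=; ring.
have [->|aj] := eqVneq a j.
  have [->|bi] := eqVneq b i; first by rewrite (eq_sym j) (negbTE ij) /=; ring.
  have [_|bj] := eqVneq b j; first by apply: etrans c2; ring.
  by rewrite /=; ring.
have [->|bi] := eqVneq b i; first by rewrite ?(eq_sym i a) ?(negbTE ai).
have [->|bj] := eqVneq b j; first by rewrite ?(eq_sym j a) ?(negbTE aj).
by rewrite eq_sym.
Qed.

Lemma tnth_plane_rot (x : n.-tuple R) a :
  tnth (mx_act (plane_rot i j t) x) a =
  if a == i then c * (tnth x i - t * tnth x j) else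
  if a == j then c * (t * tnth x i + tnth x j) else tnth x a.
Proof. by rewrite tnth_mx_act plane_rot_sum. Qed.

End plane_rotation.

(** To be read with [a = x_i x_j / r] and [b = (x_i^2 - x_j^2) / r]. The rotation turns [a] into
    [((1 - t^2) a + t b) e] and moves [B] by [D], while [p], [p'] and [dp] are [phi] before, [phi]
    after and [phi'] before. The bracket multiplied by [t] is the first-order term. *)
Lemma rotation_expansion (R : realType) (a b B p p' dp t K : R) :
  let e := (1 + t ^+ 2)^-1 in
  let D := (- (2 * t * a) - t ^+ 2 * b) * e in
  0 < t <= 1 -> `|a| <= 1 -> `|b| <= 1 ->
  `|p| <= K -> `|p'| <= K -> `|dp| <= K -> `|p' - p - dp * D| <= K * D ^+ 2 ->
  `|((1 - t ^+ 2) * a + t * b) * e * p' - a * p - t * (b * p - 2 * a ^+ 2 * dp)|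
    <= 27 * K * t ^+ 2.
Proof.
move=> e D /andP[t0 t1] a1 b1 pK p'K dK h.
have K0 : 0 <= K by apply: le_trans pK.
have tt0 : 0 < 1 + t ^+ 2 by rewrite ltr_pwDl// sqr_ge0.
have e0 : 0 <= e by rewrite invr_ge0 ltW.
have e1 : e <= 1 by rewrite invf_le1// lerDl sqr_ge0.
have eE : e * (1 + t ^+ 2) = 1 by rewrite mulVf// gt_eqF.
have bnd (x y M N : R) : `|x| <= M -> `|y| <= N -> `|x * y| <= M * N.
  by move=> xM yN; rewrite normrM; apply: ler_pM.
have ntl : `|t| <= t by rewrite gtr0_norm.
have ne : `|e| <= 1 by rewrite ger0_norm.
have nt2 : `|t ^+ 2| <= t ^+ 2 by rewrite ger0_norm// sqr_ge0.
have t2 : t ^+ 2 <= t by rewrite expr2 ler_piMr// ltW.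
have E1 : `|D| <= 3 * t.
  rewrite -[leRHS]mulr1 /D; apply: (bnd _ _ _ _) => //.
  have := bnd t a t 1 ntl a1; have := bnd (t^+2) b (t^+2) 1 nt2 b1.
  rewrite !ler_norml => /andP[? ?] /andP[? ?]; apply/andP; split; lra.
have E2 : `|D + 2 * t * a| <= 3 * t ^+ 2.
  have -> : D + 2 * t * a = t ^+ 2 * ((2 * t * a - b) * e).
    rewrite /D -[X in _ + X]mulr1 -eE; ring.
  rewrite mulrC; apply: (bnd _ _ _ _) => //; rewrite -[leRHS]mulr1; apply: (bnd _ _ _ _) => //.
  have := bnd t a t 1 ntl a1; move: b1.
  rewrite !ler_norml => /andP[? ?] /andP[? ?]; apply/andP; split; lra.
have E3 : `|((1 - t ^+ 2) * a + t * b) * e - a - t * b| <= 3 * t ^+ 2.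
  have -> : ((1 - t ^+ 2) * a + t * b) * e - a - t * b =
      t ^+ 2 * ((- (2 * a) - t * b) * e).
    transitivity (((1 - t ^+ 2) * a + t * b) * e - (a + t * b) * (e * (1 + t ^+ 2))).
      by rewrite eE; ring.
    ring.
  rewrite mulrC; apply: (bnd _ _ _ _) => //; rewrite -[leRHS]mulr1; apply: (bnd _ _ _ _) => //.
  have := bnd t b t 1 ntl b1; move: a1.
  rewrite !ler_norml => /andP[? ?] /andP[? ?]; apply/andP; split; lra.
have D2 : D ^+ 2 <= 9 * t ^+ 2.
  rewrite -real_normK ?num_real// expr2.
  have : `|D| * `|D| <= (3 * t) * (3 * t) by apply: ler_pM.
  by move/le_trans; apply; rewrite expr2 le_eqVlt; apply/orP; left; apply/eqP; ring.
have h' : `|p' - p - dp * D| <= 9 * K * t ^+ 2.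
  apply: le_trans h _; rewrite (_ : 9 * K * t ^+ 2 = K * (9 * t ^+ 2)).
    exact: ler_wpM2l.
  by ring.
have E4 : `|p' - p| <= 12 * K * t.
  have -> : p' - p = (p' - p - dp * D) + dp * D by ring.
  apply: le_trans (ler_normD _ _) _.
  have := bnd _ _ _ _ dK E1.
  have : K * t ^+ 2 <= K * t by apply: ler_wpM2l.
  lra.
(* The four terms are at most 3, 12, 9 and 3 times [K * t ^+ 2], hence the constant 27. *)
have -> : ((1 - t ^+ 2) * a + t * b) * e * p' - a * p - t * (b * p - 2 * a ^+ 2 * dp)
  = (((1 - t ^+ 2) * a + t * b) * e - a - t * b) * p' + (t * b) * (p' - p)
    + a * (p' - p - dp * D) + (a * dp) * (D + 2 * t * a) by ring.
have F1 := bnd _ _ _ _ E3 p'K.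
have F2 := bnd _ _ _ _ (bnd _ _ _ _ ntl b1) E4.
have F3 := bnd _ _ _ _ a1 h'.
have F4 := bnd _ _ _ _ (bnd _ _ _ _ a1 dK) E2.
apply: le_trans (ler_normD _ _) _.
apply: le_trans (lerD (ler_normD _ _) (lexx _)) _.
apply: le_trans (lerD (lerD (ler_normD _ _) (lexx _)) (lexx _)) _.
move: F1 F2 F3 F4.
have -> : t * 1 * (12 * K * t) = 12 * (K * t ^+ 2) by ring.
have -> : 1 * (9 * K * t ^+ 2) = 9 * (K * t ^+ 2) by ring.
have -> : 1 * K * (3 * t ^+ 2) = 3 * (K * t ^+ 2) by ring.
have -> : 3 * t ^+ 2 * K = 3 * (K * t ^+ 2) by ring.
have -> : 27 * K * t ^+ 2 = 27 * (K * t ^+ 2) by ring.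
move: (K * t ^+ 2) => X; lra.
Qed.

Definition sqsum (R : realType) n (I : {set 'I_n}) (x : n.-tuple R) : R :=
  \sum_(i in I) tnth x i ^+ 2.

Lemma sqsum_ge0 (R : realType) n (I : {set 'I_n}) (x : n.-tuple R) : 0 <= sqsum I x.
Proof. by apply: sumr_ge0 => i _; rewrite sqr_ge0. Qed.

Lemma sqsum_ge (R : realType) n (I : {set 'I_n}) (x : n.-tuple R) i :
  i \in I -> tnth x i ^+ 2 <= sqsum I x.
Proof.
move=> iI; rewrite /sqsum (bigD1 i)//= lerDl.
by apply: sumr_ge0 => a _; rewrite sqr_ge0.
Qed.

Section stein.
Context d (T : measurableType d) (R : realType) (P : probability T R).
Variables (n : nat) (y : T -> n.-tuple R).
Hypotheses (my : measurable_fun setT y) (sy : spherical P y).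
Variables (I J : {set 'I_n}).
Hypothesis IJ : forall i, i \in I -> i \notin J.
(** Below, [phiT] expresses that [dphi] is the derivative of [phi] on [[0, 1]], with a uniform
    remainder because a rotation moves [B] by a finite amount. *)
Variables (phi dphi : R -> R) (K : R).
Hypotheses (mphi : measurable_fun setT phi) (mdphi : measurable_fun setT dphi).
Hypothesis phiK : forall b, 0 <= b <= 1 -> `|phi b| <= K.
Hypothesis dphiK : forall b, 0 <= b <= 1 -> `|dphi b| <= K.
Hypothesis phiT : forall b b', 0 <= b <= 1 -> 0 <= b' <= 1 ->
  `|phi b' - phi b - dphi b * (b' - b)| <= K * (b' - b) ^+ 2.

Let r (x : n.-tuple R) := sqsum I x + sqsum J x.
Let B (x : n.-tuple R) := sqsum I x / r x.
Let V (x : n.-tuple R) := sqsum J x / r x.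
Let al i j (x : n.-tuple R) := tnth x i * tnth x j / r x.
Let be i j (x : n.-tuple R) := (tnth x i ^+ 2 - tnth x j ^+ 2) / r x.

Let r_ge0 x : 0 <= r x. Proof. by rewrite addr_ge0// sqsum_ge0. Qed.

Let B01 x : 0 <= B x <= 1.
Proof.
rewrite /B; have [->|r0] := eqVneq (r x) 0; first by rewrite invr0 mulr0 lexx ler01.
have r0' : 0 < r x by rewrite lt0r r0 r_ge0.
by rewrite divr_ge0 ?sqsum_ge0//= ler_pdivrMr// mul1r lerDl sqsum_ge0.
Qed.

Let ijr i j x : i \in I -> j \in J -> tnth x i ^+ 2 + tnth x j ^+ 2 <= r x.
Proof. by move=> iI jJ; apply: lerD; apply: sqsum_ge. Qed.

Let normr_div (u v : R) : 0 <= v -> `|u| <= v -> `|u / v| <= 1.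
Proof.
move=> v0 uv; have [v0'|v0'] := eqVneq v 0.
  by rewrite v0' invr0 mulr0 normr0.
by rewrite normrM normfV (ger0_norm v0) ler_pdivrMr ?mul1r// lt0r v0'.
Qed.

Let al1 i j x : i \in I -> j \in J -> `|al i j x| <= 1.
Proof.
move=> iI jJ; apply: normr_div => //; apply: le_trans (ijr x iI jJ).
rewrite ler_norml; apply/andP; split; nra.
Qed.

Let be1 i j x : i \in I -> j \in J -> `|be i j x| <= 1.
Proof.
move=> iI jJ; apply: normr_div => //; apply: le_trans (ijr x iI jJ).
have := sqr_ge0 (tnth x i); have := sqr_ge0 (tnth x j).
by rewrite ler_norml => ? ?; apply/andP; split; lra.
Qed.

Let msq (A : {set 'I_n}) : measurable_fun setT (@sqsum R n A).
Proof.
by apply: measurable_sum_cond => i; apply: measurable_funX; exact: measurable_tnth.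
Qed.

Let mr : measurable_fun setT r.
Proof. exact: measurable_funD. Qed.

Let mrV : measurable_fun setT (fun x => (r x)^-1).
Proof. exact: measurable_funV. Qed.

Let mB : measurable_fun setT B.
Proof. exact: measurable_funM. Qed.

Let mV : measurable_fun setT V.
Proof. exact: measurable_funM. Qed.

Let mal i j : measurable_fun setT (al i j).
Proof.
by apply: measurable_funM => //; apply: measurable_funM; exact: measurable_tnth.
Qed.

Let mbe i j : measurable_fun setT (be i j).
Proof.
apply: measurable_funM => //; apply: measurable_funB;
by apply: measurable_funX; exact: measurable_tnth.
Qed.

Section rotated.
Variables (i j : 'I_n) (t : R).
Hypotheses (iI : i \in I) (jJ : j \in J).
Let O := plane_rot i j t.
Let e := (1 + t ^+ 2)^-1.

Let ij : i != j.
Proof. by apply: contraTneq jJ => <-; exact: IJ. Qed.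

Let jI : j \notin I. Proof. by apply: contraTN jJ; exact: IJ. Qed.
Let iJ : i \notin J. Proof. exact: IJ. Qed.

Let eE : e * (1 + t ^+ 2) = 1.
Proof. by rewrite mulVf// gt_eqF// ltr_pwDl// sqr_ge0. Qed.

Let sqI x : sqsum I (mx_act O x) = sqsum I x +
  (- (2 * t * (tnth x i * tnth x j)) - t ^+ 2 * (tnth x i ^+ 2 - tnth x j ^+ 2)) * e.
Proof.
rewrite /sqsum (bigD1 i)//= [in RHS](bigD1 i)//= tnth_plane_rot// eqxx.
rewrite exprMn plane_rot_cos -/e.
rewrite (eq_bigr (fun a => tnth x a ^+ 2)); last first.
  move=> a /andP[aI ai]; rewrite tnth_plane_rot// (negbTE ai) ifF//.
  by apply: contraTF aI => /eqP ->.
set X := \sum_(_ in I | _) _.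
transitivity (e * (tnth x i - t * tnth x j) ^+ 2 + X); first by [].
rewrite -[tnth x i ^+ 2 in RHS]mul1r -{1}eE; ring.
Qed.

Let sqJ x : sqsum J (mx_act O x) = sqsum J x -
  (- (2 * t * (tnth x i * tnth x j)) - t ^+ 2 * (tnth x i ^+ 2 - tnth x j ^+ 2)) * e.
Proof.
rewrite /sqsum (bigD1 j)//= [in RHS](bigD1 j)//= tnth_plane_rot// eqxx.
rewrite eq_sym (negbTE ij) exprMn plane_rot_cos -/e.
rewrite (eq_bigr (fun a => tnth x a ^+ 2)); last first.
  move=> a /andP[aJ aj]; rewrite tnth_plane_rot// (negbTE aj) ifF//.
  by apply: contraTF aJ => /eqP ->.
set X := \sum_(_ in J | _) _.
transitivity (e * (t * tnth x i + tnth x j) ^+ 2 + X); first by [].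
rewrite -[tnth x j ^+ 2 in RHS]mul1r -{1}eE; ring.
Qed.

Let rO x : r (mx_act O x) = r x.
Proof. by rewrite /r sqI sqJ; ring. Qed.

(** The rotation preserves [x_i^2 + x_j^2], hence the denominator [r]; only the share of [I] in the
    sum changes. *)
Lemma B_rot x : B (mx_act O x) - B x =
  (- (2 * t * al i j x) - t ^+ 2 * be i j x) * e.
Proof. by rewrite /B rO sqI /al /be; ring. Qed.

Lemma al_rot x : al i j (mx_act O x) =
  ((1 - t ^+ 2) * al i j x + t * be i j x) * e.
Proof.
rewrite /al /be rO !tnth_plane_rot// !eqxx eq_sym (negbTE ij).
rewrite mulrACA -expr2 plane_rot_cos -/e; ring.
Qed.

End rotated.

(** The derivative at [t = 0] of [al i j * phi B] along the rotation. *)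
Let L i j x := be i j x * phi (B x) - 2 * al i j x ^+ 2 * dphi (B x).

Let mphiB : measurable_fun setT (fun x => phi (B x)).
Proof. exact: (measurableT_comp mphi mB). Qed.

Let mdphiB : measurable_fun setT (fun x => dphi (B x)).
Proof. exact: (measurableT_comp mdphi mB). Qed.

Let mL i j : measurable_fun setT (L i j).
Proof.
apply: measurable_funB; apply: measurable_funM => //.
by apply: measurable_funM => //; exact: measurable_funX.
Qed.

Let compy (f : n.-tuple R -> R) : measurable_fun setT f ->
  measurable_fun setT (fun t => f (y t)).
Proof. by move=> mf; exact: (measurableT_comp mf my). Qed.

Let L3 i j x : i \in I -> j \in J -> `|L i j x| <= 3 * K.
Proof.
move=> iI jJ.
have G (a b p q : R) : `|a| <= 1 -> `|b| <= 1 -> `|p| <= K -> `|q| <= K ->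
    `|b * p - 2 * a ^+ 2 * q| <= 3 * K.
  move=> a1 b1 pK qK; apply: le_trans (ler_normB _ _) _.
  rewrite expr2 !normrM (ger0_norm (_ : 0 <= 2))//.
  have : `|b| * `|p| <= 1 * K by apply: ler_pM.
  have : `|a| * `|a| * `|q| <= 1 * 1 * K.
    by apply: ler_pM => //; apply: ler_pM.
  lra.
by apply: G; [exact: al1|exact: be1|exact: phiK|exact: dphiK].
Qed.

(** The expectation of [F (O y) - F y] vanishes by sphericity, so [t * |E L| <= 27 K t^2]. Dividing
    by [t] and taking [t] small concludes; no derivative is exchanged with the integral. *)
Let EL0 i j : i \in I -> j \in J -> \int[P]_t L i j (y t) = 0.
Proof.
move=> iI jJ; apply/eqP; rewrite -normr_le0; apply/ler_addgt0Pl => eps eps0.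
rewrite addr0.
have K0 : 0 <= K.
  by apply: le_trans (phiK (_ : 0 <= 0 <= 1)); rewrite ?lexx ?ler01.
pose t := Num.min 1 (eps / (27 * K + 1)).
have K1 : 0 < 27 * K + 1 by lra.
have t0 : 0 < t by rewrite lt_min ltr01 divr_gt0.
have t1 : t <= 1 by rewrite ge_min lexx.
have te : t * (27 * K + 1) <= eps by rewrite -ler_pdivlMr// ge_min lexx orbT.
pose F x := al i j x * phi (B x).
have mF : measurable_fun setT F by exact: measurable_funM.
have FK x : `|F x| <= K.
  rewrite normrM -[leRHS]mul1r; apply: ler_pM => //; [exact: al1|exact: phiK].
have ij : i != j.
  by apply: contraTneq jJ => <-; exact: IJ.
have inv := spherical_Rintegral my sy (plane_rot_orthogonal t ij) mF.
pose O := plane_rot i j t.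
have mFO : measurable_fun setT (fun x => F (mx_act O x)).
  exact: (measurableT_comp mF (measurable_mx_act O)).
have iF := bounded_integrable P (compy mF) (fun t => FK (y t)).
have iFO : P.-integrable setT (EFin \o (fun s => F (mx_act O (y s)))).
  exact: (bounded_integrable P (compy mFO) (fun t => FK (mx_act O (y t)))).
have iL := bounded_integrable P (compy (mL i j)) (fun t => L3 (y t) iI jJ).
have : `|\int[P]_s (F (mx_act O (y s)) - F (y s) - t * L i j (y s))|
    <= 27 * K * t ^+ 2.
  apply: norm_Rintegral_le.
    apply: (measurable_funB (measurable_funB (compy mFO) (compy mF))).
    exact: (measurable_funM (measurable_cst t) (compy (mL i j))).
  move=> s; rewrite /F al_rot// /L.
  apply: rotation_expansion; rewrite ?t0 ?t1//.
  - exact: al1.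
  - exact: be1.
  - exact: phiK.
  - exact: phiK.
  - exact: dphiK.
  - by rewrite -B_rot//; exact: phiT.
rewrite RintegralB//; last 2 first.
- exact: integrableB_EFin.
- exact: integrableZl_EFin.
rewrite RintegralB// inv// subrr sub0r normrN RintegralZl//.
rewrite normrM (gtr0_norm t0) => h; apply: le_trans (_ : 27 * K * t <= _).
  rewrite -(ler_pM2l t0); apply: le_trans h _.
  by rewrite le_eqVlt; apply/orP; left; apply/eqP; ring.
by apply: le_trans te; rewrite mulrC ler_pM2l//; lra.
Qed.

(* Rotate by the angle [arctan t] in the plane of coordinates [i \in I] and
   [j \in J], which preserves the law of [y]: the first-order term in [t] of the
   expectation of [x_i x_j / r * phi B] vanishes. Sum over [i] and [j]. *)
Lemma stein_identity :
  \int[P]_t ((#|J|%:R * B (y t) - #|I|%:R * V (y t)) * phi (B (y t))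
             - 2 * (B (y t) * V (y t)) * dphi (B (y t))) = 0.
Proof.
transitivity (\int[P]_t (\sum_(ij in finset.setX I J) L ij.1 ij.2 (y t))).
  apply: eq_Rintegral => t _.
  move: (y t) => x.
  have -> : \sum_(ij in finset.setX I J) L ij.1 ij.2 x =
      \sum_(i in I) \sum_(j in J) L i j x.
    rewrite pair_big; apply: eq_bigl => -[a b] /=; first by rewrite finset.in_setX.
  have bE : \sum_(i in I) \sum_(j in J) be i j x = #|J|%:R * B x - #|I|%:R * V x.
    rewrite /be; under eq_bigr do rewrite -mulr_suml sumrB sumr_const.
    rewrite -mulr_suml sumrB sumr_const sumrMnl mulrBl.
    by rewrite /B /V /sqsum !mulrA !mulr_natl.
  have aE : \sum_(i in I) \sum_(j in J) al i j x ^+ 2 = B x * V x.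
    transitivity (\sum_(i in I) (tnth x i ^+ 2 * (r x)^-1 * V x)).
      apply: eq_bigr => i _; rewrite /V /sqsum mulr_suml mulr_sumr.
      by apply: eq_bigr => j _; rewrite /al; ring.
    by rewrite -!mulr_suml.
  rewrite -bE -aE !(mulr_suml, mulr_sumr) -sumrB; apply: eq_bigr => i _.
  rewrite !(mulr_suml, mulr_sumr) -sumrB; apply: eq_bigr => j _.
  by [].
under eq_Rintegral do rewrite big_mkcond /=.
rewrite Rintegral_sum.
  apply: big1 => -[a b] _; case: (boolP ((a, b) \in _)) => [|_].
    by rewrite finset.in_setX /= => /andP[aI bJ]; exact: EL0.
  exact: Rintegral_cst_prob.
move=> -[a b]; case: (boolP ((a, b) \in _)) => [|_].
  rewrite finset.in_setX /= => /andP[aI bJ].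
  exact: (bounded_integrable P (compy (mL a b)) (fun t => L3 (y t) aI bJ)).
exact: integrable_cst_prob.
Qed.

End stein.

(** On [B = 0] one has [eps * (B + eps)^-1 = 1], so this event has probability at most [eps * C] for
    every [eps]. This must come first: with [0^-1 = 0], the integral of [B^-1] does not see an atom
    at 0. Monotone convergence along [eps = 1 / n.+1] gives the rest. *)
Lemma integrable_inv d (T : measurableType d) (R : realType)
  (P : probability T R) (B : T -> R) (C : R) :
  measurable_fun setT B -> (forall t, 0 <= B t) ->
  (forall eps, 0 < eps -> \int[P]_t (B t + eps)^-1 <= C) ->
  [/\ {ae P, forall t, 0 < B t},
      P.-integrable setT (EFin \o (fun t => (B t)^-1)) &
      \int[P]_t (B t)^-1 <= C].
Proof.
move=> mB B0 BC.
have Be0 t eps : 0 < eps -> 0 < B t + eps by move=> e0; rewrite ltr_wpDl.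
have mBe eps : measurable_fun setT (fun t => (B t + eps)^-1).
  by apply: measurable_funV; exact: measurable_funD.
have iBe eps : 0 < eps ->
    P.-integrable setT (EFin \o (fun t => (B t + eps)^-1)).
  move=> e0; apply: (@bounded_integrable _ _ _ P _ eps^-1) => // t.
  rewrite ger0_norm; last by rewrite invr_ge0 ltW ?Be0.
  rewrite lef_pV2 ?posrE ?Be0//.
  by rewrite lerDr.
have C0 : 0 <= C.
  apply: le_trans (BC 1 ltr01); apply: Rintegral_ge0 => t _.
  by rewrite invr_ge0 ltW ?Be0.
pose A : set T := [set t | B t <= 0].
have mA : measurable A.
  have -> : A = setT `&` B @^-1` `]-oo, 0]%classic.
    by apply/seteqP; split=> t; rewrite /A /= in_itv/=; [|case].
  exact: mB.
have PA : P A = 0%E.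
  have fA : P A \is a fin_num by rewrite fin_num_measure.
  rewrite -(fineK fA); congr EFin; apply/eqP; rewrite eq_le fine_ge0 ?andbT//.
  apply/ler_addgt0Pl => e e0; rewrite addr0.
  pose eps := e / (C + 1).
  have C1 : 0 < C + 1 by lra.
  have eps0 : 0 < eps by rewrite divr_gt0.
  have -> : fine (P A) = \int[P]_t \1_A t.
    by rewrite /Rintegral integral_indic// setIT.
  apply: (@le_trans _ _ (\int[P]_t (eps * (B t + eps)^-1))).
    apply: le_Rintegral => //.
    - exact: integrable_indic.
    - by apply: integrableZl_EFin; exact: iBe.
    - move=> t _; rewrite indicE; case: (boolP (t \in A)) => [|_].
        rewrite inE /A /= => Bt.
        have -> : B t = 0 by apply/eqP; rewrite eq_le Bt B0.
        by rewrite add0r divff// gt_eqF.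
      by rewrite mulr_ge0 ?(ltW eps0)// invr_ge0 ltW ?Be0.
  rewrite RintegralZl//; last exact: iBe.
  apply: (@le_trans _ _ (eps * C)); first by rewrite ler_pM2l// BC.
  by rewrite /eps mulrAC ler_pdivrMr// ler_pM2l//; lra.
have aeB : {ae P, forall t, 0 < B t}.
  exists A; split => // t /= /negP; rewrite -leNgt.
  by [].
have mBV : measurable_fun setT (fun t => (B t)^-1) by exact: measurable_funV.
have lim : (\int[P]_t ((B t)^-1)%:E <= C%:E)%E.
  rewrite (@ge0_negligible_integral _ _ _ P setT A)//; last 2 first.
  - exact/measurable_EFinP.
  - by move=> t _; rewrite lee_fin invr_ge0.
  have mD : measurable (setT `\` A) by exact: measurableD.
  have BD t : (setT `\` A) t -> 0 < B t.
    by move=> [_ /negP]; rewrite -ltNge.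
  pose g (n : nat) t : \bar R := ((B t + n.+1%:R^-1)^-1)%:E.
  have n0 n : 0 < n.+1%:R^-1 :> R by rewrite invr_gt0.
  have mg n : measurable_fun (setT `\` A) (g n).
    by apply: measurable_funTS; exact/measurable_EFinP.
  have g0 n t : (0 <= g n t)%E.
    by rewrite lee_fin invr_ge0 ltW ?Be0.
  have gnd t : (setT `\` A) t -> nondecreasing_seq (g ^~ t).
    move=> /BD Bt m n mn; rewrite lee_fin lef_pV2 ?posrE ?Be0// lerD2l.
    by rewrite lef_pV2 ?posrE// ler_nat.
  rewrite (eq_integral (fun t => limn (g ^~ t))); last first.
    move=> t /[!inE] /BD Bt; apply/esym/cvg_lim => //.
    apply: cvg_EFin; first by near=> n.
    apply: cvgV; first by rewrite gt_eqF.
    rewrite -[X in _ --> X]addr0; apply: cvgD; first exact: cvg_cst.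
    exact: cvg_harmonic.
  rewrite monotone_convergence//.
  apply: lime_le.
    apply: ereal_nondecreasing_is_cvgn => m n mn.
    by apply: ge0_le_integral => // t Dt; exact: gnd.
  near=> n.
  apply: (@le_trans _ _ (\int[P]_t g n t)%E).
    apply: ge0_subset_integral => //.
    exact/measurable_EFinP.
  rewrite -(fineK (integrable_fin_num measurableT (iBe _ (n0 n)))) lee_fin.
  exact: BC.
have iV : P.-integrable setT (EFin \o (fun t => (B t)^-1)).
  apply/integrableP; split; first exact/measurable_EFinP.
  apply: le_lt_trans (ltry C); apply: le_trans lim.
  apply: ge0_le_integral => //.
  - apply: measurableT_comp => //; exact/measurable_EFinP.
  - exact/measurable_EFinP.
  - by move=> t _ /=; rewrite lee_fin ger0_norm// invr_ge0.
split => //.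
by rewrite -lee_fin /Rintegral fineK//; exact: integrable_fin_num.
Unshelve. all: by end_near. Qed.

Section moments.
Context d (T : measurableType d) (R : realType) (P : probability T R).
Variables (n : nat) (y : T -> n.-tuple R).
Hypotheses (my : measurable_fun setT y) (sy : spherical P y).
Variables (I J : {set 'I_n}).
Hypothesis IJ : forall i, i \in I -> i \notin J.
Hypothesis rpos : {ae P, forall t, 0 < sqsum I (y t) + sqsum J (y t)}.

Let q : R := #|I|%:R.
Let k : R := #|J|%:R.
Let B t := sqsum I (y t) / (sqsum I (y t) + sqsum J (y t)).

Lemma measurable_sqsum_ratio : measurable_fun setT B.
Proof.
have msq (A : {set 'I_n}) : measurable_fun setT (fun t => sqsum A (y t)).
  by apply: measurable_sum_cond => i; apply: measurable_funX;
    exact: measurable_tnth_comp.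
apply: measurable_funM => //; apply: measurable_funV; exact: measurable_funD.
Qed.

Lemma sqsum_ratio01 t : 0 <= B t <= 1.
Proof.
have I0 := sqsum_ge0 I (y t); have J0 := sqsum_ge0 J (y t).
rewrite /B; have [->|r0] := eqVneq (sqsum I (y t) + sqsum J (y t)) 0.
  by rewrite invr0 mulr0 lexx ler01.
have r0' : 0 < sqsum I (y t) + sqsum J (y t) by rewrite lt0r r0 addr_ge0.
by rewrite divr_ge0 ?(ltW r0')//= ler_pdivrMr// mul1r lerDl.
Qed.

Let mB := measurable_sqsum_ratio.
Let B01 := sqsum_ratio01.

(** Almost everywhere the denominator is positive, so the complementary ratio is [1 - B] and the
    Stein identity becomes one about [B] alone. *)
Lemma stein_ratio (phi dphi : R -> R) (K : R) :
  measurable_fun setT phi -> measurable_fun setT dphi ->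
  (forall b, 0 <= b <= 1 -> `|phi b| <= K) ->
  (forall b, 0 <= b <= 1 -> `|dphi b| <= K) ->
  (forall b b', 0 <= b <= 1 -> 0 <= b' <= 1 ->
    `|phi b' - phi b - dphi b * (b' - b)| <= K * (b' - b) ^+ 2) ->
  \int[P]_t (((q + k) * B t - q) * phi (B t)
     - 2 * (B t * (1 - B t)) * dphi (B t)) = 0.
Proof.
move=> mphi mdphi phiK dphiK phiT.
have mphiB : measurable_fun setT (fun t => phi (B t)).
  exact: (measurableT_comp mphi mB).
have mdphiB : measurable_fun setT (fun t => dphi (B t)).
  exact: (measurableT_comp mdphi mB).
rewrite -[RHS](stein_identity my sy IJ mphi mdphi phiK dphiK phiT).
have mV : measurable_fun setT
    (fun t => sqsum J (y t) / (sqsum I (y t) + sqsum J (y t))).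
  have msq (A : {set 'I_n}) : measurable_fun setT (fun t => sqsum A (y t)).
    by apply: measurable_sum_cond => i; apply: measurable_funX;
      exact: measurable_tnth_comp.
  apply: measurable_funM => //; apply: measurable_funV; exact: measurable_funD.
apply: ae_eq_Rintegral.
- apply: measurable_funB; apply: measurable_funM => //.
    by apply: measurable_funB => //; exact: measurable_funM.
  apply: measurable_funM => //; apply: measurable_funM => //.
  exact: measurable_funB.
- apply: measurable_funB; apply: measurable_funM => //.
    by apply: measurable_funB => //; exact: measurable_funM.
  by apply: measurable_funM => //; exact: measurable_funM.
- apply: filterS rpos => t r0.
  have -> : sqsum J (y t) / (sqsum I (y t) + sqsum J (y t)) = 1 - B t.
    by rewrite /B; field; rewrite gt_eqF.
  by rewrite -/(B t) -/q -/k; ring.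
Qed.

Lemma integrable_ratio (h : R -> R) (K : R) : measurable_fun setT h ->
  (forall b, 0 <= b <= 1 -> `|h b| <= K) ->
  P.-integrable setT (EFin \o (fun t => h (B t))).
Proof.
move=> mh hK.
apply: (@bounded_integrable _ _ _ P _ K (measurableT_comp mh mB)) => t.
exact: hK.
Qed.

Let iBX j : P.-integrable setT (EFin \o (fun t => B t ^+ j)).
Proof.
apply: (@integrable_ratio (fun b => b ^+ j) 1); first exact: measurable_funX.
by move=> b /andP[b0 b1]; rewrite ger0_norm ?exprn_ge0// exprn_ile1.
Qed.

(** The Stein identity for [phi b = b ^+ j]. The constant 4 bounds [j] as well as the remainder
    factors 1 (for [j = 2]) and [c + 2 * b <= 3] (for [j = 3]). *)
Lemma ratio_moment_rec j : (j < 4)%N ->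
  (q + k + 2 * j%:R) * \int[P]_t (B t ^+ j.+1) =
  (q + 2 * j%:R) * \int[P]_t (B t ^+ j).
Proof.
move=> j4.
have main : \int[P]_t (((q + k) * B t - q) * B t ^+ j
     - 2 * (B t * (1 - B t)) * (j%:R * B t ^+ j.-1)) = 0.
  apply: (@stein_ratio (fun b => b ^+ j) (fun b => j%:R * b ^+ j.-1) 4).
  - exact: measurable_funX.
  - by apply: measurable_funM => //; exact: measurable_funX.
  - move=> b /andP[b0 b1]; rewrite ger0_norm ?exprn_ge0//.
    by apply: le_trans (exprn_ile1 _ _ _) _ => //; lra.
  - move=> b /andP[b0 b1]; rewrite ger0_norm ?mulr_ge0 ?exprn_ge0//.
    rewrite -[leRHS]mulr1; apply: ler_pM; rewrite ?exprn_ge0 ?exprn_ile1//.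
    by rewrite (ler_nat _ j 4) ltnW.
  - move=> b c /andP[b0 b1] /andP[c0 c1].
    have s0 := sqr_ge0 (c - b).
    case: j j4 => [|[|[|[|j]]]] // _ /=.
    + by rewrite (_ : _ - _ - _ = 0) ?normr0; [lra|ring].
    + by rewrite (_ : _ - _ - _ = 0) ?normr0; [lra|ring].
    + have -> : c ^+ 2 - b ^+ 2 - 2 * b ^+ 1 * (c - b) = (c - b) ^+ 2 by ring.
      rewrite ger0_norm//; lra.
    + have -> : c ^+ 3 - b ^+ 3 - 3 * b ^+ 2 * (c - b) =
        (c + 2 * b) * (c - b) ^+ 2 by ring.
      have cb : 0 <= c + 2 * b by lra.
      rewrite ger0_norm; last exact: mulr_ge0.
      by apply: ler_wpM2r => //; lra.
have : \int[P]_t ((q + k + 2 * j%:R) * B t ^+ j.+1 - (q + 2 * j%:R) * B t ^+ j)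
    = 0.
  rewrite -[RHS]main; apply: eq_Rintegral => t _.
  case: j {j4 main} => [|j] /=; first by rewrite !mulr0 !mul0r !mulr0 expr1 expr0; ring.
  rewrite !exprS; ring.
rewrite RintegralB//; [|exact: integrableZl_EFin|exact: integrableZl_EFin].
by rewrite !RintegralZl// => /eqP; rewrite subr_eq0 => /eqP.
Qed.

(** The Stein identity for [phi b = b^-1] would give equality; the pole is avoided with
    [phi b = (b + eps)^-1]. *)
Lemma ratio_inv_moment : 2 < q -> 4 <= q + k ->
  [/\ {ae P, forall t, 0 < B t},
      P.-integrable setT (EFin \o (fun t => (B t)^-1)) &
      \int[P]_t (B t)^-1 <= (q + k - 2) / (q - 2)].
Proof.
move=> q2 m4; apply: integrable_inv => //.
  by move=> t; case/andP: (B01 t).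
move=> eps e0.
pose phi b : R := (b + eps)^-1.
pose dphi b : R := - ((b + eps)^-1) ^+ 2.
pose K := eps^-1 + eps^-1 ^+ 2 + eps^-1 ^+ 3.
have eV0 : 0 < eps^-1 by rewrite invr_gt0.
have p1 b : 0 <= b <= 1 -> 0 < phi b <= eps^-1.
  move=> /andP[b0 b1]; rewrite /phi invr_gt0 ltr_wpDl//=.
  by rewrite lef_pV2 ?posrE ?ltr_wpDl// lerDr.
have mphi : measurable_fun setT phi.
  by apply: measurable_funV; exact: measurable_funD.
have mdphi : measurable_fun setT dphi.
  by apply: measurable_funN; exact: measurable_funX.
have phiK b : 0 <= b <= 1 -> `|phi b| <= K.
  move=> /p1 /andP[h1 h2]; rewrite gtr0_norm//; apply: le_trans h2 _.
  by rewrite /K -addrA lerDl addr_ge0// exprn_ge0// ltW.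
have dphiK b : 0 <= b <= 1 -> `|dphi b| <= K.
  move=> /p1 /andP[h1 h2]; rewrite normrN ger0_norm ?sqr_ge0//.
  apply: (@le_trans _ _ (eps^-1 ^+ 2)).
    by apply: lerXn2r => //; rewrite nnegrE ltW.
  rewrite /K addrAC lerDr addr_ge0// ?exprn_ge0// ltW//.
have phiT b b' : 0 <= b <= 1 -> 0 <= b' <= 1 ->
    `|phi b' - phi b - dphi b * (b' - b)| <= K * (b' - b) ^+ 2.
  move=> hb hb'; have /andP[h1 h2] := p1 _ hb; have /andP[h3 h4] := p1 _ hb'.
  have -> : phi b' - phi b - dphi b * (b' - b) =
      (phi b' * phi b ^+ 2) * (b' - b) ^+ 2.
    by rewrite /phi /dphi; field; case/andP: hb => ? _; case/andP: hb' => ? _;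
      rewrite !gt_eqF// ltr_wpDl.
  rewrite ger0_norm; last first.
    by apply: mulr_ge0; [apply: mulr_ge0; [exact: ltW|exact: sqr_ge0]|exact: sqr_ge0].
  apply: ler_wpM2r; first exact: sqr_ge0.
  apply: (@le_trans _ _ (eps^-1 ^+ 3)).
    rewrite [leRHS]exprS; apply: ler_pM => //; [exact: ltW|exact: sqr_ge0|].
    by apply: lerXn2r => //; rewrite nnegrE ltW.
  by rewrite /K lerDr addr_ge0// ?exprn_ge0// ltW.
have main := stein_ratio mphi mdphi phiK dphiK phiT.
have iphi : P.-integrable setT (EFin \o (fun t => phi (B t))).
  exact: integrable_ratio mphi phiK.
pose S t := ((q + k) * B t - q) * phi (B t) - 2 * (B t * (1 - B t)) * dphi (B t).
have iS : P.-integrable setT (EFin \o S).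
  have -> : S = (fun b => ((q + k) * b - q) * phi b - 2 * (b * (1 - b)) * dphi b) \o B
    by [].
  apply: (@integrable_ratio _ ((q + k + q) * K + 2 * K)).
    apply: measurable_funB; apply: measurable_funM => //.
      by apply: measurable_funB => //; exact: measurable_funM.
    apply: measurable_funM => //; apply: measurable_funM => //.
    exact: measurable_funB.
  move=> b hb; have := hb => /andP[b0 b1].
  apply: le_trans (ler_normB _ _) _; rewrite !normrM (ger0_norm (_ : 0 <= 2))//.
  have k0 : 0 <= k by rewrite /k.
  apply: lerD.
    apply: ler_pM => //; last exact: phiK.
    apply: le_trans (ler_normB _ _) _; rewrite normrM !ger0_norm//; [|lra..].
    by rewrite lerD2r ler_piMr//; lra.
  rewrite -mulrA ler_pM2l// -[leRHS]mul1r; apply: ler_pM => //; last exact: dphiK.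
  rewrite !ger0_norm//; last by lra.
  nra.
rewrite ler_pdivlMr; last by lra.
rewrite mulrC -RintegralZl//.
have -> : q + k - 2 = \int[P]_t (q + k - 2 - S t).
  by rewrite RintegralB// ?main ?Rintegral_cst_prob ?subr0//; exact: integrable_cst_prob.
apply: le_Rintegral => //.
- exact: integrableZl_EFin.
- by apply: integrableB_EFin => //; exact: integrable_cst_prob.
move=> t _; rewrite -/(phi (B t)).
have /andP[h1 h2] := p1 _ (B01 t).
have /andP[b0 b1] := B01 t.
rewrite -subr_ge0.
have e1 : (B t + eps) * phi (B t) = 1.
  by rewrite /phi divff// gt_eqF// ltr_wpDl.
(* What the regularization adds is a sum of nonnegative terms, the first one because [4 <= q + k].
   The bound is therefore uniform in [eps]. *)
rewrite (_ : _ - _ = (q + k - 4) * eps * phi (B t) + 2 * eps * phi (B t) ^+ 2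
  + 2 * eps ^+ 2 * phi (B t) ^+ 2); last first.
  have v0 : phi (B t) != 0 by rewrite gt_eqF.
  have -> : S t = ((q + k) * ((phi (B t))^-1 - eps) - q) * phi (B t) +
      2 * (((phi (B t))^-1 - eps) * (1 - ((phi (B t))^-1 - eps))) * phi (B t) ^+ 2.
    by rewrite /S /dphi /phi invrK addrK; ring.
  by field.
have k0 : 0 <= q + k - 4 by lra.
by rewrite !addr_ge0// !mulr_ge0// ?sqr_ge0// ltW.
Qed.

End moments.

Section residual_moments.
Context d (T : measurableType d) (R : realType) (P : probability T R).
Variables (n : nat) (y : T -> n.-tuple R).
Hypotheses (my : measurable_fun setT y) (sy : spherical P y).
Hypothesis y_neq0 : P (y @^-1` [set [tuple of nseq n 0]]) = 0%E.
Hypothesis n4 : (4 <= n)%N.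

Let tail k := [set j : 'I_n | (k < j)%N]%SET.

Let sqsum_tail k (x : n.-tuple R) : sqsum (tail k) x = resid k x.
Proof. by rewrite /sqsum /resid; apply: eq_bigl => j; rewrite inE. Qed.

Let card_tail k : #|tail k| = (n - k.+1)%N.
Proof.
rewrite -sum1_card -[RHS]muln1 -sum_nat_const_nat big_geq_mkord /=.
by apply: eq_bigl => j; rewrite inE.
Qed.

Let head k := [set j : 'I_n | (0 < j <= k)%N]%SET.

Let card_head k : (k < n)%N -> #|head k| = k.
Proof.
move=> kn; rewrite -sum1_card -[RHS]muln1 -[X in (X * 1)%N](subnK (leq0n k)) addn0.
rewrite -sum_nat_const_nat.
rewrite (_ : \sum_(0 <= i < k) 1 = \sum_(1 <= i < k.+1) 1)%N; last first.
  by rewrite big_add1.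
rewrite (big_nat_widen _ _ n)//= big_geq_mkord /=.
by apply: eq_bigl => j; rewrite inE ltnS andbC.
Qed.

Let sqsum_head k (x : n.-tuple R) : sqsum (tail k) x + sqsum (head k) x = resid 0 x.
Proof.
rewrite addrC /sqsum /resid (bigID (fun j : 'I_n => (j <= k)%N) (fun j : 'I_n => (0 < j)%N)) /=.
congr (_ + _); apply: eq_bigl => j; rewrite inE//.
rewrite -ltnNge; case: (ltnP k j) => kj; rewrite ?andbF// andbT.
by rewrite (leq_ltn_trans _ kj).
Qed.

(** The assumption that [y] is almost surely nonzero must be strengthened to [y] having a nonzero
    coordinate other than the one of index 0. This is the positivity in [ratio_inv_moment], applied
    to the split of all coordinates into [tail 0] and index 0. *)
Let sqsum0_gt0 : {ae P, forall t, 0 < resid 0 (y t)}.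
Proof.
have n0 : (0 < n)%N by lia.
pose z := Ordinal n0; pose J := [set z]%SET.
have IJ i : i \in tail 0 -> i \notin J.
  by rewrite !inE; apply: contraTN => /eqP ->.
have rpos : {ae P, forall t, 0 < sqsum (tail 0) (y t) + sqsum J (y t)}.
  exists (y @^-1` [set [tuple of nseq n 0]]); split => //.
    rewrite -[_ @^-1` _]setTI; apply: my => //.
    rewrite (_ : [set _] = [set x : n.-tuple R | \sum_i tnth x i ^+ 2 <= 0]).
      have mS : measurable_fun setT (fun x : n.-tuple R => \sum_i tnth x i ^+ 2).
        apply: measurable_sum_cond => i; apply: measurable_funX.
        exact: measurable_tnth.
      have := mS measurableT `]-oo, 0]%classic (measurable_itv _).
      rewrite setTI (_ : _ @^-1` _ = [set x : n.-tuple R | \sum_i tnth x i ^+ 2 <= 0])//.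
    apply/seteqP; split=> x /=.
      move=> ->; rewrite big1// => i _.
      by rewrite (tnth_nth 0) /= nth_nseq ltn_ord expr0n.
    move=> h; apply: eq_from_tnth => i.
    have : tnth x i ^+ 2 == 0.
      rewrite eq_le sqr_ge0 andbT; apply: le_trans h.
      by rewrite (bigD1 i)//= lerDl; apply: sumr_ge0 => a _; rewrite sqr_ge0.
    by rewrite sqrf_eq0 => /eqP ->; rewrite (tnth_nth 0) /= nth_nseq ltn_ord.
  move=> t /= /negP; rewrite -leNgt => h; apply: eq_from_tnth => i.
  rewrite [RHS](tnth_nth 0) /= nth_nseq ltn_ord; apply/eqP.
  rewrite -sqrf_eq0 eq_le sqr_ge0 andbT; apply: le_trans h.
  have [iz|iz] := eqVneq i z.
    apply: (@le_trans _ _ (sqsum J (y t))); first by apply: sqsum_ge; rewrite inE iz.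
    by rewrite lerDr sqsum_ge0.
  apply: (@le_trans _ _ (sqsum (tail 0) (y t))); last by rewrite lerDl sqsum_ge0.
  apply: sqsum_ge; rewrite inE lt0n; apply: contra_neq iz => i0.
  exact: val_inj.
have cJ : #|J| = 1%N by rewrite cards1.
have q2 : 2 < #|tail 0|%:R :> R by rewrite card_tail ltr_nat; lia.
have m4 : 4 <= #|tail 0|%:R + #|J|%:R :> R.
  by rewrite card_tail cJ -natrD ler_nat; lia.
have [h _ _] := ratio_inv_moment my sy IJ rpos q2 m4.
apply: filterS h => t; rewrite -sqsum_tail => h.
rewrite lt0r sqsum_ge0 andbT; apply: contraTneq h => ->.
by rewrite mul0r ltxx.
Qed.

Variable k : nat.
Hypothesis kn : (k + 6 <= n)%N.
Let B t := resid_ratio k (y t).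
Let q : R := n%:R - 1 - k%:R.

Let BE t : B t = sqsum (tail k) (y t) / (sqsum (tail k) (y t) + sqsum (head k) (y t)).
Proof. by rewrite sqsum_head sqsum_tail. Qed.

Let th_disj i : i \in tail k -> i \notin head k.
Proof. by rewrite !inE => ki; rewrite negb_and orbC -ltnNge ki. Qed.

Let r_gt0 : {ae P, forall t, 0 < sqsum (tail k) (y t) + sqsum (head k) (y t)}.
Proof. by apply: filterS sqsum0_gt0 => t; rewrite sqsum_head. Qed.

Let qE : #|tail k|%:R = q.
Proof. by rewrite card_tail /q natrB ?(leq_trans _ kn)//; [rewrite -natr1; ring|lia]. Qed.

Let hE : #|head k|%:R = k%:R :> R.
Proof. by rewrite card_head//; lia. Qed.

Let BE' : B = fun t => sqsum (tail k) (y t) / (sqsum (tail k) (y t) + sqsum (head k) (y t)).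
Proof. by apply/funext => t; exact: BE. Qed.

Lemma measurable_ratio : measurable_fun setT B.
Proof. by rewrite BE'; exact: measurable_sqsum_ratio. Qed.

Lemma ratio01 t : 0 <= B t <= 1.
Proof. by rewrite BE'; exact: sqsum_ratio01. Qed.

Let inv : [/\ {ae P, forall t, 0 < B t},
      P.-integrable setT (EFin \o (fun t => (B t)^-1)) &
      \int[P]_t (B t)^-1 <= (q + k%:R - 2) / (q - 2)].
Proof.
have q2 : 2 < #|tail k|%:R :> R by rewrite card_tail ltr_nat; lia.
have m4 : 4 <= #|tail k|%:R + #|head k|%:R :> R.
  by rewrite -natrD card_tail card_head ?ler_nat; lia.
rewrite BE' -qE -hE.
exact: (ratio_inv_moment my sy th_disj r_gt0 q2 m4).
Qed.

Lemma ratio_gt0 : {ae P, forall t, 0 < B t}. Proof. by case: inv. Qed.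

Lemma integrable_ratioV : P.-integrable setT (EFin \o (fun t => (B t)^-1)).
Proof. by case: inv. Qed.

Lemma ratioV_le : \int[P]_t (B t)^-1 <= (q + k%:R - 2) / (q - 2).
Proof. by case: inv. Qed.

Lemma ratioX_rec j : (j < 4)%N ->
  (q + k%:R + 2 * j%:R) * \int[P]_t (B t ^+ j.+1) =
  (q + 2 * j%:R) * \int[P]_t (B t ^+ j).
Proof.
move=> j4; rewrite BE' -qE -hE.
exact: (ratio_moment_rec my sy th_disj r_gt0 j4).
Qed.

End residual_moments.

(** * Logarithmic moments of the residual ratio *)

Lemma ge0_of_derive_sign (R : realType) (f df : R -> R) :
  (forall x : R, 0 < x -> is_derive x 1 f (df x)) -> f 1 = 0 ->
  (forall x : R, 0 < x -> 0 <= df x * (x - 1)) -> forall x : R, 0 < x -> 0 <= f x.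
Proof.
move=> fdf f1 dfx x x0.
have cont (a b : R) : 0 < a -> {within `[a, b], continuous f}.
  move=> a0; apply: derivable_within_continuous => z.
  rewrite in_itv/= => /andP[az _].
  by have [] := fdf z (lt_le_trans a0 az).
have [x1|x1|->] := ltgtP x 1; last by rewrite f1.
- have [c|c] := @MVT R f df x 1 x1 _ (cont _ _ x0).
    by rewrite in_itv/= => /andP[xc _]; apply: fdf; exact: lt_trans xc.
  rewrite in_itv/= f1 => /andP[xc c1] h.
  have := dfx c (lt_trans x0 xc).
  rewrite nmulr_lge0 ?subr_lt0// => d0.
  by rewrite -oppr_le0 -sub0r h mulr_le0_ge0// subr_ge0 ltW.
- have [c|c] := @MVT R f df 1 x x1 _ (cont _ _ ltr01).
    by rewrite in_itv/= => /andP[xc _]; apply: fdf; exact: lt_trans xc.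
  rewrite in_itv/= f1 subr0 => /andP[xc c1] h.
  have := dfx c (lt_trans ltr01 xc).
  by rewrite h pmulr_lge0 ?subr_gt0// => d0; rewrite mulr_ge0// subr_ge0 ltW.
Qed.

Section log_expansion.
Variable R : realType.
Implicit Type w : R.

(** The derivative of the difference is [(w - 1)^3 / w], of the sign of [w - 1]. *)
Lemma ln_taylor3_le w : 0 < w ->
  ln w <= (w - 1) - (w - 1) ^+ 2 / 2 + (w - 1) ^+ 3 / 3.
Proof.
move=> w0; rewrite -subr_ge0.
pose f (w : R) := (w - 1) - (w - 1) ^+ 2 / 2 + (w - 1) ^+ 3 / 3 - ln w.
pose df (w : R) := (w - 1) ^+ 3 / w.
rewrite -/(f w); apply: (@ge0_of_derive_sign R f df) w0; rewrite /f /df.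
- move=> x x0.
  have h := is_derive1_ln x0.
  apply: is_derive_eq.
  rewrite /GRing.scale /=; field; rewrite gt_eqF//.
- by rewrite ln1; field.
- move=> x x0; rewrite mulrAC -exprSr divr_ge0 ?(ltW x0)//.
  by rewrite (exprM _ 2 2) sqr_ge0.
Qed.

(** The term [w^-1] in the remainder absorbs the divergence of [ln] at 0. The derivative of the
    difference is [(w - 1)^3] times a quadratic in [w^-1] without real root. *)
Lemma ln_taylor3_ge w : 0 < w ->
  (w - 1) - (w - 1) ^+ 2 / 2 + (w - 1) ^+ 3 / 3
    - (w - 1) ^+ 4 / 4 * (1 + w^-1) <= ln w.
Proof.
move=> w0; rewrite -subr_ge0.
(* [(w - 1)^4 / w] is expanded into a polynomial plus [w^-1], so that [g] is a polynomial plus [ln]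
   and the inverse is differentiated apart. *)
pose g (w : R) := ln w - ((w - 1) - (w - 1) ^+ 2 / 2 + (w - 1) ^+ 3 / 3) +
  ((w - 1) ^+ 4 + (w ^+ 3 - 4 * w ^+ 2 + 6 * w)) / 4.
pose f (w : R) := g w + (4^-1 * w^-1 - 1).
pose df (w : R) := (w - 1) ^+ 3 * (1 - w^-1 / 4 + w^-1 ^+ 2 / 4).
have -> : ln w - (w - 1 - (w - 1) ^+ 2 / 2 + (w - 1) ^+ 3 / 3 -
    (w - 1) ^+ 4 / 4 * (1 + w^-1)) = f w.
  by rewrite /f /g; field; rewrite gt_eqF.
apply: (@ge0_of_derive_sign R f df) w0; rewrite /f /df.
- move=> x x0.
  have h := is_derive1_ln x0.
  have xn0 : x != 0 by rewrite gt_eqF.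
  have hV : is_derive x 1 (fun w : R => w^-1) (- x ^- 2).
    apply: DeriveDef; first by apply: derivableV.
    by rewrite deriveV// derive_id /GRing.scale/= mulr1.
  have hg : is_derive x 1 g (x^-1 - (1 - (x - 1) + (x - 1) ^+ 2) +
     (4 * (x - 1) ^+ 3 + (3 * x ^+ 2 - 8 * x + 6)) / 4).
    by apply: is_derive_eq; rewrite /GRing.scale /=; field.
  have hc : is_derive x 1 (fun w : R => 4^-1 * w^-1 - 1) (- 4^-1 * x ^- 2).
    by apply: is_derive_eq; rewrite /GRing.scale /=; field.
  by apply: (is_derive_eq (is_deriveD hg hc)); field.
- by rewrite /g ln1 invr1; field.
- move=> x x0; rewrite mulrAC -exprSr mulr_ge0//.
    by rewrite (exprM _ 2 2) sqr_ge0.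
  nra.
Qed.

(** For [w < 1], put [v = w^(1/4)]: then [ln w = 4 ln v] and [|ln v| <= (1 - v) / v], whose fourth
    power has exactly [w] as denominator. Hence [256 = 4^4]. *)
Lemma ln_pow4_le w : 0 < w -> ln w ^+ 4 <= 256 * ((w - 1) ^+ 4 * (1 + w^-1)).
Proof.
move=> w0.
have s4 (x : R) : x ^+ 4 = (x ^+ 2) ^+ 2 by rewrite -exprM.
have y4 : 0 <= (w - 1) ^+ 4 by rewrite s4 sqr_ge0.
have wV : 0 < w^-1 by rewrite invr_gt0.
have yw : 0 <= (w - 1) ^+ 4 * w^-1 by rewrite mulr_ge0// ltW.
have mono4 (a b : R) : `|a| <= b -> a ^+ 4 <= b ^+ 4.
  move=> ab; have b0 : 0 <= b := le_trans (normr_ge0 a) ab.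
  rewrite -(ger0_norm (_ : 0 <= a ^+ 4)); last by rewrite s4 sqr_ge0.
  by rewrite normrX lerXn2r ?nnegrE.
have [w1|w1] := leP 1 w.
  have l0 : 0 <= ln w by rewrite ln_ge0.
  have l1 : ln w <= w - 1.
    by rewrite -{1}(subrK 1 w) addrC le_ln1Dx//; lra.
  have := mono4 (ln w) (w - 1); rewrite ger0_norm// => /(_ l1).
  lra.
pose v := Num.sqrt (Num.sqrt w).
have v0 : 0 < v by rewrite !sqrtr_gt0.
have v4 : v ^+ 4 = w by rewrite s4 !sqr_sqrtr// ?sqrtr_ge0// ltW.
have v1 : v <= 1.
  by rewrite leNgt; apply/negP => v1; have := exprn_ege1 4 (ltW v1); rewrite v4; lra.
have vw : w <= v by rewrite -v4 exprS ler_piMr ?(ltW v0)// exprn_ile1// ltW.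
have lv : - ln v <= (1 - v) / v.
  rewrite -lnV//; have := @le_ln1Dx R (v^-1 - 1).
  rewrite (addrC 1) subrK => h.
  have -> : (1 - v) / v = v^-1 - 1 by field; rewrite gt_eqF.
  by apply: h; rewrite ltrBrDr addNr invr_gt0.
have lv0 : ln v <= 0 by rewrite ln_le0.
have lw : ln w = 4 * ln v by rewrite -v4 lnXn// mulr_natl.
have h4 : ln v ^+ 4 <= ((1 - v) / v) ^+ 4.
  by apply: mono4; rewrite ler0_norm.
have h5 : (1 - v) ^+ 4 <= (w - 1) ^+ 4.
  rewrite -[(w - 1) ^+ 4]opprK -(mulN1r ((w-1)^+4)).
  have -> : - (-1 * (w - 1) ^+ 4) = (1 - w) ^+ 4 by ring.
  by apply: mono4; rewrite ger0_norm; lra.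
have -> : ln w ^+ 4 = 256 * ln v ^+ 4 by rewrite lw; ring.
rewrite ler_pM2l; last by lra.
apply: le_trans h4 _; rewrite expr_div_n v4 mulrDr mulr1.
have : (1 - v) ^+ 4 / w <= (w - 1) ^+ 4 / w by rewrite ler_pM2r.
lra.
Qed.

(** Only for [w] in [[1/2, 2]] is the expansion of [ln] used. Outside, [(w - 1)^4] is bounded below
    and every term is separately a multiple of [D]. The worst case is [w < 1/2], where [ln_pow4_le]
    gives [ln w ^+ 2 <= 128 D + 1/2 <= 136 D]. *)
Lemma ln_sqr_taylor w : 0 < w ->
  `|ln w ^+ 2 - ((w - 1) ^+ 2 - (w - 1) ^+ 3)| <= 200 * ((w - 1) ^+ 4 * (1 + w^-1)).
Proof.
move=> w0.
have wV : 0 < w^-1 by rewrite invr_gt0.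
have s4 (x : R) : x ^+ 4 = (x ^+ 2) ^+ 2 by rewrite -exprM.
have l4 := ln_pow4_le w0.
have lle := ln_taylor3_le w0; have lge := ln_taylor3_ge w0.
set Y := w - 1 in l4 lle lge *.
have y4 : 0 <= Y ^+ 4 by rewrite s4 sqr_ge0.
have yw : 0 <= Y ^+ 4 * w^-1 by rewrite mulr_ge0// ltW.
set D := Y ^+ 4 * (1 + w^-1) in l4 lge *.
have DY : Y ^+ 4 <= D by rewrite /D mulrDr mulr1 lerDl.
have [w1|w1] := ltP w (1/2).
  have Y2 : 1/4 <= Y ^+ 2 by rewrite /Y; nra.
  have Y4 : 1 <= 16 * Y ^+ 4 by rewrite s4; nra.
  have Ym : -1 <= Y <= 0 by rewrite /Y; apply/andP; split; lra.
  have ll : ln w ^+ 2 <= (ln w ^+ 4 + 1) / 2.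
    by have := sqr_ge0 (ln w ^+ 2 - 1); rewrite s4; nra.
  have l0 := sqr_ge0 (ln w).
  have Y3 : 0 <= Y ^+ 2 - Y ^+ 3 <= 2.
    have -> : Y ^+ 2 - Y ^+ 3 = Y ^+ 2 * (1 - Y) by ring.
    case/andP: Ym => ? ?; apply/andP; split; last by nra.
    by rewrite mulr_ge0 ?sqr_ge0//; lra.
  case/andP: Y3 => ? ?.
  rewrite ler_norml; apply/andP; split; lra.
have [w2|w2] := ltP 2 w.
  have Y1 : 1 <= Y by rewrite /Y; lra.
  have l0 : 0 <= ln w by rewrite ln_ge0//; lra.
  have l1 : ln w <= Y.
    by rewrite -{1}(subrK 1 w) addrC le_ln1Dx//; lra.
  have l2 : ln w ^+ 2 <= Y ^+ 2 by nra.
  have Y2 : Y ^+ 2 <= Y ^+ 4 by rewrite ler_weXn2l.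
  have Y30 : 0 <= Y ^+ 3 by rewrite exprn_ge0// (le_trans ler01).
  have Y34 : Y ^+ 3 <= Y ^+ 4 by rewrite (exprS Y 3) ler_peMl.
  have l3 := sqr_ge0 (ln w); have y20 := sqr_ge0 Y.
  rewrite ler_norml; apply/andP; split; lra.
have Y1 : -1/2 <= Y <= 1 by rewrite /Y; apply/andP; split; lra.
case/andP: Y1 => Ya Yb.
have wV2 : w^-1 <= 2.
  by rewrite -[2]invrK lef_pV2 ?posrE//; lra.
have D3 : D <= 3 * Y ^+ 4 by rewrite /D mulrC ler_wpM2r//; lra.
pose p := Y - Y ^+ 2 / 2 + Y ^+ 3 / 3.
have Y2a := sqr_ge0 Y.
have Y2b : Y ^+ 2 <= 1 by nra.
have Y3 : -1 <= Y ^+ 3 <= 1 by rewrite (exprS Y 2); apply/andP; split; nra.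
have Y4 : Y ^+ 4 <= 1 by rewrite s4 [leLHS]expr2 mulr_ile1.
have pb : -2 <= p <= 2.
  by case/andP: Y3 => ? ?; rewrite /p; apply/andP; split; lra.
have dl : 0 <= p - ln w <= D.
  have -> : D = Y ^+ 4 * (1 + w^-1) by [].
  by rewrite /p; apply/andP; split; lra.
case/andP: pb => pa pc; case/andP: dl => da dc.
have h1 : `|ln w ^+ 2 - p ^+ 2| <= 7 * D.
  have -> : ln w ^+ 2 - p ^+ 2 = - ((p - ln w) * (p + ln w)) by ring.
  rewrite normrN normrM (ger0_norm da) mulrC; apply: ler_pM => //.
  rewrite ler_norml; apply/andP; split; lra.
have h2 : `|p ^+ 2 - (Y ^+ 2 - Y ^+ 3)| <= 2 * Y ^+ 4.
  have -> : p ^+ 2 - (Y ^+ 2 - Y ^+ 3) =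
     (11 / 12 - Y / 3 + Y ^+ 2 / 9) * Y ^+ 4 by rewrite /p; field.
  rewrite normrM (ger0_norm y4) ler_wpM2r//.
  rewrite ler_norml; apply/andP; split; lra.
have -> : ln w ^+ 2 - (Y ^+ 2 - Y ^+ 3) =
  (ln w ^+ 2 - p ^+ 2) + (p ^+ 2 - (Y ^+ 2 - Y ^+ 3)) by ring.
apply: le_trans (ler_normD _ _) _.
lra.
Qed.

End log_expansion.

Section beta_log_moments.
Context d (T : measurableType d) (R : realType) (P : probability T R).
Variables (B : T -> R) (q k : R).
Hypotheses (mB : measurable_fun setT B) (B01 : forall t, 0 <= B t <= 1).
Hypothesis B_gt0 : {ae P, forall t, 0 < B t}.
Hypothesis iBV : P.-integrable setT (EFin \o (fun t => (B t)^-1)).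
Hypothesis EBV : \int[P]_t (B t)^-1 <= (q + k - 2) / (q - 2).
Hypothesis EBX : forall j, (j < 4)%N ->
  (q + k + 2 * j%:R) * \int[P]_t (B t ^+ j.+1) =
  (q + 2 * j%:R) * \int[P]_t (B t ^+ j).
Hypotheses (q5 : 5 <= q) (k0 : 0 <= k).

Let m := q + k.
(** [c] is the inverse of the mean of [B], so [Y] is centered. *)
Let c := m / q.
Let Y t := c * B t - 1.
(* This is [Y ^+ 4 * (1 + (c * B)^-1)], expanded so that its expectation only
   involves the moments of order at most 4 and the inverse moment. *)
Let D t := Y t ^+ 4 +
  ((c * B t) ^+ 3 - 4 * (c * B t) ^+ 2 + 6 * (c * B t) - 4 + c^-1 * (B t)^-1).

Let q_gt0 : 0 < q. Proof. exact: lt_le_trans q5. Qed.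
Let m_gt0 : 0 < m. Proof. exact: ltr_wpDr. Qed.
Let c_gt0 : 0 < c. Proof. by rewrite divr_gt0. Qed.
Let Q_gt0 : 0 < (q ^+ 2)^-1. Proof. by rewrite invr_gt0 exprn_gt0. Qed.

Let iBX j : P.-integrable setT (EFin \o (fun t => B t ^+ j)).
Proof.
apply: (@bounded_integrable _ _ _ P _ 1); first exact: measurable_funX.
by move=> t; have /andP[b0 b1] := B01 t;
  rewrite ger0_norm ?exprn_ge0// exprn_ile1.
Qed.

(** The powers of [Y] and [D] are all of this form, so [ilin] settles integrability and expectation
    for each of them at once. *)
Let lin a0 a1 a2 a3 a4 a5 t := a0 + a1 * B t + a2 * B t ^+ 2 + a3 * B t ^+ 3 +
  a4 * B t ^+ 4 + a5 * (B t)^-1.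

Let ilin a0 a1 a2 a3 a4 a5 :
  P.-integrable setT (EFin \o lin a0 a1 a2 a3 a4 a5) /\
  \int[P]_t lin a0 a1 a2 a3 a4 a5 t = a0 + a1 * (\int[P]_t (B t ^+ 1)) +
   a2 * (\int[P]_t (B t ^+ 2)) + a3 * (\int[P]_t (B t ^+ 3)) +
   a4 * (\int[P]_t (B t ^+ 4)) + a5 * (\int[P]_t (B t)^-1).
Proof.
have i0 := integrable_cst_prob P a0.
have i1 := integrableD_EFin i0 (integrableZl_EFin a1 (iBX 1)).
have i2 := integrableD_EFin i1 (integrableZl_EFin a2 (iBX 2)).
have i3 := integrableD_EFin i2 (integrableZl_EFin a3 (iBX 3)).
have i4 := integrableD_EFin i3 (integrableZl_EFin a4 (iBX 4)).
have i5 := integrableD_EFin i4 (integrableZl_EFin a5 iBV).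
split; first exact: i5.
rewrite /lin RintegralD//; last exact: integrableZl_EFin.
rewrite RintegralD//; last exact: integrableZl_EFin.
rewrite RintegralD//; last exact: integrableZl_EFin.
rewrite RintegralD//; last exact: integrableZl_EFin.
rewrite RintegralD//; last exact: (integrableZl_EFin a1 (iBX 1)).
by rewrite !RintegralZl// ?Rintegral_cst_prob//; exact: (iBX 1).
Qed.

Let M1 : \int[P]_t (B t ^+ 1) = q / m.
Proof.
have := @EBX 0 isT; rewrite mulr0 !addr0 => h.
have -> : q = q * \int[P]_t (B t ^+ 0).
  by under eq_Rintegral do rewrite expr0; rewrite Rintegral_cst_prob mulr1.
by rewrite -h -/m; field; rewrite gt_eqF.
Qed.

Let Mrec j (M : R) : (0 < j < 4)%N -> \int[P]_t (B t ^+ j) = M ->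
  \int[P]_t (B t ^+ j.+1) = M * (q + 2 * j%:R) / (m + 2 * j%:R).
Proof.
move=> /andP[_ j4] <-.
have mj : m + 2 * j%:R != 0 by rewrite gt_eqF// ltr_pwDl// mulr_ge0.
apply: (mulfI mj); rewrite /m EBX// -/m; field; exact: mj.
Qed.

Let M2 : \int[P]_t (B t ^+ 2) = q / m * (q + 2) / (m + 2).
Proof. by rewrite (Mrec (j := 1) _ M1)// mulr1. Qed.

Let M3 : \int[P]_t (B t ^+ 3) = q / m * (q + 2) / (m + 2) * (q + 4) / (m + 4).
Proof. by rewrite (Mrec (j := 2) _ M2)// -natrM. Qed.

Let M4 : \int[P]_t (B t ^+ 4) =
  q / m * (q + 2) / (m + 2) * (q + 4) / (m + 4) * (q + 6) / (m + 6).
Proof. by rewrite (Mrec (j := 3) _ M3)// -natrM. Qed.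

Let mnz : (q != 0) /\ (m != 0) /\ (m + 2 != 0) /\ (m + 4 != 0) /\ (m + 6 != 0).
Proof. by rewrite !gt_eqF//; have := m_gt0; lra. Qed.

Let EY1 : P.-integrable setT (EFin \o Y) /\ \int[P]_t Y t = 0.
Proof.
have -> : Y = lin (- 1) c 0 0 0 0 by apply/funext => t; rewrite /lin /Y; ring.
have [-> ->] := ilin (- 1) c 0 0 0 0; split => //.
by rewrite M1 /c; case: mnz => ? [? ?]; field; apply/andP; split.
Qed.

Let EY2 : P.-integrable setT (EFin \o (fun t => Y t ^+ 2)) /\
  \int[P]_t (Y t ^+ 2) = 2 * k / (q * (m + 2)).
Proof.
have -> : (fun t => Y t ^+ 2) = lin 1 (- 2 * c) (c ^+ 2) 0 0 0.
  by apply/funext => t; rewrite /lin /Y; ring.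
have [-> ->] := ilin 1 (- 2 * c) (c ^+ 2) 0 0 0; split => //.
rewrite M1 M2 /c; case: mnz => ? [? [? _]]; rewrite (_ : k = m - q).
  by field; rewrite ?mulf_neq0//; apply/and3P; split.
by rewrite /m; ring.
Qed.

Let EY3 : P.-integrable setT (EFin \o (fun t => Y t ^+ 3)) /\
  \int[P]_t (Y t ^+ 3) = 8 * k * (k - q) / (q ^+ 2 * (m + 2) * (m + 4)).
Proof.
have -> : (fun t => Y t ^+ 3) = lin (- 1) (3 * c) (- 3 * c ^+ 2) (c ^+ 3) 0 0.
  by apply/funext => t; rewrite /lin /Y; ring.
have [-> ->] := ilin (- 1) (3 * c) (- 3 * c ^+ 2) (c ^+ 3) 0 0; split => //.
rewrite M1 M2 M3 /c; case: mnz => ? [? [? [? _]]]; rewrite (_ : k = m - q).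
  by field; apply/and4P; split.
by rewrite /m; ring.
Qed.

Let EY4 : P.-integrable setT (EFin \o (fun t => Y t ^+ 4)) /\
  \int[P]_t (Y t ^+ 4) = 12 * k * (4 * m ^+ 2 + q * k * (m - 12)) /
     (q ^+ 3 * (m + 2) * (m + 4) * (m + 6)).
Proof.
have -> : (fun t => Y t ^+ 4) =
    lin 1 (- 4 * c) (6 * c ^+ 2) (- 4 * c ^+ 3) (c ^+ 4) 0.
  by apply/funext => t; rewrite /lin /Y; ring.
have [-> ->] := ilin 1 (- 4 * c) (6 * c ^+ 2) (- 4 * c ^+ 3) (c ^+ 4) 0; split => //.
rewrite M1 M2 M3 M4 /c; case: mnz => ? [? [? [? ?]]]; rewrite (_ : k = m - q).
  by field; apply/and5P; split.
by rewrite /m; ring.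
Qed.

Let iD : P.-integrable setT (EFin \o D).
Proof.
have -> : D = lin (1 - 4) (- 4 * c + 6 * c) (6 * c ^+ 2 - 4 * c ^+ 2)
    (- 4 * c ^+ 3 + c ^+ 3) (c ^+ 4) c^-1.
  by apply/funext => t; rewrite /D /lin /Y; ring.
by have [] := ilin (1 - 4) (- 4 * c + 6 * c) (6 * c ^+ 2 - 4 * c ^+ 2)
    (- 4 * c ^+ 3 + c ^+ 3) (c ^+ 4) c^-1.
Qed.

Let EY3_le : `|\int[P]_t (Y t ^+ 3)| <= 8 * (q ^+ 2)^-1.
Proof.
have [_ ->] := EY3.
have p1 : 0 < (m + 2) * (m + 4) by rewrite mulr_gt0//; have := m_gt0; lra.
rewrite -mulrA (_ : 8 * k * ((k - q) / _) =
  (8 * (q ^+ 2)^-1) * (k * (k - q) / ((m + 2) * (m + 4)))); last first.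
  by case: mnz => ? [? [? [? ?]]]; field; apply/and3P; split.
have Q8 : 0 <= 8 * (q ^+ 2)^-1 by rewrite mulr_ge0// ltW.
rewrite normrM (ger0_norm Q8) ler_piMr// normrM normfV (gtr0_norm p1).
rewrite ler_pdivrMr// mul1r ler_norml /m.
by have := q_gt0; have := k0; move=> ? ?; apply/andP; split; nra.
Qed.

Let EY4_le : \int[P]_t (Y t ^+ 4) <= 22 * (q ^+ 2)^-1.
Proof.
have k0' := k0; have q5' := q5; have q0' := q_gt0; have m0' := m_gt0.
have [_ ->] := EY4.
have p1 : 0 < (m + 2) * (m + 4) * (m + 6).
  by rewrite !mulr_gt0//; have := m_gt0; lra.
rewrite (_ : 12 * k * _ / _ = (q ^+ 2)^-1 *
   ((12 * k * (4 * m ^+ 2 + q * k * (m - 12)) / q) / ((m + 2) * (m + 4) * (m + 6)))).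
  rewrite mulrC ler_pM2r// ler_pdivrMr// ler_pdivrMr//.
  have h1 : 0 <= m ^+ 2 by rewrite sqr_ge0.
  have kq : k * q <= m * q by rewrite ler_pM2r// /m; lra.
  have km : k <= m by rewrite /m; lra.
  have a1 : 12 * k * (4 * m ^+ 2) <= 48 * m ^+ 3.
    rewrite (exprS m 2); nra.
  have a2 : 12 * k * (q * k * (m - 12)) <= 12 * q * m ^+ 3.
    apply: (@le_trans _ _ (12 * q * (k ^+ 2 * m))).
      have -> : 12 * k * (q * k * (m - 12)) = 12 * q * (k ^+ 2 * (m - 12)) by ring.
      rewrite ler_wpM2l//; last by rewrite ler_wpM2l ?sqr_ge0//; lra.
      by rewrite mulr_ge0// ltW.
    rewrite ler_wpM2l//; first by rewrite mulr_ge0// ltW.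
    rewrite (exprSr m 2); apply: ler_wpM2r; first exact: ltW.
    by apply: lerXn2r => //; rewrite nnegrE ltW.
  have m3 : 0 < m ^+ 3 by rewrite exprn_gt0.
  have a3 : m ^+ 3 <= (m + 2) * (m + 4) * (m + 6).
    have := m_gt0; rewrite (exprS m 2) expr2; nra.
  (* Here [q >= 5] is used; 22 is [48 / 5 + 12] rounded up. *)
  have a4 : 48 * m ^+ 3 <= 48 / 5 * q * m ^+ 3 by nra.
  have a5 : (48 / 5 + 12) * q * m ^+ 3 <=
    22 * q * ((m + 2) * (m + 4) * (m + 6)) by nra.
  lra.
by case: mnz => ? [? [? [? ?]]]; field; apply/and4P; split.
Qed.

Let ED_le : \int[P]_t D t <= 44 * (q ^+ 2)^-1.
Proof.
have k0' := k0; have q5' := q5; have q0' := q_gt0; have m0' := m_gt0.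
have [i4 _] := EY4.
pose G t := (c * B t) ^+ 3 - 4 * (c * B t) ^+ 2 + 6 * (c * B t) - 4 + c^-1 * (B t)^-1.
have GE : G = lin (- 4) (6 * c) (- 4 * c ^+ 2) (c ^+ 3) 0 c^-1.
  by apply/funext => t; rewrite /G /lin; ring.
have [iG EG] := ilin (- 4) (6 * c) (- 4 * c ^+ 2) (c ^+ 3) 0 c^-1.
rewrite /D RintegralD//; last by rewrite -/(G _); rewrite -GE in iG.
have -> : \int[P]_t ((c * B t) ^+ 3 - 4 * (c * B t) ^+ 2 + 6 * (c * B t) - 4 +
  c^-1 * (B t)^-1) = \int[P]_t G t by [].
suff : \int[P]_t G t <= 22 * (q ^+ 2)^-1 by have := EY4_le; lra.
rewrite GE EG M1 M2 M3 mul0r addr0.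
have q2 : 0 < q - 2 by lra.
have cV0 : 0 < c^-1 by rewrite invr_gt0.
apply: (@le_trans _ _ (- 4 + 6 * c * (q / m) +
  - 4 * c ^+ 2 * (q / m * (q + 2) / (m + 2)) +
  c ^+ 3 * (q / m * (q + 2) / (m + 2) * (q + 4) / (m + 4)) +
  c^-1 * ((m - 2) / (q - 2)))).
  by rewrite lerD2l ler_pM2l.
(* The first fraction is the third moment of [Y], at most [8 / q^2]; the second is at most
   [14 / q^2] because [q <= 5 / 3 * (q - 2)]. Adding 22 for the fourth moment gives the total 44. *)
have -> : - 4 + 6 * c * (q / m) +
  - 4 * c ^+ 2 * (q / m * (q + 2) / (m + 2)) +
  c ^+ 3 * (q / m * (q + 2) / (m + 2) * (q + 4) / (m + 4)) +
  c^-1 * ((m - 2) / (q - 2)) = 8 * k * (k - q) / (q ^+ 2 * (m + 2) * (m + 4))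
    + 4 * k * (q + m) / (m * q * (q - 2) * (m + 2)).
  rewrite /c; case: mnz => ? [? [? [? _]]]; rewrite (_ : k = m - q).
    by field; rewrite (gt_eqF q2); apply/and5P; split.
  by rewrite /m; ring.
have [_ E3] := EY3; rewrite -E3.
have : \int[P]_t Y t ^+ 3 <= 8 * (q ^+ 2)^-1.
  by apply: le_trans (ler_norm _) EY3_le.
suff : 4 * k * (q + m) / (m * q * (q - 2) * (m + 2)) <= 14 * (q ^+ 2)^-1 by lra.
have -> : 4 * k * (q + m) / (m * q * (q - 2) * (m + 2)) =
  (4 * k * (q + m) * q / (m * (q - 2) * (m + 2))) / q ^+ 2.
  by case: mnz => ? [? [? [? ?]]]; field; rewrite (gt_eqF q2); apply/and3P; split.
rewrite ler_pM2r// ler_pdivrMr; last first.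
  by rewrite !mulr_gt0//; have := m_gt0; lra.
have qq : q <= 5 / 3 * (q - 2) by lra.
have km : k * (q + m) <= 2 * (m * (m + 2)).
  rewrite /m; nra.
have h0 : 0 <= m * (m + 2) by rewrite mulr_ge0//; have := m_gt0; lra.
have h1 : k * (q + m) * q <= 2 * (m * (m + 2)) * q by rewrite ler_pM2r.
have h2 : 2 * (m * (m + 2)) * q <= 2 * (m * (m + 2)) * (5 / 3 * (q - 2)).
  by rewrite ler_wpM2l// mulr_ge0.
have -> : 14 * (m * (q - 2) * (m + 2)) = 14 * (m * (m + 2)) * (q - 2) by ring.
have : 0 <= m * (m + 2) * (q - 2) by rewrite mulr_ge0// ltW.
lra.
Qed.

(** These stand for the increments of [mu_n] and [sigma2]; the two hypotheses are supplied by
    [mu_step] and [sigma_step]. *)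
Variables (del v : R).
Hypothesis del_approx : `|ln (q / m) - del - k / (q * m)| <= 2 * (q ^+ 2)^-1.
Hypothesis v_approx : `|v - 2 * k / (q * m)| <= 2 * (q ^+ 2)^-1.

(** [L = l + h] almost everywhere: the logarithm of the ratio divided by its mean, plus a
    deterministic shift. *)
Let L t := ln (B t) - del.
Let l t := ln (c * B t).
Let h := ln (q / m) - del.

Let ml : measurable_fun setT l.
Proof.
apply: (measurableT_comp (@measurable_ln R)).
exact: measurable_funM.
Qed.

Let mL : measurable_fun setT L.
Proof. by apply: measurable_funB => //; exact: (measurableT_comp (@measurable_ln R)). Qed.

Let DE t : 0 < B t -> D t = (c * B t - 1) ^+ 4 * (1 + (c * B t)^-1).
Proof.
move=> b0; rewrite /D /Y (invfM c (B t)); have := c_gt0.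
by move: (B t) b0 (c) => b b0 e e0; field; rewrite !gt_eqF.
Qed.

Let lL : {ae P, forall t, L t = l t + h}.
Proof.
apply: filterS B_gt0 => t b0; rewrite /L /l /h.
have -> : q / m = c^-1 by rewrite invf_div.
by rewrite lnV ?posrE// lnM ?posrE//; ring.
Qed.

Let l4D : {ae P, forall t, l t ^+ 4 <= 256 * D t}.
Proof.
apply: filterS B_gt0 => t b0; rewrite DE//; apply: ln_pow4_le.
by rewrite mulr_gt0.
Qed.

Let l2D : {ae P, forall t, `|l t ^+ 2 - (Y t ^+ 2 - Y t ^+ 3)| <= 200 * D t}.
Proof.
apply: filterS B_gt0 => t b0; rewrite DE//; apply: ln_sqr_taylor.
by rewrite mulr_gt0.
Qed.

Let l1D : {ae P, forall t,
  `|l t - (Y t - Y t ^+ 2 / 2 + Y t ^+ 3 / 3)| <= 4^-1 * D t}.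
Proof.
apply: filterS B_gt0 => t b0; rewrite DE//.
have w0 : 0 < c * B t by rewrite mulr_gt0.
have := ln_taylor3_le w0; have := ln_taylor3_ge w0.
rewrite -/(l t) -/(Y t) => h1 h2.
have h3 : 0 <= Y t ^+ 4 / 4 * (1 + (c * B t)^-1).
  have wV : 0 < (c * B t)^-1 by rewrite invr_gt0.
  rewrite mulr_ge0//; last by lra.
  by rewrite divr_ge0// (exprM _ 2 2) sqr_ge0.
have -> : 4^-1 * (Y t ^+ 4 * (1 + (c * B t)^-1)) =
  Y t ^+ 4 / 4 * (1 + (c * B t)^-1) by ring.
by rewrite ler_norml; apply/andP; split; lra.
Qed.

Let ae_le_integrable (f g : T -> R) : measurable_fun setT f ->
  P.-integrable setT (EFin \o g) -> {ae P, forall t, `|f t| <= g t} ->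
  P.-integrable setT (EFin \o f).
Proof.
move=> mf gi fg; apply/integrableP; split; first exact/measurable_EFinP.
have mg := integrable_measurable_EFin gi.
have /integrableP[_ +] := gi; apply: le_lt_trans.
apply: ae_ge0_le_integral => //.
- by apply: measurableT_comp => //; exact/measurable_EFinP.
- by apply: measurableT_comp => //; exact/measurable_EFinP.
- apply: filterS fg => t ht _ /=; rewrite lee_fin.
  exact: le_trans ht (ler_norm _).
Qed.

Let il4 : P.-integrable setT (EFin \o (fun t => l t ^+ 4)).
Proof.
apply: (@ae_le_integrable _ (fun t => 256 * D t)).
- exact: measurable_funX.
- exact: integrableZl_EFin.
- apply: filterS l4D => t; rewrite ger0_norm//.
  by rewrite (exprM _ 2 2) sqr_ge0.
Qed.

Let i1l4 : P.-integrable setT (EFin \o (fun t => 1 + l t ^+ 4)).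
Proof. by apply: integrableD_EFin => //; exact: integrable_cst_prob. Qed.

Let il1 : P.-integrable setT (EFin \o l).
Proof.
apply: (@ae_le_integrable _ (fun t => 1 + l t ^+ 4)) => //.
apply: aeW => t; rewrite (exprM _ 2 2).
have := sqr_ge0 (l t); have := sqr_ge0 (l t ^+ 2 - 1).
have := sqr_ge0 (l t - 1); have := sqr_ge0 (l t + 1).
by rewrite ler_norml => ? ? ? ?; apply/andP; split; nra.
Qed.

Let il2 : P.-integrable setT (EFin \o (fun t => l t ^+ 2)).
Proof.
apply: (@ae_le_integrable _ (fun t => 1 + l t ^+ 4)) => //.
  exact: measurable_funX.
apply: aeW => t; rewrite (exprM _ 2 2) ger0_norm ?sqr_ge0//.
by have := sqr_ge0 (l t ^+ 2 - 1); nra.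
Qed.

(** In the cubic Taylor polynomial of [ln] at 1, the linear term has mean 0 and the quadratic one
    gives [- k / (q (m + 2))]. The cubic term costs [8 / 3] and the remainder [44 / 4], in units of
    [q^-2]. *)
Let El1 : `|\int[P]_t l t + k / (q * (m + 2))| <= 14 * (q ^+ 2)^-1.
Proof.
have Q0 := Q_gt0.
have [iY1 E1] := EY1; have [iY2 E2] := EY2; have [iY3 E3] := EY3.
have iT : P.-integrable setT (EFin \o (fun t => Y t - Y t ^+ 2 / 2 + Y t ^+ 3 / 3)).
  have a := integrableZl_EFin (- 2^-1) iY2; have b := integrableZl_EFin (3^-1) iY3.
  have := integrableD_EFin (integrableD_EFin iY1 a) b.
  by congr (_.-integrable _ _); apply/funext => t /=; congr EFin; ring.
have ET : \int[P]_t (Y t - Y t ^+ 2 / 2 + Y t ^+ 3 / 3) =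
    - (k / (q * (m + 2))) + (\int[P]_t (Y t ^+ 3)) / 3.
  rewrite (_ : (fun t => _) = fun t => Y t + (- 2^-1) * Y t ^+ 2 + 3^-1 * Y t ^+ 3).
    rewrite RintegralD//; [|exact: (integrableD_EFin iY1 (integrableZl_EFin _ iY2))|
      exact: integrableZl_EFin].
    rewrite RintegralD//; last exact: integrableZl_EFin.
    rewrite !RintegralZl// E1 E2.
    by case: mnz => ? [? [? _]]; field; apply/andP; split.
  by apply/funext => t; ring.
have := ae_le_norm_Rintegral (integrableB_EFin il1 iT) (integrableZl_EFin 4^-1 iD) l1D.
rewrite RintegralB// ET RintegralZl//.
have := EY3_le; have := ED_le.
rewrite !ler_norml => ? /andP[? ?] /andP[? ?]; apply/andP; split; lra.
Qed.

Let El2 : `|\int[P]_t (l t ^+ 2) - 2 * k / (q * (m + 2))| <= (200 * 44 + 8) * (q ^+ 2)^-1.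
Proof.
have Q0 := Q_gt0.
have [iY2 E2] := EY2; have [iY3 E3] := EY3.
have iT := integrableB_EFin iY2 iY3.
have := ae_le_norm_Rintegral (integrableB_EFin il2 iT) (integrableZl_EFin 200 iD) l2D.
rewrite RintegralB// RintegralB// E2 RintegralZl//.
have := EY3_le; have := ED_le.
rewrite !ler_norml => ? /andP[? ?] /andP[? ?]; apply/andP; split; lra.
Qed.

Let El4 : \int[P]_t (l t ^+ 4) <= 256 * 44 * (q ^+ 2)^-1.
Proof.
have := ae_le_Rintegral il4 (integrableZl_EFin 256 iD) l4D.
rewrite RintegralZl// => /le_trans; apply; rewrite -mulrA.
by apply: ler_wpM2l; [exact: ler0n|exact: ED_le].
Qed.

Let k1 : 0 <= k / (q * m) <= q^-1.
Proof.
rewrite divr_ge0 ?mulr_ge0 ?(ltW q_gt0) ?(ltW m_gt0)//= invfM mulrCA.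
by rewrite ler_piMr ?invr_ge0 ?(ltW q_gt0)// ler_pdivrMr// mul1r /m lerDr ltW.
Qed.

Let k2 : 0 <= k / (q * m) - k / (q * (m + 2)) <= 2 * (q ^+ 2)^-1.
Proof.
have k0' := k0; have q0' := q_gt0; have m0' := m_gt0.
have m2 : 0 < m + 2 by lra.
have -> : k / (q * m) - k / (q * (m + 2)) = 2 * (k * q / (m * (m + 2))) / q ^+ 2.
  by case: mnz => ? [? [? _]]; field; apply/and3P; split.
have h0 : 0 <= k * q / (m * (m + 2)).
  by rewrite divr_ge0 ?mulr_ge0// ltW.
apply/andP; split; first by apply: divr_ge0; [apply: mulr_ge0|exact: sqr_ge0].
rewrite ler_pM2r//; rewrite -[leRHS]mulr1 ler_pM2l// ler_pdivrMr ?mulr_gt0//.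
rewrite mul1r /m; nra.
Qed.

Let Qq : (q ^+ 2)^-1 <= 5^-1 * q^-1.
Proof.
rewrite expr2 invfM ler_pM2r ?invr_gt0// lef_pV2 ?posrE//.
Qed.

Let h_bound : 0 <= h + 2 * (q ^+ 2)^-1 /\ h <= 7 / 5 * q^-1.
Proof.
have := del_approx; rewrite -/h ler_norml => /andP[h1 h2].
have /andP[h3 h4] := k1; have h5 := Qq; split; lra.
Qed.

(** Up to [O(q^-2)], the mean of [l] is [- k / (q m)] and [h] is the opposite. The constant 18 is 14
    from [El1], plus 2 for replacing [m + 2] by [m] and 2 from [del_approx]. *)
Lemma log_mean_bound : P.-integrable setT (EFin \o L) /\
  `|\int[P]_t L t| <= 18 * (q ^+ 2)^-1.
Proof.
have i : P.-integrable setT (EFin \o (fun t => l t + h)).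
  by apply: integrableD_EFin => //; exact: integrable_cst_prob.
split.
  apply: (@ae_le_integrable _ (fun t => `|l t + h|)) => //.
    by have := integrable_norm i.
  by apply: filterS lL => t ->.
rewrite (ae_eq_Rintegral mL _ lL); last exact: integrable_measurable_EFin i.
rewrite RintegralD//; last exact: integrable_cst_prob.
rewrite Rintegral_cst_prob.
have := del_approx; rewrite -/h; have := El1; have := k2.
rewrite !ler_norml => /andP[? ?] /andP[? ?] /andP[? ?].
by apply/andP; split; lra.
Qed.

Lemma log_sqr_bound : P.-integrable setT (EFin \o (fun t => L t ^+ 2)) /\
  `|\int[P]_t (L t ^+ 2) - v| <= 90 * 100 * (q ^+ 2)^-1.
Proof.
have i : P.-integrable setT (EFin \o (fun t => l t ^+ 2 + (2 * h * l t + h ^+ 2))).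
  apply: integrableD_EFin => //; apply: integrableD_EFin.
    exact: integrableZl_EFin.
  exact: integrable_cst_prob.
have E : {ae P, forall t, L t ^+ 2 = l t ^+ 2 + (2 * h * l t + h ^+ 2)}.
  by apply: filterS lL => t ->; ring.
have mL2 : measurable_fun setT (fun t => L t ^+ 2) by exact: measurable_funX.
split.
  apply: (@ae_le_integrable _ (fun t => `|l t ^+ 2 + (2 * h * l t + h ^+ 2)|)) => //.
    by have := integrable_norm i.
  by apply: filterS E => t ->.
rewrite (ae_eq_Rintegral mL2 _ E); last exact: integrable_measurable_EFin i.
have ih : P.-integrable setT (EFin \o (fun t => 2 * h * l t)).
  exact: integrableZl_EFin.
have ic := integrable_cst_prob P (h ^+ 2).
rewrite RintegralD//; last exact: integrableD_EFin.
rewrite RintegralD// RintegralZl// Rintegral_cst_prob.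
have qV : 0 < q^-1 by rewrite invr_gt0.
have El1' : `|\int[P]_t l t| <= 4 * q^-1.
  have := El1; have := k2; have := k1; have := Qq.
  rewrite !ler_norml => ? /andP[? ?] /andP[? ?] /andP[? ?].
  by apply/andP; split; lra.
have hb : `|h| <= 7 / 5 * q^-1.
  case: h_bound => ? ?; have := Qq; rewrite ler_norml => ?.
  by apply/andP; split; lra.
have qq : q^-1 * q^-1 = (q ^+ 2)^-1 by rewrite -expr2 exprVn.
have b1 : `|2 * h * \int[P]_t l t| <= 12 * (q ^+ 2)^-1.
  rewrite -mulrA normrM (ger0_norm (_ : 0 <= 2))// normrM.
  have : `|h| * `|\int[P]_t l t| <= (7 / 5 * q^-1) * (4 * q^-1) by exact: ler_pM.
  have -> : (7 / 5 * q^-1) * (4 * q^-1) = 28 / 5 * (q^-1 * q^-1) by ring.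
  rewrite qq; have := Q_gt0; lra.
have b2 : 0 <= h ^+ 2 <= 2 * (q ^+ 2)^-1.
  rewrite sqr_ge0 /= -real_normK ?num_real// expr2.
  have : `|h| * `|h| <= (7 / 5 * q^-1) * (7 / 5 * q^-1) by exact: ler_pM.
  have -> : (7 / 5 * q^-1) * (7 / 5 * q^-1) = 49 / 25 * (q^-1 * q^-1).
    by field; rewrite gt_eqF.
  rewrite qq; have := Q_gt0; lra.
have k2' : 0 <= 2 * k / (q * m) - 2 * k / (q * (m + 2)) <= 4 * (q ^+ 2)^-1.
  by have := k2; rewrite -!mulrA => /andP[? ?]; apply/andP; split; lra.
have := v_approx; have := El2; move: b1 b2 k2'.
rewrite !ler_norml => /andP[? ?] /andP[? ?] /andP[? ?] /andP[? ?] /andP[? ?].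
by have := Q_gt0 => ?; apply/andP; split; lra.
Qed.

(** An odd absolute moment is not accessible through moments of [B]. It is interpolated by
    [|L|^3 <= (L^2 / s + s L^4) / 2], where [s = sqrt q] balances a second moment of order [1 / q]
    and a fourth moment of order [1 / q^2]. *)
Lemma log_cube_bound : P.-integrable setT (EFin \o (fun t => `|L t| ^+ 3)) /\
  \int[P]_t (`|L t| ^+ 3) <= 60 * 10 * 100 * (q * Num.sqrt q)^-1.
Proof.
have [iL2 L2b] := log_sqr_bound.
have qV : 0 < q^-1 by rewrite invr_gt0.
have s0 : 0 < Num.sqrt q by rewrite sqrtr_gt0.
have ss : Num.sqrt q * Num.sqrt q = q by rewrite -expr2 sqr_sqrtr// ltW.
set s := Num.sqrt q in s0 ss *.
have i4 : P.-integrable setT (EFin \o (fun t => 8 * (l t ^+ 4 + h ^+ 4))).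
  by apply/integrableZl_EFin/integrableD_EFin => //; exact: integrable_cst_prob.
pose G t := 2^-1 * (s^-1 * L t ^+ 2 + s * (8 * (l t ^+ 4 + h ^+ 4))).
have iG : P.-integrable setT (EFin \o G).
  by apply/integrableZl_EFin/integrableD_EFin; exact: integrableZl_EFin.
have LG : {ae P, forall t, `|L t| ^+ 3 <= G t}.
  apply: filterS lL => t Lt; rewrite /G.
  have L4 : L t ^+ 4 <= 8 * (l t ^+ 4 + h ^+ 4).
    rewrite Lt; have h1 := sqr_ge0 (l t - h); have h2 := sqr_ge0 (l t + h).
    have h3 := sqr_ge0 (l t ^+ 2 - h ^+ 2).
    have h4 : (l t + h) ^+ 2 <= 2 * (l t ^+ 2 + h ^+ 2) by lra.
    have h5 : ((l t + h) ^+ 2) ^+ 2 <= (2 * (l t ^+ 2 + h ^+ 2)) ^+ 2.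
      by rewrite lerXn2r// ?nnegrE// mulr_ge0// addr_ge0// sqr_ge0.
    rewrite (exprM _ 2 2); apply: le_trans h5 _; lra.
  apply: (@le_trans _ _ (2^-1 * (s^-1 * L t ^+ 2 + s * L t ^+ 4))); last first.
    by rewrite ler_pM2l ?invr_gt0// lerD2l ler_pM2l.
  rewrite -[L t ^+ 2]real_normK ?num_real//.
  have -> : L t ^+ 4 = `|L t| ^+ 4.
    by rewrite -normrX ger0_norm// (exprM _ 2 2) sqr_ge0.
  move: `|L t| (normr_ge0 (L t)) => a a0; rewrite -subr_ge0.
  have -> : 2^-1 * (s^-1 * a ^+ 2 + s * a ^+ 4) - a ^+ 3 =
      2^-1 * s^-1 * (a * (1 - s * a)) ^+ 2.
    by field; rewrite gt_eqF.
  by rewrite mulr_ge0 ?sqr_ge0// mulr_ge0// invr_ge0 ltW.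
have mc : measurable_fun setT (fun t => `|L t| ^+ 3).
  by apply: measurable_funX; exact: measurableT_comp.
have i3 : P.-integrable setT (EFin \o (fun t => `|L t| ^+ 3)).
  apply: (@ae_le_integrable _ G) => //; apply: filterS LG => t.
  by rewrite normrX normr_id.
split => //; apply: le_trans (ae_le_Rintegral i3 iG LG) _.
rewrite /G RintegralZl//; last by apply: integrableD_EFin; exact: integrableZl_EFin.
rewrite RintegralD//; [|exact: integrableZl_EFin|exact: integrableZl_EFin].
rewrite RintegralZl// RintegralZl// RintegralZl//; last first.
  by apply: integrableD_EFin => //; exact: integrable_cst_prob.
rewrite RintegralD//; last exact: integrable_cst_prob.
rewrite Rintegral_cst_prob.
have hb : `|h| <= 7 / 5 * q^-1.
  case: h_bound => ? ?; have := Qq; rewrite ler_norml => ?.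
  by apply/andP; split; lra.
have h2 : h ^+ 2 <= 2 * (q ^+ 2)^-1.
  rewrite -real_normK ?num_real// expr2.
  have : `|h| * `|h| <= (7 / 5 * q^-1) * (7 / 5 * q^-1) by exact: ler_pM.
  have -> : (7 / 5 * q^-1) * (7 / 5 * q^-1) = 49 / 25 * (q^-1 * q^-1).
    by field; rewrite gt_eqF.
  rewrite (_ : q^-1 * q^-1 = (q ^+ 2)^-1); last by rewrite expr2 invfM.
  have := Q_gt0; lra.
have q1 : q^-1 <= 5^-1 by rewrite lef_pV2 ?posrE.
have Q1 : (q ^+ 2)^-1 <= 25^-1 by have := Qq; lra.
have h4 : h ^+ 4 <= (q ^+ 2)^-1.
  rewrite (exprM _ 2 2).
  apply: (@le_trans _ _ ((2 * (q ^+ 2)^-1) ^+ 2)).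
    by rewrite lerXn2r// ?nnegrE ?sqr_ge0// mulr_ge0// ltW.
  rewrite exprMn expr2 [X in _ * X]expr2 mulrA; rewrite ler_piMl ?(ltW Q_gt0)//; lra.
have vb : v <= 2 * q^-1 + 2 * (q ^+ 2)^-1.
  have := v_approx; have := k1; rewrite ler_norml -mulrA => /andP[? ?] /andP[? ?]; lra.
have L2' : \int[P]_t L t ^+ 2 <= 18 * 101 * q^-1.
  move: L2b; rewrite ler_norml => /andP[? ?]; have := Qq; lra.
have L4' : 8 * (\int[P]_t l t ^+ 4 + h ^+ 4) <= 90 * 10 * 101 * (q ^+ 2)^-1.
  by have := El4; have := Q_gt0; lra.
have E1 : s^-1 * q^-1 = (q * s)^-1 by rewrite invfM mulrC.
have E2 : s * (q ^+ 2)^-1 = (q * s)^-1.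
  have sn0 : s != 0 by rewrite gt_eqF.
  have qn0 : q != 0 by rewrite gt_eqF.
  transitivity ((s * s) / (q ^+ 2 * s)); first by field; apply/andP.
  by rewrite ss; field; apply/andP.
have b1 : s^-1 * \int[P]_t L t ^+ 2 <= 18 * 101 * (q * s)^-1.
  by rewrite -E1 (mulrCA _ s^-1); apply: ler_wpM2l => //; rewrite invr_ge0 ltW.
have b2 : s * (8 * (\int[P]_t l t ^+ 4 + h ^+ 4)) <= 90 * 10 * 101 * (q * s)^-1.
  by rewrite -E2 (mulrCA _ s); apply: ler_wpM2l => //; exact: ltW.
have : 0 < (q * s)^-1 by rewrite invr_gt0 mulr_gt0.
lra.
Qed.

End beta_log_moments.

(** * Increments and lower bounds of the centering and scaling sequences *)

Section steps.
Variable R : realType.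

Lemma ln1B_bound (x : R) : 0 < x <= 5^-1 ->
  0 <= - ln (1 - x) - x - x ^+ 2 / 2 <= x ^+ 3.
Proof.
move=> /andP[x0 x5].
have w0 : 0 < 1 - x by lra.
have := ln_taylor3_le w0; have := ln_taylor3_ge w0.
have -> : 1 - x - 1 = - x by ring.
have wV : (1 - x)^-1 <= 5 / 4.
  by rewrite -[leRHS]invrK lef_pV2 ?posrE ?invr_gt0//; lra.
have x3 : 0 <= x ^+ 3 by rewrite exprn_ge0// ltW.
have x4 : x ^+ 4 <= 5^-1 * x ^+ 3 by rewrite (exprS x 3) ler_wpM2r.
have x4' : 0 <= x ^+ 4 by rewrite exprn_ge0// ltW.
have -> : (- x) ^+ 4 = x ^+ 4 by ring.
have -> : (- x) ^+ 3 = - x ^+ 3 by ring.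
have -> : (- x) ^+ 2 = x ^+ 2 by ring.
have h : x ^+ 4 / 4 * (1 + (1 - x)^-1) <= x ^+ 4 / 4 * (9 / 4).
  by rewrite ler_wpM2l ?divr_ge0//; lra.
move=> h1 h2; apply/andP; split; lra.
Qed.

(** The quantity under the square root in [sigma_n]: variances, not deviations, add up over the
    columns. *)
Definition sigma2 (n p : nat) : R :=
  - 2 * (p%:R / (n%:R - 1) + ln (1 - p%:R / (n%:R - 1))).

Section one_step.
Variables n p : nat.
Hypothesis pn : (p + 6 <= n)%N.
Let M : R := n%:R - 1.
Let q : R := n%:R - 1 - p%:R.

Lemma q_ge5 : 5 <= q.
Proof.
have h : (p + 6)%:R <= n%:R :> R by rewrite ler_nat.
by rewrite natrD in h; rewrite /q; lra.
Qed.

Let M_gt0 : 0 < M.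
Proof. by apply: (@lt_le_trans _ _ q); [exact: lt_le_trans q_ge5|rewrite /q lerBlDr lerDl]. Qed.

Let x := q^-1.
Let x01 : 0 < x <= 5^-1.
Proof.
have q0 : 0 < q by exact: lt_le_trans q_ge5.
by rewrite /x invr_gt0 q0/= lef_pV2 ?posrE// q_ge5.
Qed.

Let lnS : ln (1 - p.+1%:R / M) = ln (q / M) + ln (1 - x).
Proof.
have q0 : 0 < q by exact: lt_le_trans q_ge5.
have /andP[x0 x5] := x01.
rewrite -lnM ?posrE ?divr_gt0//; last by lra.
by congr ln; rewrite /x -natr1 /q -/M; field; rewrite (gt_eqF M_gt0) -/M (gt_eqF q0).
Qed.

Let ln0 : ln (1 - p%:R / M) = ln (q / M).
Proof. by congr ln; rewrite /q -/M; field; rewrite (gt_eqF M_gt0). Qed.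

(** Passing from [p] to [p.+1] multiplies the argument of the logarithm by [1 - x] with [x = 1 / q].
    The constant [3 / 2] in [mu_n] makes the terms of order [x] match exactly, through
    [1 / q - 1 / M = p / (q M)]. What is left is [3/4 x^2] and [q - 3/2] times the third-order
    remainder [th] of the logarithm. *)
Lemma mu_step :
  `|ln (q / M) - (mu_n R n p.+1 - mu_n R n p) - p%:R / (q * M)| <= 2 * (q ^+ 2)^-1.
Proof.
have q0 : 0 < q by exact: lt_le_trans q_ge5.
have q5 := q_ge5.
have /andP[h1 h2] := ln1B_bound x01.
have /andP[x0 x5] := x01.
set th := - ln (1 - x) - x - x ^+ 2 / 2 in h1 h2.
have -> : ln (q / M) - (mu_n R n p.+1 - mu_n R n p) - p%:R / (q * M) =
  3 / 4 * x ^+ 2 - (q - 3 / 2) * th.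
  rewrite /mu_n -/M lnS ln0.
  have -> : ln (1 - x) = - x - x ^+ 2 / 2 - th by rewrite /th; ring.
  move: (ln (q / M)) th {h1 h2} => l th.
  have -> : p%:R = M - q by rewrite /q /M; ring.
  have -> : p.+1%:R = M - q + 1 by rewrite -natr1 /q /M; ring.
  have -> : n%:R = M + 1 by rewrite /M; ring.
  rewrite /x; field; by rewrite (gt_eqF M_gt0) (gt_eqF q0).
rewrite -exprVn -/x.
have qx : q * x = 1 by rewrite divff// gt_eqF.
have h3 : (q - 3 / 2) * th <= x ^+ 2.
  apply: (@le_trans _ _ (q * x ^+ 3)).
    by apply: ler_pM => //; lra.
  by rewrite exprS mulrA qx mul1r.
have h4 : 0 <= (q - 3 / 2) * th by rewrite mulr_ge0//; lra.
have := sqr_ge0 x.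
by move=> ?; rewrite ler_norml; apply/andP; split; lra.
Qed.

(** The increment is exactly [2 p / (q M) + x^2 + 2 th] with [th >= 0], which shows its positivity
    as well. *)
Lemma sigma_step :
  `|(sigma2 n p.+1 - sigma2 n p) - 2 * p%:R / (q * M)| <= 2 * (q ^+ 2)^-1 /\
  0 < sigma2 n p.+1 - sigma2 n p.
Proof.
have q0 : 0 < q by exact: lt_le_trans q_ge5.
have /andP[h1 h2] := ln1B_bound x01.
have /andP[x0 x5] := x01.
set th := - ln (1 - x) - x - x ^+ 2 / 2 in h1 h2.
have E : (sigma2 n p.+1 - sigma2 n p) - 2 * p%:R / (q * M) = x ^+ 2 + 2 * th.
  rewrite /sigma2 -/M lnS ln0.
  have -> : ln (1 - x) = - x - x ^+ 2 / 2 - th by rewrite /th; ring.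
  move: (ln (q / M)) th {h1 h2} => l th.
  have -> : p%:R = M - q by rewrite /q /M; ring.
  have -> : p.+1%:R = M - q + 1 by rewrite -natr1 /q /M; ring.
  rewrite /x; field; by rewrite (gt_eqF M_gt0) (gt_eqF q0).
have x2 : 0 < x ^+ 2 by rewrite exprn_gt0.
have h3 : th <= 5^-1 * x ^+ 2.
  by apply: le_trans h2 _; rewrite exprS ler_wpM2r// ltW.
split.
  by rewrite E -exprVn -/x ger0_norm; lra.
have : 0 <= 2 * p%:R / (q * M).
  by rewrite divr_ge0// mulr_ge0// ltW.
lra.
Qed.

(** Discrete form of integrating [q^(-3/2)]: with [a = sqrt q] and [b = sqrt (q - 1)], the
    difference [1 / b - 1 / a] is [1 / (a b (a + b))], and [b <= a]. *)
Lemma sum_term_le : (q * Num.sqrt q)^-1 <=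
  2 * ((Num.sqrt (n%:R - 1 - p.+1%:R))^-1 - (Num.sqrt (n%:R - 1 - p%:R))^-1).
Proof.
have q5 := q_ge5.
rewrite -/q; have -> : n%:R - 1 - p.+1%:R = q - 1 by rewrite /q -natr1; ring.
have q0 : 0 < q by lra.
have q1 : 0 < q - 1 by lra.
have a0 : 0 < Num.sqrt q by rewrite sqrtr_gt0.
have b0 : 0 < Num.sqrt (q - 1) by rewrite sqrtr_gt0.
have a2 : Num.sqrt q ^+ 2 = q by rewrite sqr_sqrtr// ltW.
have b2 : Num.sqrt (q - 1) ^+ 2 = q - 1 by rewrite sqr_sqrtr// ltW.
have ba : Num.sqrt (q - 1) <= Num.sqrt q by rewrite ler_sqrt; lra.
move: (Num.sqrt q) (Num.sqrt (q - 1)) a0 b0 a2 b2 ba => a b a0 b0 a2 b2 ba.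
have -> : b^-1 - a^-1 = (a * b * (a + b))^-1.
  have ab : (a - b) * (a + b) = 1 by rewrite -subr_sqr a2 b2; ring.
  have abn : a + b != 0 by rewrite gt_eqF// addr_gt0.
  rewrite -[in RHS](mul1r (_^-1)) -ab.
  by field; rewrite abn (gt_eqF a0) (gt_eqF b0).
have Z0 : 0 < a * b * (a + b) by rewrite !mulr_gt0 ?addr_gt0.
have X0 : 0 < q * a by rewrite mulr_gt0.
rewrite ler_pdivlMr// mulrC ler_pdivrMr// -a2.
have : b * (a + b) <= a * (a + a) by apply: ler_pM; lra.
rewrite -(ler_pM2l a0); lra.
Qed.

End one_step.

Lemma sum_terms_le n p : (p + 5 <= n)%N ->
  \sum_(k < p) ((n%:R - 1 - k%:R) * Num.sqrt (n%:R - 1 - k%:R))^-1 <=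
  2 / Num.sqrt (n%:R - 1 - p%:R) :> R.
Proof.
move=> pn.
pose u k : R := (Num.sqrt (n%:R - 1 - k%:R))^-1.
apply: (@le_trans _ _ (2 * (u p - u 0))).
  rewrite -(telescope_sumr u (leq0n p)) mulr_sumr big_mkord.
  apply: ler_sum => k _; apply: sum_term_le.
  by have := ltn_ord k; lia.
rewrite ler_pM2l// lerBlDr lerDl.
by rewrite invr_ge0 sqrtr_ge0.
Qed.

Lemma sigma2_ge_sqr n p : (p + 5 <= n)%N -> (p%:R / (n%:R - 1)) ^+ 2 <= sigma2 n p.
Proof.
move=> pn.
have h : (p + 5)%:R <= n%:R :> R by rewrite ler_nat.
rewrite natrD in h.
have p0 : 0 <= p%:R :> R by [].
have M0 : 0 < n%:R - 1 :> R by lra.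
set x := p%:R / (n%:R - 1).
have x0 : 0 <= x by rewrite divr_ge0// ltW.
have x1 : x < 1 by rewrite ltr_pdivrMr// mul1r; lra.
have w0 : 0 < 1 - x by lra.
have := ln_taylor3_le w0.
have -> : 1 - x - 1 = - x by ring.
have : 0 <= x ^+ 3 by rewrite exprn_ge0.
have -> : (- x) ^+ 3 = - x ^+ 3 by ring.
have -> : (- x) ^+ 2 = x ^+ 2 by ring.
rewrite /sigma2 -/x; lra.
Qed.

Lemma sigma2_ge_ln n p : (p + 5 <= n)%N ->
  2 * ln ((n%:R - 1) / (n%:R - 1 - p%:R)) - 2 <= sigma2 n p.
Proof.
move=> pn.
have h : (p + 5)%:R <= n%:R :> R by rewrite ler_nat.
rewrite natrD in h.
have p0 : 0 <= p%:R :> R by [].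
have M0 : 0 < n%:R - 1 :> R by lra.
have N0 : 0 < n%:R - 1 - p%:R :> R by lra.
rewrite /sigma2.
have -> : 1 - p%:R / (n%:R - 1) = ((n%:R - 1) / (n%:R - 1 - p%:R))^-1 :> R.
  by rewrite invf_div; field; rewrite gt_eqF.
rewrite lnV ?posrE ?divr_gt0//.
have : p%:R / (n%:R - 1) <= 1 :> R by rewrite ler_pdivrMr// mul1r; lra.
lra.
Qed.

End steps.

(** * Gaussian integrals *)

Section normal_integral.
Variable R : realType.
Local Notation leb := (@lebesgue_measure R).

Import HBNNSimple.

Lemma measurable_normal_pdf_EFin (m s : R) :
  measurable_fun setT (fun x => (normal_pdf m s x)%:E : \bar R).
Proof. by apply/measurable_EFinP; exact: measurable_normal_pdf. Qed.

Lemma normal_pdf_EFin_ge0 (m s x : R) : (0 <= (normal_pdf m s x)%:E :> \bar R)%E.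
Proof. by rewrite lee_fin normal_pdf_ge0. Qed.

(** For indicators this is the definition of [normal_prob]; sums and increasing limits of simple
    functions extend it. *)
Lemma ge0_integral_normal (m s : R) (f : R -> \bar R) :
  measurable_fun setT f -> (forall x, 0 <= f x)%E ->
  (\int[normal_prob m s]_x f x = \int[leb]_x (f x * (normal_pdf m s x)%:E))%E.
Proof.
move=> mf f0.
have mpdf := measurable_normal_pdf_EFin m s.
have pdf0 := normal_pdf_EFin_ge0 m s.
pose g x := (normal_pdf m s x)%:E : \bar R.
pose h := nnsfun_approx measurableT mf.
have h_nd x : nondecreasing_seq (fun n => (h n x)%:E : \bar R).
  by move=> a b ab; rewrite lee_fin; exact/lefP/nd_nnsfun_approx.
have mh n : measurable_fun setT (h n).
  first [exact: measurable_funPT | exact: measurable_funP | by []].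
have -> : (\int[normal_prob m s]_x f x =
    lim (\int[normal_prob m s]_x (h n x)%:E @[n --> \oo]))%E.
  have fE x : setT x -> f x = lim ((h n x)%:E @[n --> \oo]).
    by move=> Ex; apply/esym/cvg_lim => //; exact: cvg_nnsfun_approx.
  under eq_integral => x /[!inE] /fE -> //.
  apply: monotone_convergence => //.
  - by move=> n; apply/measurable_EFinP; exact: mh.
  - by move=> n x _; rewrite lee_fin.
have -> : (\int[leb]_x (f x * g x) =
    lim (\int[leb]_x ((h n x)%:E * g x) @[n --> \oo]))%E.
  have fg x : setT x -> (f x * g x = lim (((h n x)%:E * g x) @[n --> \oo]))%E.
    by move=> Ex; apply/esym/cvg_lim => //; apply: cvgeZr => //;
      exact: cvg_nnsfun_approx.
  under eq_integral => x /[!inE] /fg -> //.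
  apply: monotone_convergence => //.
  - move=> n; apply: emeasurable_funM => //.
    by apply/measurable_EFinP; exact: mh.
  - by move=> n x _; apply: mule_ge0; [rewrite lee_fin|exact: pdf0].
  - by move=> x _ a b ab; apply: lee_wpmul2r; [exact: pdf0|exact: (h_nd x a b ab)].
congr (limn _); apply/funext => n.
have mA r : measurable (h n @^-1` [set r]) by [].
have mr r : measurable_fun setT (fun x => r * \1_(h n @^-1` [set r]) x).
  by apply: measurable_funM => //; exact: measurable_indic.
transitivity (\int[normal_prob m s]_x
   (\sum_(y \in range (h n)) (y * \1_(h n @^-1` [set y]) x)%:E))%E.
  by apply: eq_integral => t _; rewrite /= fimfunE -fsumEFin.
rewrite ge0_integral_fsum//; last 2 first.
- by move=> r; apply/measurable_EFinP; exact: mr.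
- by move=> r x _; rewrite nnfun_muleindic_ge0.
transitivity (\int[leb]_x (\sum_(y \in range (h n))
    (y * \1_(h n @^-1` [set y]) x)%:E * g x))%E; last first.
  apply: eq_integral => x _.
  rewrite -ge0_mule_fsuml => [|y]; last exact: nnfun_muleindic_ge0.
  by congr (_ * _)%E; rewrite fsumEFin//; congr EFin; exact: (esym (fimfunE (h n) x)).
rewrite ge0_integral_fsum//; last 2 first.
- move=> r; apply: emeasurable_funM => //.
  by apply/measurable_EFinP; exact: mr.
- by move=> r x _; apply: mule_ge0; [exact: nnfun_muleindic_ge0|exact: pdf0].
apply: eq_fsbigr => r /[!inE] -[y _ yr].
have r0 : 0 <= r by rewrite -yr.
under eq_integral do rewrite EFinM.
have m1 : measurable_fun setT (fun x => (\1_(h n @^-1` [set r]) x)%:E : \bar R).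
  by apply/measurable_EFinP; exact: measurable_indic.
rewrite ge0_integralZl//.
under [RHS]eq_integral do rewrite EFinM -muleA.
rewrite ge0_integralZl//; last 2 first.
- exact: emeasurable_funM.
- by move=> x _; apply: mule_ge0; [rewrite lee_fin|exact: pdf0].
congr (_ * _)%E; rewrite integral_indic//; last exact: mA.
transitivity (normal_prob m s (h n @^-1` [set r])).
  by congr (normal_prob m s _); exact: setIT.
rewrite /normal_prob.
rewrite [LHS]integral_mkcond; congr (integral _ _ _); apply/funext => x.
by rewrite epatch_indic muleC.
Qed.

(** The image of Lebesgue measure under a translation gives intervals their length, so it is
    Lebesgue measure by uniqueness. *)
Lemma ge0_integral_translate (c : R) (f : R -> \bar R) :
  measurable_fun setT f -> (forall x, 0 <= f x)%E ->
  (\int[leb]_x f (x + c)%R = \int[leb]_x f x)%E.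
Proof.
move=> mf f0.
pose T (x : measurableTypeR R) : measurableTypeR R := x + c.
have mT : measurable_fun setT T by exact: measurable_funD.
have := ge0_integral_pushforward mT leb measurableT mf.
rewrite preimage_setT => <-; last by move=> y _.
apply: eq_measure_integral => A mA _; apply/esym/lebesgue_measure_unique => //.
move=> _ [[a b]] _ <-; rewrite /pushforward /=.
rewrite (_ : pushforward leb T _ = leb (`]a - c, b - c]%classic)).
  rewrite !lebesgue_measure_itv/= !lte_fin ltrD2r; case: ifP => // _.
  by rewrite -!EFinD; congr EFin; ring.
rewrite /pushforward; congr (leb _); apply/seteqP; split=> x /=;
by rewrite /T !in_itv/= ltrBlDr lerBrDr.
Qed.

(** Completing the square in [u]. For independent [U ~ N(0, s^2)] and [V ~ N(0, t^2)], the joint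
    density of [(U, U + V)] is the density of the sum times the conditional density of [U] given the
    sum. *)
Lemma normal_pdf_convolution (s t u w : R) : 0 < s -> 0 < t ->
  let r := Num.sqrt (s ^+ 2 + t ^+ 2) in
  normal_pdf 0 t (w - u) * normal_pdf 0 s u =
  normal_pdf 0 r w * normal_pdf (w * s ^+ 2 / r ^+ 2) (s * t / r) u.
Proof.
move=> s0 t0 r.
have st0 : 0 < s ^+ 2 + t ^+ 2 by rewrite addr_gt0// exprn_gt0.
have r0 : 0 < r by rewrite sqrtr_gt0.
have r2 : r ^+ 2 = s ^+ 2 + t ^+ 2 by rewrite sqr_sqrtr// ltW.
have str0 : 0 < s * t / r by rewrite divr_gt0// mulr_gt0.
rewrite /normal_pdf !gt_eqF// mulrACA [RHS]mulrACA; congr (_ * _).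
  have peak (a : R) : 0 < a -> normal_peak a = (a * Num.sqrt (pi *+ 2))^-1.
    move=> a0; rewrite /normal_peak -mulrnAr sqrtrM ?sqr_ge0//.
    by rewrite sqrtr_sqr gtr0_norm.
  have p0 : 0 < Num.sqrt (pi *+ 2) :> R by rewrite sqrtr_gt0 pmulrn_lgt0// pi_gt0.
  by rewrite !peak//; field; rewrite !gt_eqF.
rewrite /normal_fun -!expRD; congr expR; rewrite !subr0.
have -> : (s * t / r) ^+ 2 = s ^+ 2 * t ^+ 2 / r ^+ 2.
  by rewrite expr_div_n exprMn.
rewrite r2; field.
by rewrite !gt_eqF.
Qed.

(** Substitute [w = u + v], exchange the integrals and integrate out [u], whose conditional density
    in [normal_pdf_convolution] has mass 1. *)
Lemma normal_semigroup (s t : R) (f : R -> \bar R) : 0 < s -> 0 < t ->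
  measurable_fun setT f -> (forall x, 0 <= f x)%E ->
  (\int[normal_prob 0 s]_u \int[normal_prob 0 t]_v f (u + v)%R =
   \int[normal_prob 0 (Num.sqrt (s ^+ 2 + t ^+ 2))]_w f w)%E.
Proof.
move=> s0 t0 mf f0.
set r := Num.sqrt _.
have muv : measurable_fun setT (fun z : measurableTypeR R * measurableTypeR R => z.1 + z.2).
  exact: measurable_funD.
have mfuv : measurable_fun setT (fun z : measurableTypeR R * measurableTypeR R => f (z.1 + z.2)).
  exact: (measurableT_comp mf muv).
have mpt : measurable_fun setT (fun z : measurableTypeR R * measurableTypeR R => (normal_pdf 0 t z.2)%:E : \bar R).
  exact: (measurableT_comp (measurable_normal_pdf_EFin 0 t)).
pose G (z : measurableTypeR R * measurableTypeR R) := (f z.2 * (normal_pdf 0 t (z.2 - z.1) * normal_pdf 0 s z.1)%:E)%E.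
have mG : measurable_fun setT G.
  apply: emeasurable_funM; first exact: (measurableT_comp mf).
  apply/measurable_EFinP; apply: measurable_funM.
    apply: (measurableT_comp (measurable_normal_pdf 0 t)).
    exact: measurable_funB.
  exact: (measurableT_comp (measurable_normal_pdf 0 s)).
have G0 z : (0 <= G z)%E by rewrite mule_ge0// lee_fin mulr_ge0// normal_pdf_ge0.
have inner u : (\int[normal_prob 0 t]_v f (u + v)%R =
   \int[leb]_w (f w * (normal_pdf 0 t (w - u))%:E))%E.
  rewrite ge0_integral_normal//; last first.
    by apply: (measurableT_comp mf); exact: measurable_funD.
  rewrite -[RHS](ge0_integral_translate u).
  - by apply: eq_integral => v _; rewrite addrK addrC.
  - apply: emeasurable_funM => //.
    apply: (measurableT_comp (measurable_normal_pdf_EFin 0 t)).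
    exact: measurable_funB.
  - by move=> x; rewrite mule_ge0// normal_pdf_EFin_ge0.
under eq_integral do rewrite inner.
rewrite [LHS]ge0_integral_normal; last 2 first.
- pose H (z : measurableTypeR R * measurableTypeR R) := (f z.2 * (normal_pdf 0 t (z.2 - z.1))%:E)%E.
  have mH : measurable_fun setT H.
    apply: emeasurable_funM; first exact: (measurableT_comp mf).
    apply: (measurableT_comp (measurable_normal_pdf_EFin 0 t)).
    exact: measurable_funB.
  have H0 z : (0 <= H z)%E by rewrite mule_ge0// normal_pdf_EFin_ge0.
  exact: (measurable_fun_fubini_tonelli_F (m2 := leb) H mH H0).
- by move=> u; apply: integral_ge0 => w _; rewrite mule_ge0// normal_pdf_EFin_ge0.
transitivity (\int[leb]_u \int[leb]_w G (u, w))%E.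
  apply: eq_integral => u _; rewrite -ge0_integralZr//.
  - by apply: eq_integral => w _; rewrite /G /= EFinM muleA.
  - apply: emeasurable_funM => //.
    apply: (measurableT_comp (measurable_normal_pdf_EFin 0 t)).
    exact: measurable_funB.
  - by move=> w _; rewrite mule_ge0// normal_pdf_EFin_ge0.
  - exact: normal_pdf_EFin_ge0.
rewrite (fubini_tonelli (m1 := leb) (m2 := leb) G mG G0) [RHS]ge0_integral_normal//.
apply: eq_integral => w _.
under eq_integral do rewrite /G /= normal_pdf_convolution// -/r EFinM muleA.
rewrite ge0_integralZl//.
- by rewrite integral_normal_pdf mule1.
- exact: measurable_normal_pdf_EFin.
- by move=> x _; exact: normal_pdf_EFin_ge0.
- by rewrite mule_ge0// normal_pdf_EFin_ge0.
Qed.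

(** Multiplying the density by [expR (t * u)] shifts its mean to [s ^+ 2 * t], up to the stated
    factor. *)
Lemma normal_mgf (s t : R) : 0 < s ->
  (\int[normal_prob 0 s]_u (expR (t * u))%:E = (expR (s ^+ 2 * t ^+ 2 / 2))%:E)%E.
Proof.
move=> s0.
rewrite ge0_integral_normal; last 2 first.
- apply/measurable_EFinP; apply: (measurableT_comp (@measurable_expR R)).
  exact: measurable_funM.
- by move=> x; rewrite lee_fin expR_ge0.
under eq_integral => u _.
  have -> : ((expR (t * u))%:E * (normal_pdf 0 s u)%:E =
    (expR (s ^+ 2 * t ^+ 2 / 2))%:E * (normal_pdf (s ^+ 2 * t) s u)%:E)%E.
    rewrite -!EFinM; congr EFin.
    rewrite /normal_pdf gt_eqF// mulrCA [RHS]mulrCA; congr (_ * _).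
    rewrite /normal_fun -!expRD; congr expR; rewrite subr0.
    by field; rewrite gt_eqF.
  over.
rewrite ge0_integralZl//.
- by rewrite integral_normal_pdf mule1.
- exact: measurable_normal_pdf_EFin.
- by move=> x _; exact: normal_pdf_EFin_ge0.
Qed.

End normal_integral.

Section gaussian_moments.
Variable R : realType.

Lemma le_of_derive_le (f df : R -> R) (A M : R) :
  (forall x : R, `|x| <= A -> is_derive x 1 f (df x)) -> f 0 = 0 ->
  (forall x, `|x| <= A -> `|df x| <= M) -> forall x, `|x| <= A -> `|f x| <= M * A.
Proof.
move=> fdf f0 dfM x xA.
have A0 : 0 <= A := le_trans (normr_ge0 x) xA.
have M0 : 0 <= M by apply: le_trans (normr_ge0 _) (dfM 0 _); rewrite normr0.
have cont (a b : R) : -A <= a -> b <= A -> {within `[a, b], continuous f}.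
  move=> aA bA; apply: derivable_within_continuous => z.
  rewrite in_itv/= => /andP[az zb].
  have zA : `|z| <= A by rewrite ler_norml (le_trans aA az) (le_trans zb bA).
  by have [] := fdf z zA.
have := xA; rewrite ler_norml => /andP[x1 x2].
have [x0|x0|->] := ltgtP x 0; last by rewrite f0 normr0 mulr_ge0.
- have in01 c : c \in `]x, 0[ -> `|c| <= A.
    rewrite in_itv/= => /andP[xc c0]; rewrite ler_norml.
    by rewrite (le_trans x1 (ltW xc)) (le_trans (ltW c0) A0).
  have [c|c /in01 cA] := @MVT R f df x 0 x0 _ (cont _ _ x1 A0).
    by move=> /in01; exact: fdf.
  rewrite f0 sub0r sub0r => h.
  rewrite -normrN h normrM; apply: ler_pM => //; first exact: dfM.
  by rewrite normrN.
- have in01 c : c \in `]0, x[ -> `|c| <= A.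
    rewrite in_itv/= => /andP[c0 xc]; rewrite ler_norml.
    by rewrite (le_trans (ltW xc) x2) andbT (le_trans _ (ltW c0))// oppr_le0.
  have AN0 : - A <= 0 by rewrite oppr_le0.
  have [c|c /in01 cA] := @MVT R f df 0 x x0 _ (cont _ _ AN0 x2).
    by move=> /in01; exact: fdf.
  rewrite f0 !subr0 => ->; rewrite normrM; apply: ler_pM => //; exact: dfM.
Qed.

(** Each remainder is the derivative of the next one and vanishes at 0, so each of three uses of
    [le_of_derive_le] gains a factor [|x|]. *)
Lemma expR_taylor2 (x : R) :
  `|expR x - 1 - x - x ^+ 2 / 2| <= `|x| ^+ 3 * expR `|x|.
Proof.
set A := `|x|.
have e1 y : `|y| <= A -> `|expR y - 1| <= expR A * A.
  apply: (le_of_derive_le (f := fun y => expR y - 1) (df := expR)).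
  - by move=> z _; apply: is_derive_eq; rewrite subr0.
  - by rewrite expR0 subrr.
  - move=> z zA; rewrite ger0_norm ?expR_ge0// ler_expR.
    exact: le_trans (ler_norm _) zA.
have e2 y : `|y| <= A -> `|expR y - 1 - y| <= expR A * A * A.
  apply: (le_of_derive_le (f := fun y => expR y - 1 - y) (df := fun y => expR y - 1)) => //.
  - by move=> z _; apply: is_derive_eq; rewrite subr0.
  - by rewrite expR0 subrr subr0.
have := le_of_derive_le (f := fun y => expR y - 1 - y - y ^+ 2 / 2)
  (df := fun y => expR y - 1 - y) (A := A) _ _ e2 (lexx A).
have -> : A ^+ 3 * expR A = expR A * A * A * A by ring.
apply.
- by move=> z _; apply: is_derive_eq; rewrite /GRing.scale /=; field.
- by rewrite expR0; field.
Qed.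

Lemma cube_le_expR (x : R) : 0 <= x -> x ^+ 3 <= 6 * expR x.
Proof.
move=> x0; have := expR_ge1Dxn 2 x0; rewrite /= => h.
have : x ^+ 3 / 6 <= expR x by apply: le_trans h; rewrite lerDr.
lra.
Qed.

Lemma expR_norm_le (x : R) : expR `|x| <= expR x + expR (- x).
Proof.
have := expR_gt0 x; have := expR_gt0 (- x).
by have [|] := ger0P x => _; lra.
Qed.

Context d (T : measurableType d) (P : probability T R) (V : T -> R).
Hypothesis mV : measurable_fun setT V.
Hypothesis mgf : forall t, (\int[P]_w (expR (t * V w))%:E = (expR (t ^+ 2 / 2))%:E)%E.

Let mexp t : measurable_fun setT (fun w => expR (t * V w)).
Proof.
by apply: (measurableT_comp (@measurable_expR R)); exact: measurable_funM.
Qed.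

Let iexp t : P.-integrable setT (EFin \o (fun w => expR (t * V w))).
Proof.
apply/integrableP; split; first by apply/measurable_EFinP; exact: mexp.
under eq_integral do rewrite /= ger0_norm ?expR_ge0//.
by rewrite mgf ltry.
Qed.

Let Eexp t : \int[P]_w expR (t * V w) = expR (t ^+ 2 / 2).
Proof. by rewrite /Rintegral mgf. Qed.

(** A dominating function of known expectation: [|V|^3 <= 6 expR |V|], so that [|V|^3 * expR |V|] is
    at most [6 G]. *)
Let G w := expR (2 * V w) + expR (- 2 * V w).

Let iG : P.-integrable setT (EFin \o G).
Proof. by apply: integrableD_EFin. Qed.

Let EG : \int[P]_w G w = 2 * expR 2.
Proof.
rewrite RintegralD// !Eexp.
have -> : (2 : R) ^+ 2 / 2 = 2 by field.
have -> : (- 2 : R) ^+ 2 / 2 = 2 by field.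
ring.
Qed.

Let dom (f : T -> R) c : measurable_fun setT f -> 0 <= c ->
  (forall w, `|f w| <= c * G w) -> P.-integrable setT (EFin \o f).
Proof.
move=> mf c0 fG; apply: (@le_integrable _ _ _ P setT measurableT _
  (EFin \o (fun w => c * G w))).
- by apply/measurable_EFinP.
- by move=> w _ /=; rewrite lee_fin (le_trans (fG w))// ler_norm.
- exact: integrableZl_EFin.
Qed.

Let cube_G w : `|V w| ^+ 3 * expR `|V w| <= 6 * G w.
Proof.
apply: (@le_trans _ _ (6 * expR `|V w| * expR `|V w|)).
  by rewrite ler_wpM2r ?expR_ge0// cube_le_expR.
rewrite -mulrA ler_pM2l// -expRD.
have := expR_norm_le (2 * V w); rewrite normrM ger0_norm// /G.
by rewrite mulNr; have -> : 2 * `|V w| = `|V w| + `|V w| by ring.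
Qed.

Lemma gauss_integrable_abs3 : P.-integrable setT (EFin \o (fun w => `|V w| ^+ 3)).
Proof.
apply: (@dom _ 6) => //.
  by apply: measurable_funX; exact: measurableT_comp.
move=> w; rewrite normrX normr_id; apply: le_trans (cube_G w).
by rewrite ler_peMr ?exprn_ge0// -expR0 ler_expR.
Qed.

Lemma gauss_abs3_le : \int[P]_w (`|V w| ^+ 3) <= 12 * expR 2.
Proof.
have -> : 12 * expR 2 = \int[P]_w (6 * G w) :> R.
  by rewrite RintegralZl// EG; ring.
apply: le_Rintegral => //.
- exact: gauss_integrable_abs3.
- exact: integrableZl_EFin.
- move=> w _; apply: le_trans (cube_G w).
  by rewrite ler_peMr ?exprn_ge0// -expR0 ler_expR.
Qed.

Lemma gauss_integrable1 : P.-integrable setT (EFin \o V).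
Proof.
apply: (@dom _ 7) => // w.
have := cube_G w; have h1 : 1 <= G w.
  rewrite /G; have := expR_ge1Dx (2 * V w); have := expR_ge1Dx (- 2 * V w); lra.
have h2 : `|V w| ^+ 3 <= `|V w| ^+ 3 * expR `|V w|.
  by rewrite ler_peMr ?exprn_ge0// -expR0 ler_expR.
have : 0 <= (`|V w| - 1) ^+ 2 * (`|V w| + 2) by rewrite mulr_ge0 ?sqr_ge0// addr_ge0.
lra.
Qed.

Lemma gauss_integrable2 : P.-integrable setT (EFin \o (fun w => V w ^+ 2)).
Proof.
apply: (@dom _ 7) => // [|w]; first exact: measurable_funX.
rewrite normrX.
have := cube_G w; have h1 : 1 <= G w.
  rewrite /G; have := expR_ge1Dx (2 * V w); have := expR_ge1Dx (- 2 * V w); lra.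
have h2 : `|V w| ^+ 3 <= `|V w| ^+ 3 * expR `|V w|.
  by rewrite ler_peMr ?exprn_ge0// -expR0 ler_expR.
have : 0 <= (`|V w| - 1) ^+ 2 * (`|V w| + 1) by rewrite mulr_ge0 ?sqr_ge0// addr_ge0.
move: `|V w| (normr_ge0 (V w)) h2 => a a0 h2; nra.
Qed.

Let a := \int[P]_w V w.
Let b := \int[P]_w (V w ^+ 2).

(** The moments are read off the moment generating function: [expR (t * V)] is expanded to second
    order under the integral and compared with [expR (t^2 / 2)] for small [t]. *)
Let key t : `|t| <= 1 ->
  `|expR (t ^+ 2 / 2) - 1 - t * a - t ^+ 2 / 2 * b| <= 12 * expR 2 * `|t| ^+ 3.
Proof.
move=> t1.
have i1 := gauss_integrable1; have i2 := gauss_integrable2.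
have ic := integrable_cst_prob P 1.
have j1 := integrableB_EFin (iexp t) ic.
have j2 := integrableB_EFin j1 (integrableZl_EFin t i1).
have j3 := integrableB_EFin j2 (integrableZl_EFin (t ^+ 2 / 2) i2).
have -> : expR (t ^+ 2 / 2) - 1 - t * a - t ^+ 2 / 2 * b =
  \int[P]_w (expR (t * V w) - 1 - t * V w - t ^+ 2 / 2 * V w ^+ 2).
  rewrite RintegralB//; last exact: integrableZl_EFin.
  rewrite RintegralB//; last exact: integrableZl_EFin.
  by rewrite RintegralB// Eexp !RintegralZl// Rintegral_cst_prob.
have -> : 12 * expR 2 * `|t| ^+ 3 = \int[P]_w (6 * `|t| ^+ 3 * G w).
  by rewrite RintegralZl// EG; ring.
apply: le_norm_Rintegral => //; first exact: integrableZl_EFin.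
move=> w.
have -> : expR (t * V w) - 1 - t * V w - t ^+ 2 / 2 * V w ^+ 2 =
  expR (t * V w) - 1 - t * V w - (t * V w) ^+ 2 / 2 by ring.
apply: le_trans (expR_taylor2 _) _.
rewrite normrM exprMn.
have -> : 6 * `|t| ^+ 3 * G w = `|t| ^+ 3 * (6 * G w) by ring.
rewrite -mulrA ler_wpM2l ?exprn_ge0//; apply: le_trans (cube_G w).
rewrite ler_wpM2l ?exprn_ge0// ler_expR ler_piMl//.
Qed.

Let small_eq0 (c K : R) : (forall t, 0 < t <= 1 -> `|c| <= K * t) -> c = 0.
Proof.
move=> h; apply/eqP; rewrite -normr_le0; apply/ler_addgt0Pl => e e0.
rewrite addr0.
have K0 : 0 <= K.
  by have := h 1; rewrite ltr01 lexx mulr1 => /(_ isT); apply: le_trans.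
have K1 : 0 < K + 1 by rewrite ltr_wpDl.
pose t := Num.min 1 (e / (K + 1)).
have t0 : 0 < t by rewrite lt_min ltr01 divr_gt0.
have t1 : t <= 1 by rewrite ge_min lexx.
have te : t * (K + 1) <= e by rewrite -ler_pdivlMr// ge_min lexx orbT.
apply: (le_trans (h t _)); first by rewrite t0.
apply: le_trans te; rewrite mulrC ler_pM2l// lerDl//.
Qed.

Lemma gauss_mean0 : \int[P]_w V w = 0.
Proof.
apply: (@small_eq0 _ (12 * expR 2)) => t /andP[t0 t1].
have nt : `|t| = t by rewrite gtr0_norm.
(* Subtracting the estimates at [t] and [- t] removes the even terms and leaves [2 * t * a]. *)
have := key (t := t); have := key (t := - t); rewrite normrN nt sqrrN.
move=> /(_ t1) h1 /(_ t1) h2; rewrite -/a.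
move: h1 h2; rewrite 2!(ler_norml (_ - _)) => /andP[h1 h2] /andP[h3 h4].
have := expR_gt0 (2 : R) => e2.
have tt : `|a| * t <= 12 * expR 2 * t ^+ 3.
  rewrite -(gtr0_norm t0) -normrM (gtr0_norm t0) ler_norml.
  by apply/andP; split; lra.
have t3 : t ^+ 3 <= t * t.
  by rewrite exprS expr2 ler_wpM2l ?(ltW t0)// ler_piMl// ltW.
rewrite -(ler_pM2r t0); apply: le_trans tt _.
by rewrite -[leRHS]mulrA ler_pM2l// mulr_gt0.
Qed.

Lemma gauss_var1 : \int[P]_w (V w ^+ 2) = 1.
Proof.
apply/eqP; rewrite -subr_eq0; apply/eqP.
apply: (@small_eq0 _ (24 * expR 2 + 4 * expR 1)) => t /andP[t0 t1].
have nt : `|t| = t by rewrite gtr0_norm.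
(* Adding the two estimates removes the odd term. The remaining [expR (t^2 / 2) - 1] is [t^2 / 2] up
   to a multiple of [t^3]. *)
have := key (t := t); have := key (t := - t); rewrite normrN nt sqrrN.
move=> /(_ t1) h1 /(_ t1) h2; rewrite -/b.
have h := expR_taylor2 (t ^+ 2 / 2).
have tt0 : 0 <= t ^+ 2 / 2 by rewrite divr_ge0// sqr_ge0.
rewrite (ger0_norm tt0) in h.
have t2 : t ^+ 2 <= 1 by rewrite expr_le1// ltW.
have e1 : expR (t ^+ 2 / 2) <= expR 1 by rewrite ler_expR; lra.
have E1 := expR_gt0 (1 : R); have E2 := expR_gt0 (2 : R).
have x3 : (t ^+ 2 / 2) ^+ 3 * expR (t ^+ 2 / 2) <= t ^+ 3 * expR 1.
  apply: ler_pM => //; rewrite ?exprn_ge0 ?expR_ge0//.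
  apply: lerXn2r; rewrite ?nnegrE ?(ltW t0)//.
  have : t * t <= t by rewrite ler_piMl// ltW.
  rewrite expr2; lra.
have x2 : (t ^+ 2 / 2) ^+ 2 / 2 <= t ^+ 3.
  have : t ^+ 4 <= t ^+ 3 by rewrite (exprS t 3) ler_piMl ?exprn_ge0 ?(ltW t0).
  have := exprn_gt0 3 t0.
  have -> : (t ^+ 2 / 2) ^+ 2 / 2 = t ^+ 4 / 8 by field.
  lra.
have x2' : 0 <= (t ^+ 2 / 2) ^+ 2 / 2 by rewrite divr_ge0// sqr_ge0.
have E1' : 1 <= expR (1 : R) by rewrite -[leLHS]expR0 ler_expR.
have t3 := exprn_gt0 3 t0.
move: h1 h2 h; rewrite 3!(ler_norml (_ - _ - _)) => /andP[h1 h2] /andP[h3 h4] /andP[h5 h6].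
have tb : `|b - 1| * t ^+ 2 <= (24 * expR 2 + 4 * expR 1) * t ^+ 3.
  have -> : `|b - 1| * t ^+ 2 = `|(b - 1) * t ^+ 2|.
    by rewrite normrM (ger0_norm (sqr_ge0 t)).
  rewrite ler_norml.
  have te : t ^+ 3 <= t ^+ 3 * expR 1 by rewrite ler_peMr// ltW.
  by apply/andP; split; lra.
rewrite -(ler_pM2r (exprn_gt0 2 t0)); apply: le_trans tb _.
by rewrite (exprS t 2) mulrA.
Qed.

End gaussian_moments.

(** * Gaussian smoothing *)

(** [a] and [b] play the roles of the first two derivatives of [f]. An expansion, unlike a
    derivative, passes under the integral without further argument, and it suits the spline used
    later, which is only twice differentiable. *)
Definition taylor3 (R : realType) (f a b : R -> R) (C : R) :=
  [/\ measurable_fun setT f, measurable_fun setT a & measurable_fun setT b] /\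
  [/\ forall x, `|f x| <= C, forall x, `|a x| <= C, forall x, `|b x| <= C &
   forall x l, `|f (x + l) - f x - a x * l - b x / 2 * l ^+ 2| <= C * `|l| ^+ 3].

Lemma taylor_expectation d (T : measurableType d) (R : realType)
  (P : probability T R) (h a b : R -> R) C w (L : T -> R) :
  taylor3 h a b C -> measurable_fun setT L ->
  P.-integrable setT (EFin \o L) ->
  P.-integrable setT (EFin \o (fun t => L t ^+ 2)) ->
  P.-integrable setT (EFin \o (fun t => `|L t| ^+ 3)) ->
  `|\int[P]_t h (w + L t) - h w - a w * \int[P]_t L t -
    b w / 2 * \int[P]_t L t ^+ 2| <= C * \int[P]_t `|L t| ^+ 3.
Proof.
move=> [[mh _ _] [hC _ _ hT]] mL L1 L2 L3.
have hi : P.-integrable setT (EFin \o (fun t => h (w + L t))).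
  apply: (bounded_integrable _ (K := C)) => [|t]; last exact: hC.
  by apply: (measurableT_comp mh); exact: measurable_funD.
have i1 := integrableB_EFin hi (integrable_cst_prob P (h w)).
have i2 := integrableB_EFin i1 (integrableZl_EFin (a w) L1).
have i3 := integrableB_EFin i2 (integrableZl_EFin (b w / 2) L2).
have j1 := integrableZl_EFin (a w) L1.
have j2 := integrableZl_EFin (b w / 2) L2.
rewrite -(RintegralZl _ measurableT L1) -(RintegralZl _ measurableT L2).
rewrite -{1}(Rintegral_cst_prob P (h w)).
rewrite -(RintegralB measurableT hi (integrable_cst_prob P (h w))).
rewrite -(RintegralB measurableT i1 j1) -(RintegralB measurableT i2 j2).
rewrite -(RintegralZl _ measurableT L3).
apply: le_norm_Rintegral => [//||t].
  exact: integrableZl_EFin.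
exact: hT.
Qed.

Section smoothing.
Context (R : realType).
Implicit Types (v w x : R) (f : R -> R).

Local Notation gauss v := (normal_prob 0 (Num.sqrt v)).

(* Convolution with [N(0, v)]; the case [v = 0] is separate because
   [normal_prob 0 0] is not a Dirac mass. *)
Definition smooth v f x := if v == 0 then f x else \int[gauss v]_u f (x + u).

Let shift_integrable v f C x : measurable_fun setT f -> (forall x, `|f x| <= C) ->
  (gauss v).-integrable setT (EFin \o (fun u => f (x + u))).
Proof.
move=> mf fC; apply: (bounded_integrable _ (K := C)) => [|t]; last exact: fC.
by apply: (measurableT_comp mf); exact: measurable_funD.
Qed.

Lemma smooth_bounded v f C x : measurable_fun setT f -> (forall x, `|f x| <= C) ->
  `|smooth v f x| <= C.
Proof.
move=> mf fC; rewrite /smooth; case: ifP => // _.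
apply: norm_Rintegral_le => [|u]; last exact: fC.
by apply: (measurableT_comp mf); exact: measurable_funD.
Qed.

Lemma measurable_smooth v f C : measurable_fun setT f -> (forall x, `|f x| <= C) ->
  measurable_fun setT (smooth v f).
Proof.
move=> mf fC.
rewrite (_ : smooth v f = if v == 0 then f else fun x => \int[gauss v]_u f (x + u)); last first.
  by apply/funext => x; rewrite /smooth; case: ifP.
case: ifP => // _.
(* Adding the bound [C] makes the integrand nonnegative, as the Tonelli theorem requires. *)
pose H (z : measurableTypeR R * measurableTypeR R) := (f (z.1 + z.2) + C)%:E.
have mH : measurable_fun setT H.
  apply/measurable_EFinP; apply: measurable_funD => //.
  apply: (measurableT_comp mf); apply: measurable_funD; [exact: measurable_fst|exact: measurable_snd].
have H0 z : (0 <= H z)%E.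
  by rewrite lee_fin; have := fC (z.1 + z.2); rewrite ler_norml => /andP[? _]; lra.
have mF := measurable_fun_fubini_tonelli_F (m2 := gauss v) H mH H0.
rewrite (_ : (fun x => \int[gauss v]_u f (x + u)) = fun x => fine (fubini_F (gauss v) H x) - C).
  by apply: measurable_funB => //; exact: (measurableT_comp (fine_measurable measurableT) mF).
apply/funext => x; rewrite /fubini_F /H /=.
have fi := shift_integrable v x mf fC.
have := RintegralD measurableT fi (integrable_cst_prob (gauss v) C).
by rewrite Rintegral_cst_prob => h; apply/eqP; rewrite eq_sym subr_eq; apply/eqP.
Qed.

Lemma smooth01 v f : measurable_fun setT f -> (forall x, 0 <= f x <= 1) ->
  forall x, 0 <= smooth v f x <= 1.
Proof.
move=> mf f01 x; rewrite /smooth; case: ifP => // _; apply/andP; split.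
  by apply: Rintegral_ge0 => u _; have /andP[] := f01 (x + u).
have f1 y : `|f y| <= 1 by have /andP[? ?] := f01 y; rewrite ger0_norm.
apply: le_trans (ler_norm _) _; apply: norm_Rintegral_le => [|u]; last exact: f1.
by apply: (measurableT_comp mf); exact: measurable_funD.
Qed.

Lemma smooth_taylor3 v f a b C : taylor3 f a b C ->
  taylor3 (smooth v f) (smooth v a) (smooth v b) C.
Proof.
move=> [[mf ma mb] [fC aC bC fT]]; split.
  by split; [exact: measurable_smooth mf fC|exact: measurable_smooth ma aC|exact: measurable_smooth mb bC].
split=> [x|x|x|x l]; [exact: smooth_bounded|exact: smooth_bounded|exact: smooth_bounded|].
rewrite /smooth; case: ifP => // _.
have fi y := shift_integrable v y mf fC.
have ai := shift_integrable v x ma aC.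
have bi := shift_integrable v x mb bC.
have i1 := integrableB_EFin (fi (x + l)) (fi x).
have j1 := integrableZl_EFin l ai.
have j2 := integrableZl_EFin (l ^+ 2 / 2) bi.
have i2 := integrableB_EFin i1 j1.
rewrite [X in _ - X - _]mulrC -mulrA [2^-1 * _]mulrC [X in _ - X](mulrC _ (l ^+ 2 / 2)).
rewrite -(RintegralZl _ measurableT ai) -(RintegralZl _ measurableT bi).
rewrite -(RintegralB measurableT (fi (x + l)) (fi x)).
rewrite -(RintegralB measurableT i1 j1) -(RintegralB measurableT i2 j2).
apply: norm_Rintegral_le => [|u].
  exact: (integrable_measurable_EFin (integrableB_EFin i2 j2)).
have := fT (x + u) l; rewrite (addrAC x u l).
by congr (`|_| <= _); ring.
Qed.

Lemma smooth_add v w f : 0 <= v -> 0 <= w -> measurable_fun setT f ->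
  (forall x, 0 <= f x <= 1) -> smooth v (smooth w f) = smooth (v + w) f.
Proof.
move=> v0 w0 mf f01; apply/funext => x; rewrite {1 3}/smooth.
have [->|vn0] := eqVneq v 0; first by rewrite add0r.
have vp : 0 < v by rewrite lt_neqAle eq_sym vn0.
have -> : v + w == 0 = false by apply/negbTE; rewrite gt_eqF// ltr_wpDr.
have [->|wn0] := eqVneq w 0; first by rewrite addr0 /smooth eqxx.
have wp : 0 < w by rewrite lt_neqAle eq_sym wn0.
have sv : 0 < Num.sqrt v by rewrite sqrtr_gt0.
have sw : 0 < Num.sqrt w by rewrite sqrtr_gt0.
have mg : measurable_fun setT (fun u => (f (x + u))%:E).
  by apply/measurable_EFinP; apply: (measurableT_comp mf); exact: measurable_funD.
have g0 u : (0 <= (f (x + u))%:E)%E by rewrite lee_fin; have /andP[] := f01 (x + u).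
have := normal_semigroup sv sw mg g0.
rewrite (sqr_sqrtr v0) (sqr_sqrtr w0) => h.
refine (etrans _ (congr1 fine h)); rewrite /Rintegral; apply: (congr1 fine).
apply: eq_integral => u _; rewrite /smooth (negbTE wn0) /Rintegral fineK.
  by apply: eq_integral => t _; rewrite addrA.
have f1 y : `|f y| <= 1 by have /andP[? ?] := f01 y; rewrite ger0_norm.
exact: (integrable_fin_num measurableT (shift_integrable w (x + u) mf f1)).
Qed.

Lemma smooth_approx v f a b C x : 0 <= v -> taylor3 f a b C ->
  `|smooth v f x - f x - b x / 2 * v| <= C * (12 * expR 2 * Num.sqrt v ^+ 3).
Proof.
move=> v0 ft; have C0 : 0 <= C.
  by case: ft => _ [h _ _ _]; exact: le_trans (normr_ge0 _) (h 0).
rewrite /smooth; case: eqVneq => [->|vn0].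
  by rewrite subrr mulr0 subrr normr0 sqrtr0 expr0n /= !mulr0.
have sv : 0 < Num.sqrt v by rewrite sqrtr_gt0 lt_neqAle eq_sym vn0.
set s := Num.sqrt v in sv *.
pose V (u : measurableTypeR R) : R := s^-1 * u.
have mV : measurable_fun setT V by exact: measurable_funM.
have mgf t : (\int[normal_prob 0 s]_u (expR (t * V u))%:E = (expR (t ^+ 2 / 2))%:E)%E.
  under eq_integral do rewrite /V mulrA.
  rewrite (normal_mgf (t * s^-1) sv); congr (expR _)%:E.
  by field; rewrite gt_eqF.
have sV u : u = s * V u by rewrite /V mulrA divff ?mul1r// gt_eqF.
have V1 := gauss_integrable1 mV mgf.
have V2 := gauss_integrable2 mV mgf.
have V3 := gauss_integrable_abs3 mV mgf.
have mid : measurable_fun setT (fun u : measurableTypeR R => u : R) by [].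
have e1 : (fun u : measurableTypeR R => u : R) = (fun u => s * V u).
  exact/funext.
have e2 : (fun u : measurableTypeR R => (u : R) ^+ 2) = (fun u => s ^+ 2 * V u ^+ 2).
  by apply/funext => u; rewrite {1}(sV u) exprMn.
have e3 : (fun u : measurableTypeR R => `|u : R| ^+ 3) = (fun u => s ^+ 3 * `|V u| ^+ 3).
  by apply/funext => u; rewrite {1}(sV u) normrM exprMn (gtr0_norm sv).
have i1 : (normal_prob 0 s).-integrable setT (EFin \o (fun u : measurableTypeR R => u : R)).
  by rewrite e1; exact: integrableZl_EFin.
have i2 : (normal_prob 0 s).-integrable setT (EFin \o (fun u : measurableTypeR R => (u : R) ^+ 2)).
  by rewrite e2; exact: integrableZl_EFin.
have i3 : (normal_prob 0 s).-integrable setT (EFin \o (fun u : measurableTypeR R => `|u : R| ^+ 3)).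
  by rewrite e3; exact: integrableZl_EFin.
have := taylor_expectation x ft mid i1 i2 i3.
rewrite e1 e2 e3 (RintegralZl _ measurableT V1) (RintegralZl _ measurableT V2) (RintegralZl _ measurableT V3).
rewrite (gauss_mean0 mV mgf) (gauss_var1 mV mgf) !mulr0 subr0 mulr1 sqr_sqrtr//.
move=> /le_trans; apply; apply: ler_wpM2l => //.
rewrite [leRHS]mulrC; apply: ler_wpM2l; first by apply: exprn_ge0; exact: ltW.
exact: (gauss_abs3_le mV mgf).
Qed.
End smoothing.

Section log_ratio_step.
Context d (T : measurableType d) (R : realType) (P : probability T R).
Variables (n : nat) (y : T -> n.-tuple R).
Hypotheses (my : measurable_fun setT y) (sy : spherical P y).
Hypothesis y_neq0 : P (y @^-1` [set [tuple of nseq n 0]]) = 0%E.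
Variables (k : nat).
Hypothesis kn : (k + 6 <= n)%N.

Let q : R := n%:R - 1 - k%:R.
Let r := (q * Num.sqrt q)^-1.
Let v : R := sigma2 R n k.+1 - sigma2 R n k.
Let L t := ln (resid_ratio k (y t)) - (mu_n R n k.+1 - mu_n R n k).

Let q5 : 5 <= q. Proof. exact: q_ge5. Qed.

Let q_gt0 : 0 < q. Proof. by have q5' := q5; lra. Qed.

Let sq_gt0 : 0 < Num.sqrt q. Proof. by rewrite sqrtr_gt0. Qed.

Let sqsq : Num.sqrt q * Num.sqrt q = q.
Proof. by rewrite -expr2 sqr_sqrtr// ltW. Qed.

Let qV_le : (q ^+ 2)^-1 <= r.
Proof.
rewrite /r lef_pV2 ?posrE ?mulr_gt0 ?exprn_gt0// expr2.
have := sq_gt0; have := sqsq; have := q5; nra.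
Qed.

(** The abstract estimates applied with the actual increments. The rate [q^-2] is weakened to
    [r = q^(-3/2)], the order of the third moment, which dominates anyway. *)
Lemma log_ratio_moments :
  [/\ P.-integrable setT (EFin \o L), P.-integrable setT (EFin \o (fun t => L t ^+ 2)) &
      P.-integrable setT (EFin \o (fun t => `|L t| ^+ 3))] /\
  [/\ `|\int[P]_t L t| <= 90 * 100 * r, `|\int[P]_t (L t ^+ 2) - v| <= 90 * 100 * r &
      \int[P]_t (`|L t| ^+ 3) <= 60 * 10 * 100 * r].
Proof.
have n4 : (4 <= n)%N by lia.
have mB := @measurable_ratio _ _ _ n y my k.
have B01 t : 0 <= resid_ratio k (y t) <= 1 by exact: ratio01.
have B0 := ratio_gt0 my sy y_neq0 n4 kn.
have iBV := integrable_ratioV my sy y_neq0 n4 kn.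
have EBV := ratioV_le my sy y_neq0 n4 kn.
have EBX j (j4 : (j < 4)%N) := ratioX_rec my sy y_neq0 n4 kn j4.
have mE : q + k%:R = n%:R - 1 by rewrite /q; ring.
have da : `|ln (q / (q + k%:R)) - (mu_n R n k.+1 - mu_n R n k) - k%:R / (q * (q + k%:R))|
    <= 2 * (q ^+ 2)^-1 by rewrite mE; exact: mu_step.
have [va _] := sigma_step R kn.
have va' : `|v - 2 * k%:R / (q * (q + k%:R))| <= 2 * (q ^+ 2)^-1 by rewrite mE.
have k0 : 0 <= k%:R :> R by [].
have [i1 b1] := log_mean_bound mB B01 B0 iBV EBV EBX q5 k0 da.
have [i2 b2] := log_sqr_bound mB B01 B0 iBV EBV EBX q5 k0 da va'.
have [i3 b3] := log_cube_bound mB B01 B0 iBV EBV EBX q5 k0 da va'.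
split; split => //.
- apply: le_trans b1 _; have := qV_le; have : 0 < (q ^+ 2)^-1 by rewrite invr_gt0 exprn_gt0.
  lra.
- apply: le_trans b2 _; apply: ler_wpM2l => //.
Qed.

Let v_gt0 : 0 < v. Proof. by have [] := sigma_step R kn. Qed.

(** Because [v <= 4 / q]: this bounds the third moment of the Gaussian increment. *)
Lemma sqrt_increment_le : Num.sqrt v ^+ 3 <= 8 * r.
Proof.
have [va _] := sigma_step R kn.
rewrite -/q -/v in va.
have k0 : 0 <= k%:R :> R by [].
have kM : k%:R <= n%:R - 1 :> R by have := q5; rewrite /q; lra.
have M0 : 0 < n%:R - 1 :> R by have := q5; rewrite /q; lra.
have v4 : v <= 4 / q.
  have : v <= 2 * k%:R / (q * (n%:R - 1)) + 2 * (q ^+ 2)^-1.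
    by move: va; rewrite ler_norml => /andP[_]; lra.
  have : 2 * k%:R / (q * (n%:R - 1)) <= 2 / q.
    rewrite ler_pdivrMr ?mulr_gt0// mulrA divfK ?gt_eqF//; lra.
  have : 2 * (q ^+ 2)^-1 <= 2 / q.
    rewrite ler_wpM2l// lef_pV2 ?posrE ?exprn_gt0// expr2.
    by have := q5; nra.
  by rewrite !(mulrC _ q^-1); lra.
have -> : 8 * r = (2 / Num.sqrt q) ^+ 3.
  by rewrite /r -{1}sqsq; field; rewrite gt_eqF.
have s0 : 0 <= 2 / Num.sqrt q by rewrite divr_ge0// ltW.
apply: lerXn2r; rewrite ?nnegrE ?sqrtr_ge0//.
rewrite -(ger0_norm s0) -sqrtr_sqr ler_wsqrtr//.
rewrite expr_div_n sqr_sqrtr ?(ltW q_gt0)// (_ : 2 ^+ 2 = 4 :> R)//.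
by rewrite -natrX.
Qed.

(** One replacement. Both expectations are expanded around [w]; their difference keeps the mean of
    [L], the defect [E L^2 - v] and the two third moments, all of order [r]. The constant 96 is
    [12 * 8], from the Gaussian third moment and [sqrt_increment_le]. *)
Lemma smooth_log_step (g a b : R -> R) C s w : taylor3 g a b C -> 0 < s ->
  `|\int[P]_t g (w + s * L t) - smooth (s ^+ 2 * v) g w| <=
  C * (60 * 10 * 100 + 96 * expR 2) * (s + s ^+ 2 + s ^+ 3) * r.
Proof.
move=> gt s0.
have [[i1 i2 i3] [b1 b2 b3]] := log_ratio_moments.
have [_ [gC aC bC _]] := gt.
have C0 : 0 <= C := le_trans (normr_ge0 _) (gC 0).
have j1 : P.-integrable setT (EFin \o (fun t => s * L t)) by exact: integrableZl_EFin.
have e2 : (fun t => (s * L t) ^+ 2) = (fun t => s ^+ 2 * L t ^+ 2).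
  by apply/funext => t; rewrite exprMn.
have e3 : (fun t => `|s * L t| ^+ 3) = (fun t => s ^+ 3 * `|L t| ^+ 3).
  by apply/funext => t; rewrite normrM exprMn (gtr0_norm s0).
have j2 : P.-integrable setT (EFin \o (fun t => (s * L t) ^+ 2)).
  by rewrite e2; exact: integrableZl_EFin.
have j3 : P.-integrable setT (EFin \o (fun t => `|s * L t| ^+ 3)).
  by rewrite e3; exact: integrableZl_EFin.
have := taylor_expectation w gt (integrable_measurable_EFin j1) j1 j2 j3.
rewrite e2 e3 (RintegralZl _ measurableT i1) (RintegralZl _ measurableT i2) (RintegralZl _ measurableT i3).
have t0 : 0 <= s ^+ 2 * v by rewrite mulr_ge0// ?sqr_ge0// ltW.
have := smooth_approx w t0 gt.
have -> : Num.sqrt (s ^+ 2 * v) = s * Num.sqrt v.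
  by rewrite sqrtrM ?sqr_ge0// sqrtr_sqr gtr0_norm.
rewrite exprMn.
have := sqrt_increment_le; have := aC w; have := bC w.
set V := Num.sqrt v ^+ 3; set A := \int[P]_t g (w + s * L t); set S := smooth _ _ _.
set E1 := (\int[P]_t L t) in b1 *; set E2 := (\int[P]_t L t ^+ 2) in b2 *.
set E3 := (\int[P]_t `|L t| ^+ 3) in b3 *; set G := g w.
set a' := a w; set b' := b w; set e := expR 2.
move=> b'C a'C V8 hS hA.
have r0 : 0 < r by rewrite invr_gt0 mulr_gt0.
have e0 : 0 < e by exact: expR_gt0.
have s2 : 0 < s ^+ 2 by rewrite exprn_gt0.
have s3 : 0 < s ^+ 3 by rewrite exprn_gt0.
have -> : A - S = (A - G - a' * (s * E1) - b' / 2 * (s ^+ 2 * E2)) -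
   (S - G - b' / 2 * (s ^+ 2 * v)) + a' * (s * E1) + b' / 2 * (s ^+ 2 * (E2 - v)).
  by ring.
have h1 : `|a' * (s * E1)| <= C * (s * (90 * 100 * r)).
  rewrite normrM normrM (gtr0_norm s0); apply: ler_pM => //.
    by rewrite mulr_ge0// ltW.
  by rewrite ler_pM2l.
have h2 : `|b' / 2 * (s ^+ 2 * (E2 - v))| <= C * (s ^+ 2 * (90 * 100 * r)).
  rewrite normrM (normrM (s ^+ 2)) (gtr0_norm s2); apply: ler_pM => //.
  - by rewrite mulr_ge0// ltW.
  - by rewrite normrM (ger0_norm (_ : 0 <= 2^-1))//; have := normr_ge0 b'; lra.
  - by rewrite ler_pM2l.
have h3 : C * (s ^+ 3 * E3) <= C * (s ^+ 3 * (60 * 10 * 100 * r)).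
  by rewrite ler_wpM2l// ler_pM2l.
have h4 : C * (12 * e * (s ^+ 3 * V)) <= C * (12 * e * (s ^+ 3 * (8 * r))).
  by rewrite ler_wpM2l// ler_pM2l ?mulr_gt0// ler_pM2l.
apply: le_trans (ler_normD _ _) _; apply: le_trans (lerD (ler_normD _ _) (lexx _)) _.
apply: le_trans (lerD (lerD (ler_normB _ _) (lexx _)) (lexx _)) _.
have p1 : 0 <= C * (s * r) by rewrite mulr_ge0// mulr_ge0// ltW.
have p2 : 0 <= C * (s ^+ 2 * r) by rewrite mulr_ge0// mulr_ge0// ltW.
have p3 : 0 <= C * e * (s * r) by rewrite mulr_ge0// mulr_ge0// ltW.
have p4 : 0 <= C * e * (s ^+ 2 * r) by rewrite mulr_ge0// mulr_ge0// ltW.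
rewrite [leRHS](_ : _ = 60 * 10 * 100 * (C * (s * r)) + 60 * 10 * 100 * (C * (s ^+ 2 * r)) +
  C * (s ^+ 3 * (60 * 10 * 100 * r)) + 96 * (C * e * (s * r)) + 96 * (C * e * (s ^+ 2 * r))
  + C * (12 * e * (s ^+ 3 * (8 * r)))); last by ring.
have h1' : `|a' * (s * E1)| <= 90 * 100 * (C * (s * r)) by rewrite (le_trans h1)// le_eqVlt; apply/orP; left; apply/eqP; ring.
have h2' : `|b' / 2 * (s ^+ 2 * (E2 - v))| <= 90 * 100 * (C * (s ^+ 2 * r)) by rewrite (le_trans h2)// le_eqVlt; apply/orP; left; apply/eqP; ring.
lra.
Qed.
End log_ratio_step.

(** * Independence *)

Section past_independent.
Context d d' (T : measurableType d) (S : measurableType d') (R : realType).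
Variables (P : probability T R) (Y : nat -> T -> S) (k : nat).
Hypothesis mY : forall i, measurable_fun setT (Y i).
Hypothesis indY : forall A : nat -> set S, (forall i, measurable (A i)) ->
  P (\bigcap_(i in `I_k.+1) Y i @^-1` A i) =
  (\prod_(i < k.+1) P (Y i @^-1` A i))%E.

Definition past t : k.-tuple S := [tuple Y i t | i < k].

Lemma measurable_past : measurable_fun setT past.
Proof.
apply/measurable_fun_tnthP => i.
by rewrite (_ : _ \o _ = Y i)//; apply/funext => t /=; rewrite tnth_mktuple.
Qed.

Let measurable_preimage i (F : set S) : measurable F -> measurable (Y i @^-1` F).
Proof. by move=> mF; rewrite -[_ @^-1` _]setTI; exact: mY. Qed.

Let box (A : nat -> set S) :=
  [set x : k.-tuple S | forall i : 'I_k, A i (tnth x i)].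

Let past_box A F : (forall i, measurable (A i)) -> measurable F ->
  P (past @^-1` box A `&` Y k @^-1` F) =
  ((\prod_(i < k) P (Y i @^-1` A i)) * P (Y k @^-1` F))%E.
Proof.
move=> mA mF; pose A' i := if (i < k)%N then A i else F.
have mA' i : measurable (A' i) by rewrite /A'; case: ifP.
have := indY mA'; rewrite big_ord_recr/= {3}/A' ltnn.
under [in RHS]eq_bigr do rewrite /A' ltn_ord.
move=> <-; congr (P _); apply/seteqP; split => t /=.
  case=> bA Yk i /=; rewrite ltnS leq_eqVlt => /orP[/eqP->|ik].
    by rewrite /A' ltnn.
  by rewrite /A' ik; have := bA (Ordinal ik); rewrite tnth_mktuple.
move=> h; split => [i|].
  by rewrite tnth_mktuple; have := h i (ltnW (ltn_ord i)); rewrite /A' /= ltn_ord.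
by have := h k (ltnSn k); rewrite /A' /= ltnn.
Qed.

Let measurable_box A : (forall i, measurable (A i)) -> measurable (box A).
Proof.
move=> mA; rewrite (_ : box A =
    \bigcap_(i in [set: 'I_k]) ((fun x : k.-tuple S => tnth x i) @^-1` A i)).
  apply: fin_bigcap_measurable => [|i _]; first exact: finite_finset.
  by rewrite -[_ @^-1` _]setTI; exact: measurable_tnth.
by apply/seteqP; split => x h i => [_|]; exact: h.
Qed.

(** The sigma-algebra on tuples is generated by preimages under single coordinates, which are boxes
    with at most one nontrivial side. *)
Let generated_by_boxes E : measurable E ->
  <<s [set B | exists2 A, (forall i, measurable (A i)) & B = box A] >> E.
Proof.
apply: smallest_sub => [|]; first exact: smallest_sigma_algebra.
apply: (@big_ind _ (fun X => X `<=` _)) => [//|A B sA sB X [|]|i _ _ [B mB <-]].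
- exact: sA.
- exact: sB.
- apply: sub_sigma_algebra.
exists (fun j : nat => if j == i :> nat then B else setT) => [j|]; first by case: ifP.
rewrite setTI; apply/seteqP; split => x /= => [Bx j|/(_ i)]; last by rewrite eqxx; apply.
by case: eqP => [/val_inj ->|].
Qed.

(** For fixed [F], both sides are finite measures in [E] that agree on boxes, a generating family
    stable under intersection. *)
Lemma past_independent E F : measurable E -> measurable F ->
  P (past @^-1` E `&` Y k @^-1` F) = (P (past @^-1` E) * P (Y k @^-1` F))%E.
Proof.
move=> mE mF.
have mF' := measurable_preimage k mF.
pose G := [set B | exists2 A, (forall i, measurable (A i)) & B = box A].
pose c : {nonneg R} := NngNum (fine_ge0 (measure_ge0 P (Y k @^-1` F))).
have cE : (c%:num%:E = P (Y k @^-1` F))%E.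
  by rewrite /= fineK//; exact: fin_num_measure.
have [m1 m1E] : exists m1 : {measure set (k.-tuple S) -> \bar R},
    forall A, m1 A = P (past @^-1` A `&` Y k @^-1` F).
  by eexists (measure_function_pushforward__canonical__measure_function_Measure (mrestr P mF') measurable_past).
have [m2 m2E] : exists m2 : {measure set (k.-tuple S) -> \bar R},
    forall A, m2 A = (P (past @^-1` A) * P (Y k @^-1` F))%E.
  exists (mscale c (measure_function_pushforward__canonical__measure_function_Measure P measurable_past)) => A.
  by rewrite -cE muleC.
rewrite -m1E -m2E.
apply: (g_sigma_algebra_measure_unique _ _ (fun=> setT) _ _ m1 m2 _ _ _ E (generated_by_boxes mE)).
- by move=> _ [A mA ->]; exact: measurable_box.
- by move=> _; exists (fun=> setT) => //; apply/seteqP; split.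
- by apply/seteqP; split => // x _; exists 0.
- move=> _ _ [A mA ->] [B mB ->]; exists (fun i => A i `&` B i) => [i|].
    exact: measurableI.
  by apply/seteqP; split => x /= => [[hA hB] i|h]; split => // i; case: (h i).
- move=> _ [A mA ->]; rewrite m1E m2E past_box//; congr (_ * _)%E.
  have := past_box mA measurableT.
  by rewrite preimage_setT setIT probability_setT mule1.
- move=> _; rewrite m1E (le_lt_trans (probability_le1 _ _)) ?ltry//.
  by apply: measurableI => //; rewrite preimage_setT.
Qed.
End past_independent.

(** The law of the pair is the product of the two laws by uniqueness on rectangles; then Tonelli. *)
Lemma ge0_integral_independent d d1 d2 (T : measurableType d)
  (S1 : measurableType d1) (S2 : measurableType d2) (R : realType)
  (P : probability T R) (f : T -> S1) (g : T -> S2) (H : S1 * S2 -> \bar R) :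
  measurable_fun setT f -> measurable_fun setT g -> measurable_fun setT H ->
  (forall x, 0 <= H x)%E ->
  (forall A B, measurable A -> measurable B ->
    P (f @^-1` A `&` g @^-1` B) = P (f @^-1` A) * P (g @^-1` B))%E ->
  (\int[P]_t H (f t, g t) = \int[P]_t \int[P]_s H (f t, g s))%E.
Proof.
move=> mf mg mH H0 indep.
pose F : {mfun T >-> S1} := HB.pack f (isMeasurableFun.Build _ _ _ _ f mf).
pose G : {mfun T >-> S2} := HB.pack g (isMeasurableFun.Build _ _ _ _ g mg).
have mfg : measurable_fun setT (fun t => (f t, g t)) by exact: measurable_fun_pair.
pose FG : {mfun T >-> (S1 * S2)%type} := HB.pack (fun t => (f t, g t))
  (isMeasurableFun.Build _ _ _ _ (fun t => (f t, g t)) mfg).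
rewrite -[LHS](@ge0_integral_distribution _ _ _ _ _ P FG)//.
transitivity (\int[(distribution P F \x distribution P G)%E]_z H z)%E.
  apply: eq_measure_integral => A mA _.
  by apply/esym/product_measure_unique => // B C mB mC; exact: indep.
rewrite fubini_tonelli1// ge0_integral_distribution//=.
- apply: eq_integral => t _.
  rewrite /fubini_F ge0_integral_distribution//.
  by apply: measurableT_comp.
- exact: measurable_fun_fubini_tonelli_F.
- by move=> x; apply: integral_ge0.
Qed.

Section det_corr_step.
Context d (T : measurableType d) (R : realType) (P : probability T R).
Variables (n k : nat) (Y : nat -> T -> n.-tuple R).
Hypothesis mY : forall i, measurable_fun setT (Y i).
Hypothesis indY : forall A : nat -> set (n.-tuple R),
  (forall i, measurable (A i)) ->
  P (\bigcap_(i in `I_k.+1) Y i @^-1` A i) =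
  (\prod_(i < k.+1) P (Y i @^-1` A i))%E.
Hypothesis sphY : spherical P (Y k).
Hypothesis kn : (k < n)%N.

Definition det_corr l t := \det (corr_mx (fun i : 'I_l => Y i t)).

Lemma measurable_det_corr_nat l : measurable_fun setT (det_corr l).
Proof. by apply: (@measurable_det_corr _ _ _ _ _ (fun i => Y i)) => i. Qed.

(** Independence comes first and separates the past, at [t], from the new column, at [s]. With [t]
    frozen, the matrix given by [det_corr_recr] is a constant and sphericity removes it inside the
    inner integral. Its dependence on [t], hence its measurability, is never at stake. *)
Lemma ge0_integral_det_corrS (g : R -> \bar R) : measurable_fun setT g ->
  (forall x, 0 <= g x)%E ->
  (\int[P]_t g (det_corr k.+1 t) =
   \int[P]_t \int[P]_s g (det_corr k t * resid_ratio k (Y k s))%R)%E.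
Proof.
move=> mg g0.
pose D (z : k.-tuple (n.-tuple R) * n.-tuple R) :=
  \det (corr_mx (fun i : 'I_k.+1 => if (i < k)%N then nth [tuple of nseq n 0] z.1 i else z.2)).
have mD : measurable_fun setT D.
  apply: (@measurable_det_corr _ _ _ _ _ (fun i (z : k.-tuple (n.-tuple R) * n.-tuple R) => if (i < k)%N then nth [tuple of nseq n 0] z.1 i else z.2)) => i.
  case: (ltnP i k) => ik; last exact: measurable_snd.
  rewrite (_ : (fun _ => _) = (fun x : k.-tuple (n.-tuple R) => tnth x (Ordinal ik)) \o fst).
    exact: (measurableT_comp (measurable_tnth _) measurable_fst).
  by apply/funext => z /=; rewrite (tnth_nth [tuple of nseq n 0]).
have DE t s : D (past Y k t, s) =
    \det (corr_mx (fun i : 'I_k.+1 => if (i < k)%N then Y i t else s)).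
  congr (\det (corr_mx _)); apply/funext => i /=.
  case: ifP => // ik; have := tnth_nth [tuple of nseq n 0] (past Y k t) (Ordinal ik).
  by rewrite tnth_mktuple.
transitivity (\int[P]_t g (D (past Y k t, Y k t)))%E.
  apply: eq_integral => t _; congr (g _); rewrite DE.
  congr (\det (corr_mx _)); apply/funext => i /=; case: ifP => //.
  by have := ltn_ord i; rewrite ltnS leq_eqVlt => /orP[/eqP-> //|->].
have /= -> := @ge0_integral_independent _ _ _ _ _ _ _ P _ (Y k) (g \o D)
   (measurable_past mY) (mY k) (measurableT_comp mg mD) (fun=> g0 _)
   (past_independent mY indY).
apply: eq_integral => t _.
have [/= O Oo rec] := det_corr_recr (Y ^~ t) kn.
under eq_integral do rewrite DE rec.
apply: (@eq_law_integral _ _ _ _ _ P (fun s => mx_act O (Y k s)) (Y k)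
  (fun z => g (det_corr k t * resid_ratio k z))) => //.
- exact: (measurableT_comp (measurable_mx_act O) (mY k)).
- apply: (measurableT_comp mg); apply: measurable_funM => //.
  exact: measurable_resid_ratio.
- exact: sphY.
Qed.
End det_corr_step.

Section det_corr_compare.
Context d (T : measurableType d) (R : realType) (P : probability T R).
Variables (n k : nat) (Y : nat -> T -> n.-tuple R).
Hypothesis mY : forall i, measurable_fun setT (Y i).
Hypothesis indY : forall A : nat -> set (n.-tuple R),
  (forall i, measurable (A i)) ->
  P (\bigcap_(i in `I_k.+1) Y i @^-1` A i) =
  (\prod_(i < k.+1) P (Y i @^-1` A i))%E.
Hypothesis sphY : spherical P (Y k).
Hypothesis kn : (k < n)%N.

Let B s := resid_ratio k (Y k s).

Let mB : measurable_fun setT B.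
Proof. exact: (measurableT_comp (measurable_resid_ratio _) (mY k)). Qed.

Let measurable_inner (g : R -> \bar R) : measurable_fun setT g ->
  (forall x, 0 <= g x)%E ->
  measurable_fun setT (fun t => \int[P]_s g (det_corr Y k t * B s)%R)%E.
Proof.
move=> mg g0; pose H (z : R * T) := g (z.1 * B z.2).
have mH : measurable_fun setT H.
  apply: (measurableT_comp mg); apply: measurable_funM => //.
  exact: (measurableT_comp mB measurable_snd).
have mF := measurable_fun_fubini_tonelli_F (m2 := P) H mH (fun=> g0 _).
exact: (measurableT_comp mF (measurable_det_corr_nat mY k)).
Qed.

(** The integral formula applied to the indicator of []-oo, 0]]: the product of two positive factors
    is almost never there, so the expectation is 0. *)
Lemma det_corrS_gt0 :
  {ae P, forall t, 0 < det_corr Y k t} -> {ae P, forall s, 0 < B s} ->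
  {ae P, forall t, 0 < det_corr Y k.+1 t}.
Proof.
move=> D0 B0.
pose g (x : R) : \bar R := (\1_(`]-oo, 0]%classic) x)%:E.
have mg : measurable_fun setT g by apply/measurable_EFinP; exact: measurable_indic.
have g0 x : (0 <= g x)%E by rewrite lee_fin.
have gpos x : 0 < x -> g x = 0%E.
  by move=> x0; rewrite /g indicE memNset//= in_itv/= leNgt x0.
have mD := measurable_det_corr_nat mY k.+1.
have := ge0_integral_det_corrS mY indY sphY kn mg g0.
rewrite [X in _ = X](ae_eq_integral (cst 0%E)) ?integral0//; first last.
- apply: filterS D0 => t Dt _.
  rewrite (ae_eq_integral (cst 0%E)) ?integral0//.
    apply: (measurableT_comp mg); apply: measurable_funM => //.
  by apply: filterS B0 => s Bs _; rewrite gpos// mulr_gt0.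
- exact: measurable_inner.
move=> I0.
have : (\int[P]_t `|g (det_corr Y k.+1 t)| = 0)%E.
  by rewrite -[RHS]I0; apply: eq_integral => t _; rewrite gee0_abs.
move/ae_eq_integral_abs => /(_ measurableT (measurableT_comp mg mD)).
apply: filterS => t /(_ I); rewrite /g/= => /eqP; rewrite eqe indicE pnatr_eq0 eqb0.
by rewrite notin_setE /= in_itv /= => /negP; rewrite -ltNge.
Qed.

Lemma expectation_det_corrS (g h : R -> R) e :
  measurable_fun setT g -> measurable_fun setT h ->
  (forall x, 0 <= g x <= 1) -> (forall x, 0 <= h x <= 1) ->
  {ae P, forall t, 0 < det_corr Y k t} ->
  (forall x, 0 < x -> `|\int[P]_s g (x * B s) - h x| <= e) ->
  `|\int[P]_t g (det_corr Y k.+1 t) - \int[P]_t h (det_corr Y k t)| <= e.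
Proof.
move=> mg mh g01 h01 D0 gh.
have mD l := measurable_det_corr_nat mY l.
have gi x : P.-integrable setT (EFin \o (fun s => g (x * B s))).
  apply: (@bounded_integrable _ _ _ _ _ 1) => [|s].
    by apply: (measurableT_comp mg); exact: measurable_funM.
  by have /andP[? ?] := g01 (x * B s); rewrite ger0_norm.
pose F t := \int[P]_s g (det_corr Y k t * B s).
have FE t : ((F t)%:E = \int[P]_s (g (det_corr Y k t * B s)%R)%:E)%E.
  by rewrite fineK//; exact: (integrable_fin_num measurableT (gi _)).
have mF : measurable_fun setT F.
  apply/measurable_EFinP.
  rewrite (_ : _ \o _ = fun t => \int[P]_s (g (det_corr Y k t * B s)%R)%:E)%E.
    apply: (@measurable_inner (EFin \o g)).
      exact/measurable_EFinP.
    by move=> x; rewrite lee_fin; have /andP[] := g01 x.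
  exact/funext.
have F01 t : `|F t| <= 1.
  apply: norm_Rintegral_le => [|s].
    by apply: (measurableT_comp mg); exact: measurable_funM.
  by have /andP[? ?] := g01 (det_corr Y k t * B s); rewrite ger0_norm.
have -> : \int[P]_t g (det_corr Y k.+1 t) = \int[P]_t F t.
  congr fine.
  have mg' : measurable_fun setT (EFin \o g) by exact/measurable_EFinP.
  have := ge0_integral_det_corrS mY indY sphY kn mg'.
  move=> /= -> => [|x]; last by rewrite lee_fin; have /andP[] := g01 x.
  by apply: eq_integral => t _; rewrite -FE.
have Fi : P.-integrable setT (EFin \o F) by exact: bounded_integrable F01.
have hi : P.-integrable setT (EFin \o (fun t => h (det_corr Y k t))).
  apply: (@bounded_integrable _ _ _ _ _ 1) => [|s].
    by apply: (measurableT_comp mh).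
  by have /andP[? ?] := h01 (det_corr Y k s); rewrite ger0_norm.
rewrite -RintegralB//.
rewrite -[leRHS](Rintegral_cst_prob P).
apply: ae_le_norm_Rintegral => //.
- exact: integrableB_EFin.
- exact: integrable_cst_prob.
- by apply: filterS D0 => t; exact: gh.
Qed.
End det_corr_compare.

(** Indexing the columns by [nat] lets the determinants of all leading submatrices be written with
    one family. *)
Definition extend_seq (U : Type) (u0 : U) p (X : 'I_p -> U) (i : nat) : U :=
  if insub i is Some j then X j else u0.

Lemma extend_seqE (U : Type) (u0 : U) p (X : 'I_p -> U) (j : 'I_p) :
  extend_seq u0 X j = X j.
Proof. by rewrite /extend_seq valK. Qed.

Lemma independent_extend d (T : measurableType d) (R : realType)
  (P : probability T R) n p (X : 'I_p -> T -> n.-tuple R) y0 k :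
  (k < p)%N -> independent_vectors P X ->
  forall A : nat -> set (n.-tuple R), (forall i, measurable (A i)) ->
  P (\bigcap_(i in `I_k.+1) extend_seq y0 X i @^-1` A i) =
  (\prod_(i < k.+1) P (extend_seq y0 X i @^-1` A i))%E.
Proof.
move=> kp indX A mA; pose J := [set i : 'I_p | (i < k.+1)%N]%SET.
have := indX J (fun i => A i) (fun i => mA i).
have -> : (\prod_(i < k.+1) P (extend_seq y0 X i @^-1` A i))%E =
    (\prod_(i in J) P (X i @^-1` A i))%E.
  rewrite (big_ord_widen _ (fun i => P (extend_seq y0 X i @^-1` A i)) kp).
  by apply: eq_big => [i|i _]; rewrite ?inE// extend_seqE.
move=> <-; congr (P _); apply/seteqP; split => t h i /=.
  rewrite inE => ik; have := h i ik; rewrite /= extend_seqE//.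
move=> ik; have ip : (i < p)%N by exact: leq_trans ik kp.
have := h (Ordinal ip); rewrite /= inE => /(_ ik).
by rewrite -(extend_seqE y0 X).
Qed.

(** * The Lindeberg sum *)

Lemma measurable_affine d (T : measurableType d) (R : realType) (a b c : R)
  (f : T -> R) : measurable_fun setT f ->
  measurable_fun setT (fun t => a + b * (f t - c)).
Proof.
by move=> mf; apply: measurable_funD => //; apply: measurable_funM => //;
  exact: measurable_funB.
Qed.

Section det_corr_bound.
Context d (T : measurableType d) (R : realType) (P : probability T R).
Variables (n p : nat) (Y : nat -> T -> n.-tuple R).
Hypothesis mY : forall i, measurable_fun setT (Y i).
Hypothesis indY : forall k, (k < p)%N -> forall A : nat -> set (n.-tuple R),
  (forall i, measurable (A i)) ->
  P (\bigcap_(i in `I_k.+1) Y i @^-1` A i) =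
  (\prod_(i < k.+1) P (Y i @^-1` A i))%E.
Hypothesis sphY : forall k, (k < p)%N -> spherical P (Y k).
Hypothesis Y_neq0 : forall k, (k < p)%N ->
  P (Y k @^-1` [set [tuple of nseq n 0]]) = 0%E.
Hypotheses (p_gt0 : (0 < p)%N) (pn : (p + 5 <= n)%N).

Let kn6 k : (k < p)%N -> (k + 6 <= n)%N. Proof. lia. Qed.

Lemma det_corr_gt0 k : (k <= p)%N -> {ae P, forall t, 0 < det_corr Y k t}.
Proof.
elim: k => [_|k IH kp].
  by apply: aeW => t; rewrite /det_corr det_mx00.
have k6 := kn6 kp.
apply: det_corrS_gt0 => //.
- exact: indY.
- exact: sphY.
- lia.
- exact: (IH (ltnW kp)).
- apply: (@ratio_gt0 _ _ _ _ n) => //; [exact: sphY|exact: Y_neq0|lia].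
Qed.

Let V k : R := sigma2 R n k.

Let V_lt k : (k < p)%N -> V k < V k.+1.
Proof. by move=> /kn6 k6; have [_] := sigma_step R k6; rewrite subr_gt0. Qed.

Let V_le k l : (k <= l)%N -> (l <= p)%N -> V k <= V l.
Proof.
move=> kl; elim: l kl => [|l IH]; first by rewrite leqn0 => /eqP ->.
rewrite leq_eqVlt => /orP[/eqP->//|kl lp].
by apply: le_trans (ltW (V_lt lp)); apply: IH => //; exact: ltnW.
Qed.

Let V0 : V 0 = 0. Proof. by rewrite /V /sigma2 mul0r subr0 ln1 addr0 mulr0. Qed.

Lemma sigma2_gt0 : 0 < V p.
Proof. by rewrite -V0; apply: lt_le_trans (V_lt p_gt0) _; exact: V_le. Qed.

Let s : R := (sigma_n R n p)^-1.

Let s_gt0 : 0 < s.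
Proof. by rewrite invr_gt0 sqrtr_gt0; exact: sigma2_gt0. Qed.

Let s2E : s ^+ 2 = (V p)^-1.
Proof. by rewrite exprVn sqr_sqrtr//; exact: ltW sigma2_gt0. Qed.

Let r k : R := ((n%:R - 1 - k%:R) * Num.sqrt (n%:R - 1 - k%:R))^-1.

(** [E k] is the expectation of [f] at the normalized logarithm for [k] columns plus an independent
    Gaussian carrying the missing variance [1 - s ^+ 2 * V k]. It runs from the Gaussian value [E 0]
    to the wanted expectation [E p], and each difference is one replacement. *)
Lemma det_corr_smooth_bound (f a b : R -> R) C : taylor3 f a b C ->
  (forall x, 0 <= f x <= 1) ->
  `|\int[P]_t f ((ln (det_corr Y p t) - mu_n R n p) / sigma_n R n p) - smooth 1 f 0|
  <= C * (60 * 10 * 100 + 96 * expR 2) * (s + s ^+ 2 + s ^+ 3) *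
     (2 / Num.sqrt (n%:R - 1 - p%:R)).
Proof.
move=> ft f01.
have [[mf _ _] [fC _ _ _]] := ft.
have C0 : 0 <= C := le_trans (normr_ge0 _) (fC 0).
pose u k := smooth (1 - s ^+ 2 * V k) f.
pose h k x := u k ((ln x - mu_n R n k) / sigma_n R n p).
pose E k := \int[P]_t h k (det_corr Y k t).
set K := C * _ * _.
have K0 : 0 <= K.
  rewrite /K mulr_ge0//; last by rewrite !addr_ge0// ?exprn_ge0// ltW.
  by rewrite mulr_ge0// addr_ge0// mulr_ge0// expR_ge0.
have mh k : measurable_fun setT (h k).
  apply: (measurableT_comp (measurable_smooth (1 - s ^+ 2 * V k) mf fC)).
  by apply: measurable_funM => //; apply: measurable_funB => //; exact: measurable_ln.
have h01 k x : 0 <= h k x <= 1 by exact: smooth01.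
have step k : (k < p)%N -> `|E k.+1 - E k| <= K * r k.
  move=> kp; have k6 := kn6 kp.
  have kn : (k < n)%N by lia.
  apply: (expectation_det_corrS mY (indY kp) (sphY kp) kn (mh k.+1) (mh k) (h01 k.+1) (h01 k)).
    by apply: det_corr_gt0; exact: ltnW.
  move=> x x0.
  have ut := smooth_taylor3 (1 - s ^+ 2 * V k.+1) ft.
  set w := (ln x - mu_n R n k) / sigma_n R n p.
  have t0 : 0 <= s ^+ 2 * (sigma2 R n k.+1 - sigma2 R n k).
    by rewrite mulr_ge0 ?sqr_ge0// subr_ge0 ltW//; exact: V_lt.
  have t1 : 0 <= 1 - s ^+ 2 * V k.+1.
    rewrite subr_ge0 s2E mulrC ler_pdivrMr ?sigma2_gt0// mul1r.
    by apply: V_le => //; exact: leqnn.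
  (* The semigroup property: [u k] is [u k.+1] convolved with the Gaussian increment of column [k],
     the very term that [smooth_log_step] compares with the logarithm of the ratio. *)
  have uE := smooth_add t0 t1 mf f01.
  rewrite (_ : _ + (1 - s ^+ 2 * V k.+1) = 1 - s ^+ 2 * V k) in uE; last first.
    by rewrite /V; ring.
  have := smooth_log_step (mY k) (sphY kp) (Y_neq0 kp) k6 w ut s_gt0.
  rewrite uE => bnd.
  have mB : measurable_fun setT (fun t => resid_ratio k (Y k t)).
    exact: (measurableT_comp (measurable_resid_ratio k) (mY k)).
  suff -> : \int[P]_t h k.+1 (x * resid_ratio k (Y k t)) =
      \int[P]_t smooth (1 - s ^+ 2 * V k.+1) f (w + s *
        (ln (resid_ratio k (Y k t)) - (mu_n R n k.+1 - mu_n R n k))) by exact: bnd.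
  (* Only almost everywhere: the logarithm of the product splits where the ratio is positive. *)
  apply: ae_eq_Rintegral.
  - by apply: (measurableT_comp (mh k.+1)); exact: measurable_funM.
  - have mln := measurableT_comp (@measurable_ln R) mB.
    exact: (measurableT_comp (measurable_smooth (1 - s ^+ 2 * V k.+1) mf fC)
      (measurable_affine w s _ mln)).
  - have n4 : (4 <= n)%N by lia.
    have := ratio_gt0 (mY k) (sphY kp) (Y_neq0 kp) n4 k6.
    apply: filterS => t B0.
    have lnE := lnM (x := x) (y := resid_ratio k (Y k t)) x0 B0.
    have wE : (ln (x * resid_ratio k (Y k t)) - mu_n R n k.+1) / sigma_n R n p =
        w + s * (ln (resid_ratio k (Y k t)) - (mu_n R n k.+1 - mu_n R n k)).
      by rewrite lnE /w /s; ring.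
    exact: (congr1 (u k.+1) wE).
(* With no column, the determinant is 1 and both [mu_n] and the variance vanish. *)
have E0 : E 0 = smooth 1 f 0.
  have b0 : 1 - s ^+ 2 * V 0 = 1 by rewrite V0 mulr0 subr0.
  have hE t : h 0 (det_corr Y 0 t) = smooth 1 f 0.
    have -> : h 0 (det_corr Y 0 t) = u 0 0; last by rewrite /u b0.
    apply: (congr1 (u 0)); rewrite /det_corr det_mx00 ln1.
    by rewrite /mu_n mul0r subr0 ln1 !mulr0 subr0 subr0 mul0r.
  exact: etrans (congr1 (fun F : T -> R => \int[P]_t F t) (funext hE)) (Rintegral_cst_prob P _).
have Ep : E p = \int[P]_t f ((ln (det_corr Y p t) - mu_n R n p) / sigma_n R n p).
  have b1 : 1 - s ^+ 2 * V p = 0 by rewrite s2E mulVf ?subrr// gt_eqF// sigma2_gt0.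
  have uE : u p = f by rewrite /u b1; apply/funext => x; rewrite /smooth eqxx.
  by rewrite /E /h uE.
rewrite -Ep.
rewrite -E0 -(telescope_sumr E (leq0n p)) big_mkord.
apply: le_trans (ler_norm_sum _ _ _) _.
apply: (@le_trans _ _ (\sum_(k < p) K * r k)); first by apply: ler_sum => k _; exact: step.
by rewrite -mulr_sumr ler_wpM2l//; exact: sum_terms_le.
Qed.
End det_corr_bound.

(** * From smooth test functions to distribution functions *)

Section spline.
Context (R : realType).
Implicit Types u l x : R.

Let pos u : R := Num.max u 0.

Let posP u : (u <= 0 /\ pos u = 0) \/ (0 <= u /\ pos u = u).
Proof. by rewrite /pos; case: (leP u 0) => h; [left|right]; split=> //; exact: ltW. Qed.

(** The second derivative of the cube of the positive part is [6 * pos], which is 6-Lipschitz; hence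
    a remainder of at most [|l| ^+ 3]. The cases are the signs of [u] and [u + l]. *)
Let pos_cube_taylor u l :
  `|pos (u + l) ^+ 3 - pos u ^+ 3 - 3 * pos u ^+ 2 * l - 3 * pos u * l ^+ 2|
  <= `|l| ^+ 3.
Proof.
have [[h1 ->]|[h1 ->]] := posP u; have [[h2 ->]|[h2 ->]] := posP (u + l).
- by rewrite !expr0n/= !mulr0 !mul0r !subr0 normr0 exprn_ge0.
- have l0 : 0 <= l by lra.
  rewrite !expr0n/= !mulr0 !mul0r !subr0 normrX (ger0_norm h2) (ger0_norm l0).
  by apply: lerXn2r; rewrite ?nnegrE//; lra.
- have l0 : l <= 0 by lra.
  rewrite (ler0_norm l0) [X in `|X|](_ : _ = l ^+ 3 - (u + l) ^+ 3); last by ring.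
  have a0 : 0 <= (- (u + l)) ^+ 3 by rewrite exprn_ge0//; lra.
  have a1 : (- (u + l)) ^+ 3 <= (- l) ^+ 3 by apply: lerXn2r; rewrite ?nnegrE; lra.
  have o1 : (- (u + l)) ^+ 3 = - (u + l) ^+ 3 by ring.
  have o2 : (- l) ^+ 3 = - l ^+ 3 by ring.
  by rewrite ler_norml; lra.
- rewrite [X in `|X|](_ : _ = l ^+ 3); last by ring.
  by rewrite normrX.
Qed.

Let m j u := pos (u - j%:R).

(* The survival function of the sum of three independent uniform variables on
   [0, 1]. *)
Definition spline u := 1 - (m 0 u ^+ 3 - 3 * m 1 u ^+ 3 + 3 * m 2 u ^+ 3 - m 3 u ^+ 3) / 6.
Let dspline u := - (m 0 u ^+ 2 - 3 * m 1 u ^+ 2 + 3 * m 2 u ^+ 2 - m 3 u ^+ 2) / 2.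
Let ddspline u := - (m 0 u - 3 * m 1 u + 3 * m 2 u - m 3 u).

Let bounds u : [/\ 0 <= spline u <= 1, `|dspline u| <= 10 & `|ddspline u| <= 10].
Proof.
rewrite /spline /dspline /ddspline /m subr0.
have e1 : 1%:R = 1 :> R by [].
have e2 : 2%:R = 2 :> R by [].
have e3 : 3%:R = 3 :> R by [].
rewrite e1.
have [[h0 ->]|[h0 ->]] := posP u; have [[h1 ->]|[h1 ->]] := posP (u - 1);
  have [[h2 ->]|[h2 ->]] := posP (u - 2);
  have [[h3 ->]|[h3 ->]] := posP (u - 3); rewrite ?expr0n /= ?ler_norml; try by exfalso; lra.
- by split; lra.
- split; [| |lra].
  + have : u ^+ 3 <= 1 by apply: exprn_ile1 => //; lra.
    have : 0 <= u ^+ 3 by rewrite exprn_ge0.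
    lra.
  + have : u ^+ 2 <= 1 by apply: exprn_ile1 => //; lra.
    have : 0 <= u ^+ 2 by rewrite exprn_ge0.
    lra.
- have [b c] : 0 <= (u - 1) <= 1 /\ 0 <= (2 - u) <= 1 by lra.
  split; [| |lra].
  + have d1 : 0 <= (2 - u) ^+ 3 by rewrite exprn_ge0//; lra.
    nra.
  + nra.
- have [b c] : 0 <= (u - 2) <= 1 /\ 0 <= (3 - u) <= 1 by lra.
  split; [| |lra].
  + rewrite (_ : 1 - _ = (3 - u) ^+ 3 / 6); last by field.
    have : 0 <= (3 - u) ^+ 3 by rewrite exprn_ge0//; lra.
    have : (3 - u) ^+ 3 <= 1 by apply: exprn_ile1; lra.
    lra.
  + nra.
- by split; [rewrite (_ : 1 - _ = 0); [lra|field]|rewrite (_ : - _ / 2 = 0); [lra|field]|lra].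
Qed.

Lemma spline01 u : 0 <= spline u <= 1. Proof. by case: (bounds u). Qed.

Let m_eq0 j u : u <= 0 -> m j u = 0.
Proof.
move=> u0; rewrite /m; have [[_ ->]//|[h ->]] := posP (u - j%:R).
by have : 0 <= j%:R :> R by []; lra.
Qed.

Lemma spline1 u : u <= 0 -> spline u = 1.
Proof. by move=> u0; rewrite /spline !m_eq0// !expr0n/= !mulr0 !subrr addr0 subrr mul0r subr0. Qed.

Lemma spline0 u : 3 <= u -> spline u = 0.
Proof.
move=> u3; rewrite /spline.
have mE j : (j < 4)%N -> m j u = u - j%:R.
  move=> j4; rewrite /m; have [[h ->]|[_ ->]//] := posP (u - j%:R).
  have : j%:R <= 3 :> R by rewrite (ler_nat _ j 3).
  lra.
by rewrite !mE//; field.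
Qed.

(** The four truncated cubes have weights 1, 3, 3, 1 over 6, so the remainder is at most [8 / 6]
    times [|l| ^+ 3]; 10 is a common bound that also covers the two derivatives. *)
Lemma spline_taylor3 : taylor3 spline dspline ddspline 10.
Proof.
have mm j : measurable_fun setT (m j).
  by apply: measurable_maxr => //; exact: measurable_funB.
have mp j k : measurable_fun setT (fun u => m j u ^+ k) by exact: measurable_funX.
split; split.
- by apply: measurable_funB => //; apply: measurable_funM => //; apply: measurable_funB => //;
   apply: measurable_funD => //; [apply: measurable_funB => //|]; exact: measurable_funM.
- by apply: measurable_funM => //; apply: measurableT_comp => //; apply: measurable_funB => //;
   apply: measurable_funD => //; [apply: measurable_funB => //|]; exact: measurable_funM.
- by apply: measurableT_comp => //; apply: measurable_funB => //;
   apply: measurable_funD => //; [apply: measurable_funB => //|]; exact: measurable_funM.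
- by move=> u; have /andP[? ?] := spline01 u; rewrite ger0_norm//; lra.
- by move=> u; have [] := bounds u.
- by move=> u; have [] := bounds u.
move=> u l.
have T j : `|m j (u + l) ^+ 3 - m j u ^+ 3 - 3 * m j u ^+ 2 * l - 3 * m j u * l ^+ 2| <= `|l| ^+ 3.
  by rewrite /m (addrAC u l); exact: pos_cube_taylor.
have := T 0; have := T 1; have := T 2; have := T 3.
rewrite !ler_norml /spline /dspline /ddspline; lra.
Qed.
End spline.

(** The chain rule produces the factors 1, [e], [e^2] and [e^3], all dominated by [(1 + e)^3]. *)
Lemma taylor3_scale (R : realType) (f a b : R -> R) (C x e : R) : 0 < e -> taylor3 f a b C ->
  exists a' b' C', taylor3 (fun u : R => f (e * (u - x))) a' b' C'.
Proof.
move=> e0 [[mf ma mb] [fC aC bC fT]].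
have C0 : 0 <= C := le_trans (normr_ge0 _) (fC 0).
have C1 (k : nat) (z : R) : `|z| <= C -> (k < 4)%N -> e ^+ k * `|z| <= C * (1 + e) ^+ 3.
  move=> zC k4; rewrite mulrC; apply: ler_pM => //; first by rewrite exprn_ge0// ltW.
  have e1 : 1 <= 1 + e by lra.
  apply: (@le_trans _ _ ((1 + e) ^+ k)).
    by apply: lerXn2r; rewrite ?nnegrE; lra.
  by apply: ler_weXn2l.
exists (fun u : R => e * a (e * (u - x))), (fun u : R => e ^+ 2 * b (e * (u - x))), (C * (1 + e) ^+ 3).
have mg : measurable_fun setT (fun u : R => e * (u - x)).
  by apply: measurable_funM => //; exact: measurable_funB.
split; split.
- exact: (measurableT_comp mf mg).
- by apply: measurable_funM => //; exact: (measurableT_comp ma mg).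
- by apply: measurable_funM => //; exact: (measurableT_comp mb mg).
- by move=> u; have := C1 0 _ (fC (e * (u - x))) isT; rewrite expr0 mul1r.
- by move=> u; rewrite normrM gtr0_norm//; exact: (C1 1 _ (aC _)).
- by move=> u; rewrite normrM gtr0_norm ?exprn_gt0//; exact: (C1 2 _ (bC _)).
move=> u l.
have := fT (e * (u - x)) (e * l).
rewrite -mulrDr (addrAC u _ l) normrM exprMn (gtr0_norm e0) => h.
rewrite (_ : _ * l = a (e * (u - x)) * (e * l)); last by ring.
rewrite (_ : _ / 2 * l ^+ 2 = b (e * (u - x)) / 2 * (e ^+ 2 * l ^+ 2)); last by ring.
apply: le_trans h _; rewrite exprMn mulrA ler_wpM2r ?exprn_ge0//.
by rewrite mulrC; have := C1 3%N C; rewrite ger0_norm//; apply.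
Qed.

(** [f] lies between the indicators of []-oo, x]] and []-oo, x']]. *)
Lemma cdf_sandwich d (T : measurableType d) (R : realType) (P : probability T R)
  (Z : T -> R) (f : R -> R) x x' :
  measurable_fun setT Z -> measurable_fun setT f -> (forall u, 0 <= f u <= 1) ->
  (forall u, u <= x -> f u = 1) -> (forall u, x' < u -> f u = 0) ->
  fine (P [set t | Z t <= x]) <= \int[P]_t f (Z t) <= fine (P [set t | Z t <= x']).
Proof.
move=> mZ mf f01 f1 f0.
pose A c := [set t | Z t <= c].
have mA c : measurable (A c).
  rewrite (_ : A c = Z @^-1` `]-oo, c]%classic).
    by rewrite -[_ @^-1` _]setTI; exact: mZ.
  by apply/seteqP; split => t; rewrite /A /= in_itv.
have indE c : fine (P (A c)) = \int[P]_t \1_(A c) t.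
  by rewrite /Rintegral integral_indic// setIT.
have indi c : P.-integrable setT (EFin \o (\1_(A c) : T -> R)).
  apply: (bounded_integrable _ (K := 1)) => [|t]; first exact: measurable_indic.
  by rewrite indicE normr_nat; case: (_ \in _).
have fi : P.-integrable setT (EFin \o (fun t => f (Z t))).
  apply: (bounded_integrable _ (K := 1)) => [|t]; first exact: (measurableT_comp mf mZ).
  by have /andP[? ?] := f01 (Z t); rewrite ger0_norm.
rewrite -!/(A _) !indE; apply/andP; split; apply: le_Rintegral => // t _;
    rewrite indicE; have /andP[h0 h1] := f01 (Z t).
  case: (boolP (t \in A x)) => // /set_mem ?.
  by rewrite f1.
case: (boolP (t \in A x')) => // /negP tA.
by rewrite f0// ltNge; apply/negP => h; apply: tA; rewrite inE.
Qed.

Lemma std_normal_cdf_fin_num (R : realType) (x : R) :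
  std_normal_cdf x \is a fin_num.
Proof.
have fin (A : set (measurableTypeR R)) : measurable A -> normal_prob 0 1 A \is a fin_num.
  by move=> mA; exact: fin_num_measure.
rewrite /std_normal_cdf.
exact: fin.
Qed.

(** The standard normal density is at most 1. *)
Lemma std_normal_cdf_lipschitz (R : realType) (x e : R) : 0 <= e ->
  fine (std_normal_cdf (x + e)) <= fine (std_normal_cdf x) + e.
Proof.
move=> e0; have := std_normal_cdf_fin_num x; have := std_normal_cdf_fin_num (x + e).
rewrite /std_normal_cdf => fin' fin.
have pdf1 u : normal_pdf 0 1 u <= 1 :> R.
  apply: le_trans (normal_pdf_ub _ _ _) _; first exact: oner_neq0.
  rewrite /normal_peak invf_le1; last first.
    by rewrite sqrtr_gt0 expr1n mul1r pmulrn_rgt0// pi_gt0.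
  rewrite -{1}sqrtr1 ler_wsqrtr// expr1n mul1r.
  by have := pi_ge2 R; rewrite mulr2n; lra.
have small : (normal_prob 0 1 `]x, (x + e)%R] <= e%:E)%E.
  rewrite /normal_prob.
  apply: (@le_trans _ _ (\int[lebesgue_measure]_(u in `]x, (x + e)%R]) 1%:E)%E).
    apply: ge0_le_integral => //.
    - by move=> u _; rewrite lee_fin normal_pdf_ge0.
    - by apply/measurable_EFinP; apply: measurable_funTS; exact: measurable_normal_pdf.
    - by move=> u _; rewrite lee_fin.
  have itvE := lebesgue_measure_itv `]x, (x + e)%R].
  rewrite integral_cst// mul1e; move: itvE => /= itvE; apply: (@le_trans _ _ (if (x%:E < (x + e)%:E)%E then (x + e)%:E - x%:E else 0)%E).
    by rewrite -itvE.
  by case: ifP => _; rewrite lee_fin; lra.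
have U : `]-oo, (x + e)%R]%classic = `]-oo, x]%classic `|` `]x, (x + e)%R]%classic :> set R.
  by apply/seteqP; split => u; rewrite /= !in_itv/=; [case: (leP u x) => h; [left|right]|case=> [|/andP[]//]; lra].
have finle (u v : \bar R) c : u \is a fin_num -> v \is a fin_num ->
    (u <= v + c%:E)%E -> fine u <= fine v + c.
  by move: u v => [u| |] [v| |].
apply: (finle _ _ _ fin' fin).
have UE : normal_prob 0 1 `]-oo, (x + e)%R] =
    normal_prob 0 1 (`]-oo, x]%classic `|` `]x, (x + e)%R]%classic).
  exact: (congr1 (normal_prob 0 1) U).
rewrite UE; apply: le_trans (measureU2 _ _ _) _ => //.
by rewrite leeD2l.
Qed.

Lemma sigma2_ge (R : realType) n p (y : R) : (p + 5 <= n)%N -> 0 < y ->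
  y <= p%:R / n%:R -> y ^+ 2 <= sigma2 R n p.
Proof.
move=> pn y0 yn.
have h : (p + 5)%:R <= n%:R :> R by rewrite ler_nat.
rewrite natrD in h.
have p0 : 0 <= p%:R :> R by [].
have n0 : 0 < n%:R :> R by lra.
have M0 : 0 < n%:R - 1 :> R by lra.
have yM : y <= p%:R / (n%:R - 1).
  by apply: le_trans yn _; rewrite ler_wpM2l// lef_pV2 ?posrE//; lra.
have d0 := le_trans (ltW y0) yM.
by apply: le_trans (sigma2_ge_sqr R pn); apply: lerXn2r yM; rewrite nnegrE//; exact: ltW.
Qed.

(** Let [N = n - 1 - p]. If [N >= K = a / y^2], the bound [sigma2 >= y^2] suffices. Otherwise [N] is
    bounded, so [(n - 1) / N] exceeds [expR (a / 2 + 1)] for large [n], and the logarithmic bound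
    gives [sigma2 >= a] while [N >= 1]. *)
Lemma sigma2_mul_infty (R : realType) (p : nat -> nat) (y : R) :
  0 < y -> (\forall n \near \oo, (p n + 5 <= n)%N) ->
  (\forall n \near \oo, y <= (p n)%:R / n%:R) ->
  forall a, \forall n \near \oo, a <= sigma2 R n (p n) * (n%:R - 1 - (p n)%:R).
Proof.
move=> y0 pn py a0; pose a := Num.max a0 1.
have ag0 : 0 < a by rewrite lt_max ltr01 orbT.
pose K := a / y ^+ 2.
have K0 : 0 < K by rewrite divr_gt0// exprn_gt0.
near=> n; apply: (@le_trans _ _ a); first by rewrite le_max lexx.
have pn5 : (p n + 5 <= n)%N by near: n.
have h : (p n + 5)%:R <= n%:R :> R by rewrite ler_nat.
rewrite natrD in h.
have p0 : 0 <= (p n)%:R :> R by [].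
have n0 : 0 < n%:R :> R by lra.
have yn : y <= (p n)%:R / n%:R by near: n.
set M : R := n%:R - 1; set N := M - _.
have M0 : 0 < M by rewrite /M; lra.
have N1 : 1 <= N by rewrite /N /M; lra.
have s2 := sigma2_ge_ln R pn5; rewrite -/M -/N in s2.
have y2 : y ^+ 2 <= sigma2 R n (p n) by exact: sigma2_ge.
case: (leP K N) => KN.
  apply: (@le_trans _ _ (y ^+ 2 * K)); first by rewrite /K mulrC divfK// expf_neq0// gt_eqF.
  by apply: ler_pM => //; rewrite ?sqr_ge0// ltW.
have big : K * expR (a / 2 + 1) <= M.
  by rewrite /M lerBrDr; near: n; exact: nbhs_infty_ger.
have lnb : a / 2 + 1 <= ln (M / N).
  rewrite -[leLHS]expRK ler_ln ?posrE ?expR_gt0 ?divr_gt0//; last by lra.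
  rewrite ler_pdivlMr; last by lra.
  apply: le_trans big; rewrite mulrC ler_wpM2r// ?expR_ge0// ltW//.
have sa : a <= sigma2 R n (p n) by lra.
by apply: (le_trans sa); rewrite ler_peMr//; lra.
Unshelve. all: by end_near.
Qed.

Lemma smooth1_sandwich (R : realType) (f : R -> R) (x x' : R) :
  measurable_fun setT f -> (forall u, 0 <= f u <= 1) ->
  (forall u, u <= x -> f u = 1) -> (forall u, x' < u -> f u = 0) ->
  fine (std_normal_cdf x) <= smooth 1 f 0 <= fine (std_normal_cdf x').
Proof.
move=> mf f01 f1 f0.
have cdfE c : std_normal_cdf c = normal_prob 0 1 [set u : measurableTypeR R | (u : R) <= c].
  apply: (congr1 (normal_prob 0 1)).
  by apply/seteqP; split => u; rewrite /= in_itv.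
have -> : smooth 1 f 0 = \int[normal_prob 0 1]_u f u.
  rewrite /smooth oner_eq0 sqrtr1.
  by have -> : (fun u : R => f (0 + u)) = f by apply/funext => u; rewrite add0r.
rewrite !cdfE.
exact: (cdf_sandwich (normal_prob 0 1) (Z := fun u : measurableTypeR R => u : R)).
Qed.

Theorem theorem6 (R : realType) (p : nat -> nat) (y : R)
  (hy : 0 < y <= 1)
  (hnp : \forall n \near \oo, (p n + 5 <= n)%N)
  (hlim : (p n)%:R / n%:R @[n --> \oo] --> y)
  (d : measure_display) (T : nat -> measurableType d)
  (P : forall n, probability (T n) R)
  (X : forall n, 'I_(p n) -> T n -> n.-tuple R)
  (hmeas : forall n i, measurable_fun setT (X n i))
  (hindep : forall n, independent_vectors (P n) (X n))
  (hsph : forall n i, spherical (P n) (X n i))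
  (hnz : forall n i, P n (X n i @^-1` [set [tuple of nseq n 0]]) = 0%E) :
  cvg_dist_std_normal P
    (fun n t => (ln (\det (corr_mx (fun i => X n i t))) - mu_n R n (p n))
                / sigma_n R n (p n)).
Proof.
set Z := fun n t => _.
have /andP[y0 _] := hy.
(* Any [c] below the limit is eventually below [p / n], so that [sigma_n >= c] for large [n]. *)
have [c c0 cy] : exists2 c, 0 < c & c < y by exists (y / 2); lra.
have hc : \forall n \near \oo, c <= (p n)%:R / n%:R.
  by exact: (cvgr_ge _ hlim).
have mZ n : measurable_fun setT (Z n).
  apply: measurable_funM => //; apply: measurable_funB => //.
  by apply: (measurableT_comp (@measurable_ln R)); exact: measurable_det_corr.
have smooth_cvg (f a b : R -> R) C e : taylor3 f a b C ->
    (forall x, 0 <= f x <= 1) -> 0 < e ->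
    \forall n \near \oo, `|\int[P n]_t f (Z n t) - smooth 1 f 0| <= e.
  move=> ft f01 e0.
  have C0 : 0 <= C by case: ft => _ [h _ _ _]; exact: le_trans (normr_ge0 _) (h 0).
  pose K := C * (60 * 10 * 100 + 96 * expR 2).
  have K0 : 0 <= K by rewrite mulr_ge0// addr_ge0// mulr_ge0// expR_ge0.
  (* As [s = 1 / sigma_n] is at most [1 / c], the factor [s + s^2 + s^3] is at most
     [s * (1 + c^-1 + c^-2)]. The error is then at most [G / (sigma_n * sqrt N)], and
     [sigma2_mul_infty] makes the denominator at least [(G + 1) / e]. *)
  pose G := K * (1 + c^-1 + c^-1 ^+ 2) * 2.
  have cV0 : 0 < c^-1 by rewrite invr_gt0.
  have G0 : 0 <= G by rewrite mulr_ge0// mulr_ge0// !addr_ge0// ?exprn_ge0// ltW.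
  have big := sigma2_mul_infty c0 hnp hc (((G + 1) / e) ^+ 2).
  near=> n.
  have pn : (p n + 5 <= n)%N by near: n.
  have cn : c <= (p n)%:R / n%:R by near: n.
  have bn : ((G + 1) / e) ^+ 2 <= sigma2 R n (p n) * (n%:R - 1 - (p n)%:R) by near: n.
  have p0 : (0 < p n)%N.
    by rewrite lt0n; apply/eqP => pE; move: cn; rewrite pE mul0r leNgt c0.
  pose Y := extend_seq (fun=> [tuple of nseq n 0]) (X n).
  have YE k (kp : (k < p n)%N) : Y k = X n (Ordinal kp).
    by rewrite /Y -(extend_seqE (fun=> [tuple of nseq n 0])).
  have mY i : measurable_fun setT (Y i).
    by rewrite /Y /extend_seq; case: insubP => [j _ _|_]; [exact: hmeas|exact: measurable_cst].
  have indY k (kp : (k < p n)%N) := independent_extend (fun=> [tuple of nseq n 0]) kp (hindep n).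
  have sphY k (kp : (k < p n)%N) : spherical (P n) (Y k) by rewrite (YE _ kp).
  have nzY k (kp : (k < p n)%N) : P n (Y k @^-1` [set [tuple of nseq n 0]]) = 0%E.
    by rewrite (YE _ kp).
  have bnd := det_corr_smooth_bound mY indY sphY nzY p0 pn ft f01.
  have ZE : (fun t => f (Z n t)) =
      fun t => f ((ln (det_corr Y (p n) t) - mu_n R n (p n)) / sigma_n R n (p n)).
    apply/funext => t; rewrite /Z /det_corr.
    have -> // : (fun i => X n i t) = (fun i : 'I_(p n) => Y i t).
    by apply/funext => i; rewrite /Y extend_seqE.
  rewrite ZE; apply: (le_trans bnd).
  have s2 := sigma2_ge pn c0 cn.
  have sg0 : 0 < sigma2 R n (p n) := lt_le_trans (exprn_gt0 2 c0) s2.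
  have sgc : c <= sigma_n R n (p n).
    by rewrite -[leLHS](ger0_norm (ltW c0)) -sqrtr_sqr ler_wsqrtr.
  set s := (sigma_n R n (p n))^-1; set N := n%:R - 1 - (p n)%:R in bn *.
  have sg0' : 0 < sigma_n R n (p n) := lt_le_trans c0 sgc.
  have s0 : 0 < s by rewrite invr_gt0.
  have sc : s <= c^-1 by rewrite lef_pV2 ?posrE.
  have g0 : 0 < (G + 1) / e by rewrite divr_gt0// ltr_wpDl.
  have root : (G + 1) / e <= sigma_n R n (p n) * Num.sqrt N.
    by rewrite -(sqrtrM _ (ltW sg0)) -[leLHS](ger0_norm (ltW g0)) -sqrtr_sqr ler_wsqrtr.
  have sN0 : 0 < sigma_n R n (p n) * Num.sqrt N := lt_le_trans g0 root.
  have le1 : s + s ^+ 2 + s ^+ 3 <= s * (1 + c^-1 + c^-1 ^+ 2).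
    have ss : s * s <= c^-1 ^+ 2 by rewrite expr2 ler_pM// ltW.
    rewrite (_ : _ + s ^+ 3 = s * (1 + s + s * s)); last by ring.
    by rewrite ler_wpM2l//; [exact: ltW|lra].
  rewrite -/K.
  have sq0 : 0 <= 2 / Num.sqrt N by rewrite divr_ge0.
  apply: (@le_trans _ _ (K * (s * (1 + c^-1 + c^-1 ^+ 2)) * (2 / Num.sqrt N))).
    by rewrite ler_wpM2r// ler_wpM2l.
  rewrite (_ : _ * (2 / _) = G / (sigma_n R n (p n) * Num.sqrt N)); last first.
    by rewrite invfM -/s /G; ring.
  rewrite ler_pdivrMr//; move: root; rewrite ler_pdivrMr//; lra.
move=> x.
have cdf_fin n x' : P n [set t | Z n t <= x'] \is a fin_num.
  apply: fin_num_measure.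
  rewrite (_ : [set t | Z n t <= x'] = Z n @^-1` `]-oo, x']%classic).
    by rewrite -[_ @^-1` _]setTI; exact: mZ.
  by apply/seteqP; split => t; rewrite /= in_itv.
rewrite -(fineK (std_normal_cdf_fin_num x)); apply/fine_cvgP; split.
  by near=> n; exact: cdf_fin.
apply/cvgrPdist_le => e e0.
(* The scaled spline falls from 1 to 0 over a length [3 * w = e / 2], which bounds the change of the
   normal distribution function; the other [e / 2] is for the test functions. *)
pose w := e / 6; have w0 : 0 < w by rewrite divr_gt0.
have wV0 : 0 < w^-1 by rewrite invr_gt0.
pose f z u : R := spline (w^-1 * (u - z)).
have f01 z u : 0 <= f z u <= 1 by exact: spline01.
have f1 z u : u <= z -> f z u = 1.
  by move=> uz; apply: spline1; rewrite pmulr_rle0// subr_le0.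
have f0 z u : z + 3 * w < u -> f z u = 0.
  move=> uz; apply: spline0; rewrite mulrC ler_pdivlMr//; lra.
have e2 : 0 < e / 2 by rewrite divr_gt0.
(* The spline that starts to fall at [x] bounds the distribution function at [x] from above; the one
   that reaches 0 at [x] bounds it from below. *)
have [a1 [b1 [C1 t1]]] := taylor3_scale x wV0 (spline_taylor3 R).
have [a2 [b2 [C2 t2]]] := taylor3_scale (x - 3 * w) wV0 (spline_taylor3 R).
have near1 := smooth_cvg _ _ _ _ _ t1 (f01 x) e2.
have near2 := smooth_cvg _ _ _ _ _ t2 (f01 (x - 3 * w)) e2.
near=> n.
have m1 : measurable_fun setT (f x) by case: t1 => [[]].
have m2 : measurable_fun setT (f (x - 3 * w)) by case: t2 => [[]].
have h1 : `|\int[P n]_t f x (Z n t) - smooth 1 (f x) 0| <= e / 2 by near: n.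
have h2 : `|\int[P n]_t f (x - 3 * w) (Z n t) - smooth 1 (f (x - 3 * w)) 0| <= e / 2 by near: n.
have /andP[k1 _] := cdf_sandwich (P n) (mZ n) m1 (f01 x) (f1 x) (f0 x).
have /andP[_ k2] := cdf_sandwich (P n) (mZ n) m2 (f01 _) (f1 _) (f0 (x - 3 * w)).
have /andP[_ k3] := smooth1_sandwich m1 (f01 x) (f1 x) (f0 x).
have /andP[k4 _] := smooth1_sandwich m2 (f01 _) (f1 _) (f0 (x - 3 * w)).
have w3 : 0 <= 3 * w by lra.
have k5 := std_normal_cdf_lipschitz x w3.
have k6 := std_normal_cdf_lipschitz (x - 3 * w) w3.
rewrite subrK in k2 k6.
move: h1 h2; rewrite !ler_norml => /andP[h1 h1'] /andP[h2 h2'].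
have we : 3 * w = e / 2 by rewrite /w; field.
rewrite /=; apply/andP; split; lra.
Unshelve. all: by end_near.
Qed.
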